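(* Let $\Gamma$ be a metric graph of genus $g$ that is neither a point nor a circle. Let $0\le d\le g$ and let $D$ be a divisor of degree $d$ on $\Gamma$ with $|D|\neq\emptyset$ (that is, $D$ is linearly equivalent to some effective divisor). Then $|D|$ contains a semibreak divisor.
   Context: A metric graph is a compact connected metric space $\Gamma$ in which every point has a neighborhood isometric to a star-shaped set $\{te^{2\pi i k/n}\in\mathbb{C} : 0\le t<r,\ k\in\mathbb{Z}\}$ (finite valency $n$, radius $r>0$) with the path metric; $n$ is the valency of the point. Its genus is $g=\dim H_1(\Gamma;\mathbb{R})$. $V_\Gamma$ is the finite set of branch points (points of valency $\ne 2$). The open edges of $\Gamma$ are the connected components of $\Gamma\setminus V_\Gamma$; an open edge segment is a (nonempty) open connected subset of an open edge. A divisor is an element $D=\sum_p D(p)\,(p)$ of the free abelian group on the points of $\Gamma$; $\deg D=\sum_p D(p)$; $D$ is effective if all $D(p)\ge 0$; $E\le D$ means $D-E$ is effective. $R(\Gamma)$ is the group of continuous piecewise affine functions $\phi:\Gamma\to\mathbb{R}$ with integer slopes (finitely many slope changes on each edge), and $\mathrm{div}(\phi)=\sum_p\sigma_p(\phi)(p)$, where $\sigma_p(\phi)$ is the sum of incoming slopes of $\phi$ at $p$ (i.e. minus the sum of the outgoing slopes). $D_1\sim D_2$ (linear equivalence) means $D_1-D_2=\mathrm{div}(\phi)$ for some $\phi\in R(\Gamma)$. $|D|$ is the set of effective divisors linearly equivalent to $D$. A break divisor is a divisor $(p_1)+\cdots+(p_g)$ for which there exist pairwise disjoint open edge segments $e_1,\dots,e_g$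 with $p_i\in\overline{e_i}$ and such that $\Gamma\setminus\bigcup_{i=1}^g e_i$ is contractible. A semibreak divisor is an effective divisor $E$ such that $E\le D$ for some break divisor $D$. *)

(* Defs.v *)
From HB Require Import structures.
From mathcomp Require Import all_boot all_order all_algebra.
From mathcomp Require Import all_classical all_reals all_analysis.
From mathcomp.multinomials Require Import freeg.

Set Implicit Arguments.
Unset Strict Implicit.
Unset Printing Implicit Defensive.

Import Order.TTheory GRing.Theory Num.Theory numFieldNormedType.Exports.

Local Open Scope classical_set_scope.
Local Open Scope ring_scope.

Section Topology.
Context {R : realType}.

Definition contractible (T : topologicalType) (A : set T) : Prop :=
  exists2 a, A a & exists H : T * R -> T,
    [/\ {within A `*` `[0, 1], continuous H},
        forall x t, A x -> 0 <= t <= 1 -> A (H (x, t)),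
        forall x, A x -> H (x, 0) = x &
        forall x, A x -> H (x, 1) = a].

Definition homeomorphic (X Y : topologicalType) : Prop :=
  exists (f : X -> Y) (h : Y -> X),
    [/\ continuous f, continuous h, cancel f h & cancel h f].

Definition unit_circle : set (R * R) := [set z | z.1 ^+ 2 + z.2 ^+ 2 = 1].

Definition is_circle (X : topologicalType) : Prop :=
  homeomorphic X (set_type unit_circle).

Definition is_point (X : Type) : Prop := exists p : X, [set: X] = [set p].

(* The singular chain complex of X with coefficients in R.                    *)

Definition std_simplex (n : nat) : set 'rV[R]_n.+1 :=
  [set x | (forall i, 0 <= x ord0 i) /\ \sum_i x ord0 i = 1].

(* The i-th face inclusion inserts a zero barycentric coordinate at place i.  *)
Definition coface_mx n (i : 'I_n.+2) (x : 'rV[R]_n.+1) : 'rV[R]_n.+2 :=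
  \row_j oapp (x ord0) 0 (unlift i j).

Lemma coface_subproof n (i : 'I_n.+2) (x : set_type (@std_simplex n)) :
  coface_mx i (set_val x) \in @std_simplex n.+1.
Proof.
have [x0 x1] := set_valP x; apply/mem_set; split.
  by move=> j; rewrite mxE; case: unliftP => [k _|_] //=.
rewrite -x1 (bigD1_ord i) //= mxE unlift_none /= add0r.
by apply: eq_bigr => j _; rewrite mxE liftK.
Qed.

Definition coface n (i : 'I_n.+2) (x : set_type (@std_simplex n)) :
  set_type (@std_simplex n.+1) := SigSub (coface_subproof i x).

Lemma coface_mx_continuous n (i : 'I_n.+2) : continuous (@coface_mx n i).
Proof.
move=> x A [B nB sBA].
have Bx a j : B a j (coface_mx i x a j) := nbhs_singleton (nB a j).
exists (fun a k => B a (fintype.lift i k)).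
  by move=> a k; have := nB a (fintype.lift i k); rewrite mxE liftK /= (ord1 a).
move=> y By; apply: sBA => a j; have := Bx a j; rewrite !mxE.
by case: unliftP => [k ->|->] //= _; have := By a k; rewrite (ord1 a).
Qed.

Lemma coface_continuous n (i : 'I_n.+2) : continuous (@coface n i).
Proof.
apply: continuous_comp_initial => x /=.
apply: (@continuous_comp _ _ _ set_val (@coface_mx n i)).
  exact: initial_continuous.
exact: coface_mx_continuous.
Qed.

HB.instance Definition _ n (i : 'I_n.+2) :=
  isContinuous.Build _ _ (@coface n i) (@coface_continuous n i).

Definition singular_simplex (X : topologicalType) (n : nat) :=
  continuousType (set_type (@std_simplex n)) X.

Definition singular_chain (X : topologicalType) (n : nat) :=
  {freeg (singular_simplex X n) / R}.

Definition face (X : topologicalType) n (i : 'I_n.+2)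
    (s : singular_simplex X n.+1) : singular_simplex X n := s \o coface i.

Definition boundary (X : topologicalType) (n : nat) :
    singular_chain X n.+1 -> singular_chain X n :=
  fglift (fun s => \sum_(i < n.+2) (-1) ^+ i *: << face i s >>).

(* [has_genus X g] : dim H_1(X; R) = g, where H_1 = ker d_1 / im d_2; the     *)
(* classes of the cycles z_0, ..., z_(g-1) form a basis of the quotient.      *)
Definition has_genus (X : topologicalType) (g : nat) : Prop :=
  exists z : 'I_g -> singular_chain X 1,
    (forall i, boundary (z i) = 0) /\
    forall c : singular_chain X 1, boundary c = 0 ->
      exists! a : {ffun 'I_g -> R},
        exists b : singular_chain X 2, c - \sum_i a i *: z i = boundary b.

End Topology.

Section MetricGraph.
Context {R : realType} {Gamma : metricType R}.
Implicit Types (p x : Gamma) (n g : nat) (r : R) (D E : {freeg Gamma / int})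
  (phi : Gamma -> R).

(* The star-shaped set {t e^(2 pi i k / n) : 0 <= t < r} in polar             *)
(* coordinates (k, t), with its path metric; the points (k, 0) all denote the *)
(* centre, at distance 0 from each other. For n = 0 there are no pairs (k, t) *)
(* and the star is its centre alone (cf. [star_chart]).                       *)
Definition star n r : set ('I_n * R) := [set u | 0 <= u.2 < r].

Definition star_dist n (u v : 'I_n * R) : R :=
  if u.1 == v.1 then `|u.2 - v.2| else u.2 + v.2.

(* f is an isometry of the star onto a neighbourhood of p, with centre p.     *)
Definition star_chart p n r (f : 'I_n * R -> Gamma) : Prop :=
  [/\ 0 < r,
      forall k, f (k, 0) = p,
      forall u v, star r u -> star r v -> mdist (f u) (f v) = star_dist u v &
      nbhs p (p |` (f @` star r))].

Definition has_valency p n : Prop :=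
  exists r (f : 'I_n * R -> Gamma), star_chart p r f.

Definition is_metric_graph : Prop :=
  [/\ [set: Gamma] !=set0, compact [set: Gamma], connected [set: Gamma] &
      forall p, exists n, has_valency p n].

Definition branch_points : set Gamma :=
  [set p | exists2 n, has_valency p n & n <> 2%N].

Definition open_edge (e : set Gamma) : Prop :=
  exists2 x, ~ branch_points x & e = connected_component (~` branch_points) x.

Definition open_edge_segment (s : set Gamma) : Prop :=
  [/\ s !=set0, open s, connected s & exists2 e, open_edge e & s `<=` e].

Definition effective D : Prop := fgle 0 D.

Definition affine_int_near phi x : Prop :=
  exists r (f : 'I_2 * R -> Gamma) (m : int), star_chart x r f /\
    forall t, 0 <= t < r ->
      phi (f (ord0, t)) = phi x + m%:~R * t /\
      phi (f (ord_max, t)) = phi x - m%:~R * t.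

(* R(Gamma): the finite set S consists of the branch points and the points    *)
(* where the slope changes.                                                   *)
Definition piecewise_affine_int phi : Prop :=
  continuous phi /\
  exists S : set Gamma,
    [/\ finite_set S, branch_points `<=` S &
        forall x, ~ S x -> affine_int_near phi x].

(* m is the sum of the incoming slopes of phi at p; a k is the outgoing slope *)
(* along the k-th ray.                                                        *)
Definition has_incoming_slope_sum phi p (m : int) : Prop :=
  exists n r (f : 'I_n * R -> Gamma) (a : 'I_n -> int),
    [/\ star_chart p r f,
        forall k t, 0 <= t < r -> phi (f (k, t)) = phi p + (a k)%:~R * t &
        m = - \sum_k a k].

Definition is_div phi D : Prop :=
  forall p, has_incoming_slope_sum phi p (coeff p D).

Definition lin_equiv D1 D2 : Prop :=
  exists2 phi, piecewise_affine_int phi & is_div phi (D1 - D2).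

Definition complete_linear_system D : set {freeg Gamma / int} :=
  [set E | effective E /\ lin_equiv E D].

(* In [break_divisor] and [semibreak_divisor], g is the genus of Gamma.       *)
Definition break_divisor g D : Prop :=
  exists (p : 'I_g -> Gamma) (e : 'I_g -> set Gamma),
    [/\ D = \sum_(i < g) << p i >>,
        forall i, open_edge_segment (e i),
        trivIset [set: 'I_g] e,
        forall i, closure (e i) (p i) &
        contractible (R := R) (~` \bigcup_i e i)].

Definition semibreak_divisor g E : Prop :=
  effective E /\ exists2 D, break_divisor g D & fgle E D.

End MetricGraph.

Arguments is_metric_graph {R} Gamma.

(* Main.v *)
Require Import Defs.
From HB Require Import structures.
From mathcomp Require Import all_boot all_order all_algebra.

(* Cut the graph at finitely many points into a finite multigraph whose edges
   are isometric arcs, with all chips of the given effective divisor at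
   vertices. Chips are placed one at a time. A placed chip sits on a closed edge
   of a set F whose removal leaves the graph connected; let x be the position of
   the next chip. As long as fewer than g edges are in F, some cycle avoids F.
   If an edge at x outside F lies on such a cycle, it is added to F and the chip
   rests on it. Otherwise a bridge h at x separates x from a side B containing a
   cycle, and every other edge leading to B is in F, hence carries a chip. Put
   the chip x on h and fire the complement of B: all chips on the cut move
   towards B at unit speed until one of them, on an edge e say, reaches a vertex
   x' of B. Trading h for e keeps the graph connected, and x' is the next free
   chip, strictly deeper on the side of the cycle; so this stops.
   The number of edges off a spanning tree is g = dim H_1: modulo boundaries a
   path only depends on the arcs it follows, so the fundamental cycles of the
   tree span, and the winding numbers around the arcs show that they are
   independent. *)

Set Implicit Arguments.
Unset Strict Implicit.
Unset Printing Implicit Defensive.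

Import Order.TTheory GRing.Theory Num.Theory.

Local Open Scope ring_scope.

(** * Spanning trees and cuts of finite multigraphs *)

(** A break divisor only asks that each point lie in the closure of its segment. A chip may
    therefore rest at an end of its edge, and the exact position on the edge never matters; what has
    to be kept is that the free edges, written [S] below, connect all vertices. The obstacle is a
    vertex x all of whose free edges are bridges. There B is taken to be the component of the cycle
    after x is deleted from the free graph: two free edges from x to this component would lie on a
    common cycle, so exactly one free edge h leads there. Once the new chip is put on h, every edge
    of the cut carries exactly one chip, which is what a function of slope 1 across the cut
    requires, and stopping at the first arrival keeps all chips on their closed edges. The waiting
    time may be 0; the process still advances, because progress is measured by the number of
    vertices of B and not by distance. For independence of the cycles no covering space or map to a
    circle is built. Crossings of the midpoint of an arc form a function of two nearby points that
    is locally a difference; its primitive along a path gives the winding number, and a primitive on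
    a whole 2-simplex shows that boundaries have none. *)

Section Graph.
Context {V E : finType} (src tgt : E -> V).
Implicit Types (S T : {set E}) (A B W : {set V}) (e h : E) (u v x y : V).

Definition ends e u v :=
  (src e == u) && (tgt e == v) || (src e == v) && (tgt e == u).

Definition joined S u v := [exists e in S, ends e u v].

Definition connecting S := forall u v, connect (joined S) u v.

Definition crossing B e := (src e \in B) (+) (tgt e \in B).

Lemma ends_sym e u v : ends e u v = ends e v u.
Proof. by rewrite /ends orbC. Qed.

Lemma endsP e : ends e (src e) (tgt e).
Proof. by rewrite /ends !eqxx. Qed.

Lemma joined_sym S : symmetric (joined S).
Proof. by move=> u v; apply: eq_existsb => e; rewrite ends_sym. Qed.

Lemma joined_connect_sym S u v :
  connect (joined S) u v = connect (joined S) v u.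
Proof. by apply: sym_connect_sym; exact: joined_sym. Qed.

Lemma joined_edge S e u v : e \in S -> ends e u v -> connect (joined S) u v.
Proof. by move=> eS euv; apply/connect1/existsP; exists e; rewrite eS. Qed.

Lemma sub_connecting S S' : {subset S <= S'} -> forall u v,
  connect (joined S) u v -> connect (joined S') u v.
Proof.
move=> SS'; apply: connect_sub => u v /existsP[e /andP[/SS' eS' euv]].
exact: joined_edge euv.
Qed.

Lemma connect_stable S A u v : (forall e, e \in S -> ~~ crossing A e) ->
  connect (joined S) u v -> (u \in A) = (v \in A).
Proof.
move=> hA /connectP[p pth ->] {v}; elim: p u pth => [|w p IH] u //=.
case/andP=> /existsP[e /andP[eS euw]] /IH <-.
move: (hA _ eS); rewrite /crossing.
by case/orP: euw => /andP[/eqP -> /eqP ->]; case: (_ \in _); case: (_ \in _).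
Qed.

Lemma connecting_cross S A u v : connecting S -> u \in A -> v \notin A ->
  exists2 e, e \in S & crossing A e.
Proof.
move=> cS uA vA; apply/exists_inP; apply: contraTT uA.
rewrite negb_exists_in => /forall_inP hA.
by rewrite (connect_stable hA (cS u v)).
Qed.

Lemma crossing_ends A e : crossing A e ->
  exists u v, [/\ ends e u v, u \in A & v \notin A].
Proof.
rewrite /crossing; case sA: (src e \in A); case tA: (tgt e \in A) => // _.
  by exists (src e), (tgt e); rewrite endsP sA tA.
by exists (tgt e), (src e); rewrite ends_sym endsP sA tA.
Qed.

Lemma ends_crossing A e u v : ends e u v -> u \in A -> v \notin A ->
  crossing A e.
Proof.
by rewrite /crossing => /orP[] /andP[/eqP -> /eqP ->] -> /negbTE ->.
Qed.

(** Generation by leaves makes counting edges, defining potentials and contracting the realised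
    graph inductions on this predicate; acyclicity is never stated. *)
Inductive tree (r : V) : {set V} -> {set E} -> Prop :=
| tree_root : tree r [set r] set0
| tree_leaf W T e u v : tree r W T -> u \in W -> v \notin W -> ends e u v ->
    tree r (v |: W) (e |: T).

Lemma tree_edge r W T e : tree r W T -> e \in T -> src e \in W /\ tgt e \in W.
Proof.
elim=> [|{}W {}T e' u v _ IH uW vW euv]; first by rewrite !inE.
rewrite !inE; case: eqP => [-> _|_ /= /IH[-> ->]]; last by rewrite !orbT.
by case/orP: euv => /andP[/eqP -> /eqP ->]; rewrite eqxx uW !orbT.
Qed.

Lemma tree_card r W T : tree r W T -> #|W| = #|T|.+1.
Proof.
elim=> [|{}W {}T e u v tWT IH uW vW euv]; first by rewrite cards1 cards0.
rewrite !cardsU1 vW IH; suff -> : e \notin T by [].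
apply: contra vW => /(tree_edge tWT)[].
by case/orP: euv => /andP[/eqP -> /eqP ->].
Qed.

Lemma tree_root_in r W T : tree r W T -> r \in W.
Proof.
by elim=> [|{}W {}T e u v _ IH _ _ _]; rewrite !inE ?eqxx ?IH ?orbT.
Qed.

Lemma tree_connect r W T u : tree r W T -> u \in W -> connect (joined T) r u.
Proof.
move=> tWT; elim: tWT u => [u|{}W {}T e w v tWT IH wW vW ewv u].
  by rewrite inE => /eqP ->.
have IH' z : z \in W -> connect (joined (e |: T)) r z.
  move=> /IH; apply: sub_connecting => e'; rewrite inE => ->.
  by rewrite orbT.
rewrite inE => /orP[|/IH' //]; rewrite inE => /eqP ->.
apply: connect_trans (IH' w wW) _; apply: (joined_edge (e := e)) => //.
by rewrite !inE eqxx.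
Qed.

(** As long as a tree misses a vertex, some edge of [S] leaves it and adds a leaf; so trees of every
    size up to #|V| are found inside [S]. *)
Lemma spanning_tree S r : connecting S ->
  exists2 T : {set E}, T \subset S & tree r [set: V] T.
Proof.
move=> cS.
have grow n : (n < #|V|)%N -> exists (W : {set V}) (T : {set E}),
    [/\ tree r W T, T \subset S & #|W| = n.+1].
  elim: n => [_|n IH nV].
    by exists [set r], set0; rewrite sub0set cards1; split => //; constructor.
  have [W [T [tWT TS cW]]] := IH (ltnW nV).
  have [v vW] : exists v, v \notin W.
    apply/existsP; apply: contraTT nV; rewrite negb_exists => /forallP allW.
    rewrite -leqNgt -cW; apply: subset_leq_card; apply/subsetP => z _.
    by have := allW z; rewrite negbK.
  have [e eS /crossing_ends[u [w [euw uW wW]]]] :=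
    connecting_cross cS (tree_root_in tWT) vW.
  exists (w |: W), (e |: T); split; first exact: tree_leaf euw.
    by rewrite subUset sub1set eS.
  by rewrite cardsU1 wW cW.
have V0 : (0 < #|V|)%N by apply/card_gt0P; exists r.
have [W [T [tWT TS]]] := grow #|V|.-1 (ltac:(by rewrite prednK)).
rewrite prednK // => cW; exists T => //.
have -> : [set: V] = W; last by [].
apply/esym/eqP; rewrite eqEcard subsetT cardsT cW leqnn //.
Qed.

Lemma tree_spanning_connecting r T : tree r [set: V] T -> connecting T.
Proof.
move=> tT u v; apply: (@connect_trans _ _ r).
  by rewrite joined_connect_sym; apply: tree_connect tT _; rewrite inE.
by apply: tree_connect tT _; rewrite inE.
Qed.

(** A spanning tree inside [S] has #|V| - 1 edges, so some edge of [S] lies off it, and its removal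
    leaves the tree intact. *)
Lemma removable_edge S (r : V) : connecting S -> (#|V| <= #|S|)%N ->
  exists2 e, e \in S & connecting (S :\ e).
Proof.
move=> cS VS; have [T TS tT] := spanning_tree r cS.
have cT := tree_card tT; rewrite cardsT in cT.
have /subsetPn[e eS eT] : ~~ (S \subset T).
  by apply: contraTN VS => /subset_leq_card ST; rewrite -ltnNge cT ltnS.
exists e => // u v; apply: sub_connecting (tree_spanning_connecting tT u v).
move=> e' e'T; rewrite !inE (subsetP TS _ e'T) andbT.
by apply: contraNneq eT => <-.
Qed.

(** On a tree every function of the edges is a coboundary. For the genus, [M] is the group of
    singular 1-chains and [P v] plays the part of the tree path from the root to v. *)
Lemma tree_potential (M : zmodType) (q : E -> M) r W T : tree r W T ->
  exists2 P : V -> M, P r = 0 & forall e, e \in T -> P (tgt e) - P (src e) = q e.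
Proof.
elim=> [|{}W {}T e u v tWT [P Pr hP] uW vW euv].
  by exists (fun=> 0) => // e; rewrite inE.
(* The new leaf gets the value forced by [e]; the sign depends on whether [e] points towards [v]. *)
pose P' z := if z == v then
  (if src e == u then P u + q e else P u - q e) else P z.
have P'W z : z \in W -> P' z = P z.
  by rewrite /P'; case: eqP vW => // -> /negbTE ->.
exists P'; first by rewrite P'W // (tree_root_in tWT).
move=> e'; rewrite !inE; case: eqP => [-> _|_ /= e'T]; last first.
  by have [s t] := tree_edge tWT e'T; rewrite !P'W // hP.
have uv : u != v by apply: contraNneq vW => <-.
case/orP: euv => /andP[/eqP e1 /eqP e2]; rewrite e1 e2 (P'W u uW) /P' eqxx e1.
  by rewrite eqxx addrAC subrr add0r.
by rewrite eq_sym (negbTE uv) opprB addrC subrK.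
Qed.

Lemma connecting_cut S A h x y : connecting S -> ends h x y ->
  x \in A -> y \notin A ->
  (forall e, e \in S -> crossing A e -> e = h) ->
  forall u, u \in A -> connect (joined (S :\ h)) u x.
Proof.
move=> cS hxy xA yA uniq u uA.
(* [W] is the component of [x] without [h], together with everything off [A]. No edge of [S] leaves
   it: [h] has both ends in [W], and no other edge of [S] crosses [A]. So [W] contains all
   vertices. *)
pose W := [set z | connect (joined (S :\ h)) z x || (z \notin A)].
have stW e : e \in S -> ~~ crossing W e.
  move=> eS; apply/negP => /crossing_ends[a [b [eab]]]; rewrite !inE.
  rewrite negb_or negbK => + /andP[bx bA].
  have [eh|eh] := eqVneq e h.
    move: eab; rewrite eh => /orP[] /andP[/eqP ha /eqP hb];
      case/orP: hxy => /andP[/eqP hx /eqP hy].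
    - by move: yA; rewrite -hy hb bA.
    - by move: bx; rewrite -hb hy connect0.
    - by move: bx; rewrite -ha hx connect0.
    - by move: yA; rewrite -hx ha bA.
  case/orP => [ax|aA].
    case/negP: bx; apply: connect_trans ax; rewrite joined_connect_sym.
    by apply: joined_edge eab; rewrite !inE eh.
  case/eqP: eh; apply: uniq => //; apply: ends_crossing bA aA.
  by rewrite ends_sym.
have := connect_stable stW (cS u x).
by rewrite !inE uA connect0 orbF /= => ->.
Qed.

(** By [connecting_cut] each side of the cut stays connected without [h], and [e] joins the two
    sides again. *)
Lemma exchange S B h e : connecting S -> crossing B h -> crossing B e ->
  (forall e', e' \in S -> crossing B e' -> e' = h) ->
  connecting (e |: S :\ h).
Proof.
move=> cS /crossing_ends[y [x [hyx yB xB]]] /crossing_ends[b [a [eba bB aB]]].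
move=> uniq.
have cC e' : crossing (~: B) e' = crossing B e'.
  by rewrite /crossing !inE; case: (_ \in _); case: (_ \in _).
have inB u : u \in B -> connect (joined (e |: S :\ h)) u y.
  move=> /(connecting_cut cS hyx yB xB uniq).
  by apply: sub_connecting => ?; rewrite !inE orbC => ->.
have inA u : u \notin B -> connect (joined (e |: S :\ h)) u x.
  move=> uB; have := @connecting_cut S (~: B) h x y cS _ _ _ _ u.
  rewrite !inE negbK ends_sym => /(_ hyx xB yB) H.
  have {}H : connect (joined (S :\ h)) u x by apply: H => // e' ?; rewrite cC; exact: uniq.
  by apply: sub_connecting H => ?; rewrite !inE orbC => ->.
have xy : connect (joined (e |: S :\ h)) x y.
  apply: (@connect_trans _ _ a); first by rewrite joined_connect_sym; exact: inA.
  apply: (@connect_trans _ _ b); last exact: inB.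
  by rewrite ends_sym in eba; apply: joined_edge eba; rewrite !inE eqxx.
have toy u : connect (joined (e |: S :\ h)) u y.
  case: (boolP (u \in B)) => [/inB //|/inA ux]; exact: connect_trans ux xy.
move=> u v; apply: connect_trans (toy u) _.
by rewrite joined_connect_sym; exact: toy.
Qed.

Lemma connecting_remove S e : connecting S ->
  connect (joined (S :\ e)) (src e) (tgt e) -> connecting (S :\ e).
Proof.
move=> cS ce u v; move: (cS u v); apply: connect_sub => {u v} u v.
case/existsP=> e' /andP[e'S e'uv]; have [ee|ne] := eqVneq e' e.
  rewrite ee in e'uv; case/orP: e'uv => /andP[/eqP <- /eqP <-] //.
  by rewrite joined_connect_sym.
by apply: joined_edge e'uv; rewrite !inE ne.
Qed.

(* [B'] is the component of [e0] in what remains of S after deleting x. *)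
Lemma narrow_cut S B x e0 : connecting S -> e0 \in S -> connecting (S :\ e0) ->
  x \in B -> src e0 \in B -> tgt e0 \in B ->
  (forall e u v, e \in S -> ends e u v -> u \in B -> v \notin B -> u = x) ->
  (forall e, e \in S -> (src e == x) || (tgt e == x) -> ~ connecting (S :\ e)) ->
  exists (B' : {set V}) (h : E), [/\ B' \subset B :\ x,
    src e0 \in B', tgt e0 \in B', h \in S &
    [/\ crossing B' h, (src h == x) || (tgt h == x) &
     forall e, e \in S -> crossing B' e -> e = h]].
Proof.
move=> cS e0S cS0 xB s0B t0B crossB noremove.
pose S' := [set e in S | (src e != x) && (tgt e != x)].
pose B' := [set z | connect (joined S') (src e0) z].
(* No edge at [x] is removable, whereas [e0] is; hence [e0] avoids [x]. *)
have s0x : src e0 != x.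
  by apply/eqP => s0x; apply: (noremove e0) => //; rewrite s0x eqxx.
have t0x : tgt e0 != x.
  by apply/eqP => t0x; apply: (noremove e0) => //; rewrite t0x eqxx orbT.
have e0S' : e0 \in S' by rewrite inE e0S s0x.
have s0B' : src e0 \in B' by rewrite inE connect0.
have t0B' : tgt e0 \in B' by rewrite inE; apply: (joined_edge e0S'); exact: endsP.
have stable e : e \in S' -> ~~ crossing B' e.
  move=> eS'; apply/negP => /crossing_ends[u [v [euv]]]; rewrite !inE => us.
  case/negP; apply: connect_trans us _; exact: joined_edge euv.
have xB' : x \notin B'.
  have st e : e \in S' -> ~~ crossing [set x] e.
    by rewrite !inE /crossing !inE => /and3P[_ /negbTE -> /negbTE ->].
  rewrite inE; apply/negP => /(connect_stable st).
  by rewrite !inE eqxx (negbTE s0x).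
have crossx e : e \in S -> crossing B' e -> (src e == x) || (tgt e == x).
  move=> eS; apply: contraTT; rewrite negb_or => ne; apply: stable.
  by rewrite inE eS.
have [h hS hB'] := connecting_cross cS s0B' xB'.
exists B', h; split => //.
- apply/subsetP => z zB'; rewrite !inE; apply/andP; split.
    by apply: contraNneq xB' => <-.
  (* Edges of [S] leave [B] only at [x], which the edges of [S'] avoid; so the component [B'] stays
     in [B]. *)
  have st e : e \in S' -> ~~ crossing B e.
    rewrite inE => /and3P[eS sx tx]; apply/negP => /crossing_ends[u [v [euv uB vB]]].
    have := crossB _ _ _ eS euv uB vB => ux.
    case/orP: euv => /andP[/eqP es /eqP et]; first by rewrite es ux eqxx in sx.
    by rewrite et ux eqxx in tx.
  by move: zB'; rewrite inE => /(connect_stable st) <-.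
split=> //; first exact: crossx.
(* A second edge [e] leaving [B'] would also end at [x]. Together with [h] and a path inside [B'] it
   would close a cycle, so it would be a removable edge at [x]. *)
move=> e eS eB'; apply/eqP; apply: contraT => eh; exfalso.
have ex := crossx _ eS eB'; have hx := crossx _ hS hB'.
apply: (noremove e) => //; apply: connecting_remove => //.
have inner u v : u \in B' -> v \in B' -> connect (joined (S :\ e)) u v.
  rewrite !inE => su sv; apply: sub_connecting (_ : connect (joined S') u v).
    move=> e'; rewrite !inE => /and3P[-> sx tx]; rewrite andbT.
    by apply: contraTneq ex => <-; rewrite negb_or sx.
  by apply: connect_trans sv; rewrite joined_connect_sym.
have [u [v [euv uB' vB']]] := crossing_ends eB'.
have [u' [v' [hu uhB' vhB']]] := crossing_ends hB'.
have vx : v = x.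
  case/orP: euv => /andP[/eqP es /eqP et]; case/orP: ex => /eqP ex;
   rewrite ?es ?et in ex => //; by rewrite ex (negbTE xB') in uB'.
have vx' : v' = x.
  case/orP: hu => /andP[/eqP es /eqP et]; case/orP: hx => /eqP ex';
   rewrite ?es ?et in ex' => //; by rewrite ex' (negbTE xB') in uhB'.
have uv : connect (joined (S :\ e)) u v.
  apply: connect_trans (inner u u' uB' uhB') _; rewrite vx -vx'.
  by apply: joined_edge hu; rewrite !inE hS eq_sym eh.
by case/orP: euv => /andP[/eqP -> /eqP ->] //; rewrite joined_connect_sym.
Qed.

End Graph.

From mathcomp Require Import all_classical all_reals all_analysis.
From mathcomp.multinomials Require Import freeg.
From mathcomp Require Import ring lra.

Import numFieldNormedType.Exports.

Local Open Scope classical_set_scope.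
Local Open Scope ring_scope.

(** * Star charts and finite models of a metric graph *)

Section Intervals.
Context {R : realType}.

(** The near-covering form of compactness turns radii that are good near each point into a common
    one. Since [G] is a property of sets that passes to subsets, no cover has to be indexed. *)
Lemma lebesgue_number (X : pseudoMetricType R) (K : set X)
    (G : set X -> Prop) :
  compact K -> (forall A B, A `<=` B -> G B -> G A) ->
  (forall x, K x -> exists2 U, nbhs x U & G U) ->
  exists2 eta : R, 0 < eta & forall x, K x -> G (ball x eta).
Proof.
move=> /compact_near_coveringP cK Gmono Gloc.
have /cK : forall x, K x ->
    \forall x' \near x & e \near (0:R)^'+, G (ball x' e).
  move=> x /Gloc [U /nbhs_ballP[r /= r0 rU] GU].
  exists (ball x (r/2), [set e | 0 < e < r/2]).
    split => /=; first by apply: nbhsx_ballx; rewrite divr_gt0.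
    near=> e; apply/andP; split; near: e; first exact: nbhs_right_gt.
    by apply: nbhs_right_lt; rewrite divr_gt0.
  move=> [x' e] [/= xx' /andP[e0 er]]; apply: Gmono GU => y x'y.
  apply: rU; rewrite (splitr r); apply: ball_triangle xx' _.
  exact: le_ball (ltW er) _ x'y.
move=> H.
have [e [He e0]] := filter_ex (filterI H (nbhs_right_gt (0 : R))).
by exists e.
Unshelve. all: by end_near. Qed.

(** Continuous induction: a Lebesgue number cuts the interval into finitely many steps on which [Q]
    holds. It serves for local constancy, for comparing primitives of a cocycle and for subdividing
    singular paths. *)
Lemma interval_chain (Q : R -> R -> Prop) (l : R) : 0 <= l ->
  (forall a b c, Q a b -> Q b c -> Q a c) ->
  (forall x, 0 <= x <= l -> exists2 e, 0 < e & forall a b,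
     0 <= a <= l -> 0 <= b <= l -> `|a - x| < e -> `|b - x| < e -> Q a b) ->
  Q 0 l.
Proof.
move=> l0 Qtrans Qloc.
have [] := @lebesgue_number R^o `[0, l]
  (fun U => forall a b, 0 <= a <= l -> 0 <= b <= l -> U a -> U b -> Q a b).
- exact: segment_compact.
- by move=> A B AB QB a b ha hb /AB Ba /AB Bb; exact: QB.
- move=> x /=; rewrite in_itv /= => /Qloc [e e0 He].
  exists (ball x e); first exact: nbhsx_ballx.
  by move=> a b ha hb; rewrite /ball /= ![`|x - _|]distrC; exact: He.
move=> e e0 He.
have [N NE] : exists N : nat, l < N%:R * (e / 2).
  exists (Num.truncn (l / (e / 2))).+1.
  by rewrite -ltr_pdivrMr ?divr_gt0// truncnS_gt.
(* Steps of e / 2 stay inside balls of radius e, and the minimum makes the sequence end exactly at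
   [l]. *)
pose a (n : nat) : R := Num.min l (n%:R * (e / 2)).
have ha n : 0 <= a n <= l.
  by rewrite /a le_min l0 ge_min lexx /= mulr_ge0 ?divr_ge0 ?ler0n// ltW.
have step n : Q (a n) (a n.+1).
  apply: (He (a n)) => //; rewrite /ball /= ?subrr ?normr0 ?in_itv //=.
  rewrite distrC.
  have a1 : a n <= a n.+1.
    rewrite /a le_min ge_min lexx /= ge_min.
    by apply/orP; right; rewrite ler_wpM2r ?divr_ge0 ?(ltW e0) ?ler_nat.
  rewrite ger0_norm ?subr_ge0//.
  have : a n.+1 <= a n + e / 2.
    have [h|h] := leP l (n%:R * (e / 2)).
      have -> : a n = l by rewrite /a min_l.
      by rewrite ge_min lerDl divr_ge0 // ltW.
    have -> : a n = n%:R * (e / 2) by rewrite /a min_r // ltW.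
    by rewrite ge_min; apply/orP; right; rewrite -natr1 mulrDl mul1r.
  by lra.
have H n : Q (a 0%N) (a n).
  elim: n => [|n IH]; last exact: Qtrans IH (step n).
  by apply: (He (a 0%N)) => //; rewrite /ball /= ?subrr ?normr0 ?in_itv /=.
have := H N; rewrite /a mul0r (min_r l0) min_l //; exact: ltW.
Qed.

(** [P] may be an open interval: only the compact interval between [a] and [b], in either order, is
    traversed. *)
Lemma locally_constant (T : Type) (h : R -> T) (P : set R) (a b : R) :
  (forall x, P x -> exists2 e, 0 < e &
     forall y, P y -> `|y - x| < e -> h y = h x) ->
  (forall x, Num.min a b <= x <= Num.max a b -> P x) -> h a = h b.
Proof.
move=> hloc hP.
have hm t : 0 <= t <= 1 -> P (a + t * (b - a)).
  move=> /andP[t0 t1]; apply: hP; rewrite ge_min le_max.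
  have [ab|ba] := leP a b.
    have h1 := mulr_ge0 t0 (_ : 0 <= b - a).
    have h2 := mulr_ge0 (_ : 0 <= 1 - t) (_ : 0 <= b - a).
    rewrite !subr_ge0 in h1 h2; have {}h1 := h1 ab; have {}h2 := h2 t1 ab.
    by apply/andP; split; apply/orP; [left|right]; lra.
  have h1 := mulr_ge0 t0 (_ : 0 <= a - b).
  have h2 := mulr_ge0 (_ : 0 <= 1 - t) (_ : 0 <= a - b).
  rewrite !subr_ge0 in h1 h2; have {}h1 := h1 (ltW ba).
  have {}h2 := h2 t1 (ltW ba).
  by apply/andP; split; apply/orP; [right|left]; lra.
have := @interval_chain
  (fun s t => h (a + s * (b - a)) = h (a + t * (b - a))) 1 ler01.
rewrite mul0r addr0 mul1r [a + (b - a)]addrC subrK; apply.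
  by move=> ? ? ? -> ->.
move=> x /hm /hloc [e e0 He].
(* The added 1 keeps the divisor positive when a = b. *)
have d0 : 0 < `|b - a| + 1 by rewrite ltr_wpDl.
exists (e / (`|b - a| + 1)); first by rewrite divr_gt0.
suff Hx s : 0 <= s <= 1 -> `|s - x| < e / (`|b - a| + 1) ->
    h (a + s * (b - a)) = h (a + x * (b - a)).
  by move=> s t hs ht sx tx; rewrite !Hx.
move=> hs sx; apply: He; first exact: hm.
have -> : a + s * (b - a) - (a + x * (b - a)) = (s - x) * (b - a) by ring.
rewrite normrM; move: sx; rewrite ltr_pdivlMr //; apply: le_lt_trans.
by rewrite ler_wpM2l // lerDl.
Qed.

End Intervals.

(* Vertices may have valency 2: a model can be refined to contain any finite
   set of points. Loops are excluded by [arc_isometry]. *)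
Record model (R : realType) (Gamma : metricType R) := Model {
  vert : finType;
  edge : finType;
  vtx : vert -> Gamma;
  len : edge -> R;
  arc : edge -> R -> Gamma;
  src : edge -> vert;
  tgt : edge -> vert;
  vtx_inj : injective vtx;
  len_gt0 : forall e, 0 < len e;
  arc_src : forall e, arc e 0 = vtx (src e);
  arc_tgt : forall e, arc e (len e) = vtx (tgt e);
  arc_continuous : forall e, continuous (arc e);
  arc_isometry : forall e s t, 0 <= s <= len e -> 0 <= t <= len e ->
    mdist (arc e s) (arc e t) = `|s - t|;
  arc_open : forall e, open (arc e @` [set s | 0 < s < len e]);
  arc_disjoint : forall e e' s s', 0 < s < len e -> 0 < s' < len e' ->
    arc e s = arc e' s' -> e = e';
  arc_vtx : forall e s v, 0 < s < len e -> arc e s <> vtx v;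
  model_cover : forall x, (exists v, x = vtx v) \/
    (exists e s, 0 < s < len e /\ x = arc e s)
}.

Section ModelTopology.
Context {R : realType} {Gamma : metricType R} (M : model Gamma).
Local Notation V := (vert M).
Local Notation E := (edge M).
Implicit Types (e : E) (s t : R) (v : V) (p x y : Gamma).

Definition open_arc e := arc e @` [set s | 0 < s < len e].
Definition closed_arc e := arc e @` [set s | 0 <= s <= len e].

Lemma arc_inj e s t : 0 <= s <= len e -> 0 <= t <= len e ->
  arc e s = arc e t -> s = t.
Proof.
move=> hs ht st; have := arc_isometry hs ht; rewrite st mdistxx => /esym/eqP.
by rewrite normr_eq0 subr_eq0 => /eqP.
Qed.

Lemma arc_disjoint_closed e e' s s' : 0 < s < len e -> 0 <= s' <= len e' ->
  arc e s = arc e' s' -> e = e'.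
Proof.
move=> hs /andP[]; rewrite le_eqVlt => /predU1P[<- _|s0].
  by rewrite arc_src => /arc_vtx; case/(_ hs).
rewrite le_eqVlt => /predU1P[->|s1].
  by rewrite arc_tgt => /arc_vtx; case/(_ hs).
by apply: arc_disjoint => //; rewrite s0 s1.
Qed.

Lemma open_arc_open e : open (open_arc e).
Proof. exact: arc_open. Qed.

Lemma closed_arc_closed e : closed (closed_arc e).
Proof.
apply: compact_closed; first exact: metric_hausdorff.
rewrite /closed_arc; have -> : [set s | 0 <= s <= len e] = `[0, len e]%classic.
  by apply/seteqP; split => s /=; rewrite in_itv.
apply: continuous_compact; last exact: segment_compact.
by apply: continuous_subspaceT; exact: arc_continuous.
Qed.

(* Only finitely many closed arcs have to be avoided. *)
Lemma near_arcs p : exists2 rho : R, 0 < rho & forall y, mdist p y < rho ->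
  y = p \/ exists e s s', [/\ 0 <= s <= len e, 0 <= s' <= len e,
    p = arc e s & y = arc e s'].
Proof.
pose A e := if `[< closed_arc e p >] then [set: Gamma] else ~` closed_arc e.
pose B v := if `[< p = vtx v >] then [set: Gamma] else ~` [set vtx v].
have nA : \forall y \near p, forall e, A e y.
  apply: filter_forall => e; rewrite /A; case: asboolP => h; first exact: filterT.
  apply: open_nbhs_nbhs; split => //; apply: closed_openC.
  exact: closed_arc_closed.
have nB : \forall y \near p, forall v, B v y.
  apply: filter_forall => v; rewrite /B; case: asboolP => h; first exact: filterT.
  apply: open_nbhs_nbhs; split => //; apply: closed_openC.
  by apply: accessible_closed_set1; apply: hausdorff_accessible;
     exact: metric_hausdorff.
have [rho /= rho0 hrho] := (@nbhs_ballP R Gamma p _).1 (filterI nA nB).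
exists rho => // y py; have [] := hrho y; first by rewrite ballEmdist.
move=> Ay By; have [[v yv]|[e [s [hs ys]]]] := model_cover M y.
  left; have := By v; rewrite /B; case: asboolP => [->//|_ /=].
  by rewrite -yv.
right; have := Ay e; rewrite /A; case: asboolP => [[s' hs' ps'] _|_ /=].
  by exists e, s', s; split => //; case/andP: hs => /ltW -> /ltW ->.
by case; exists s => //=; case/andP: hs => /ltW -> /ltW ->.
Qed.

End ModelTopology.

(** * Star charts and the uniqueness of the valency *)

Section Charts.
Context {R : realType} {Gamma : metricType R}.
Implicit Types (p x y z : Gamma) (n : nat) (r t : R).

Lemma chart_center p n r (f : 'I_n * R -> Gamma) k t : star_chart p r f ->
  0 <= t < r -> mdist p (f (k, t)) = t.
Proof.
move=> [r0 fp fd _] /andP[t0 tr]; rewrite -(fp k) fd /star /= ?lexx ?t0 //.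
by rewrite /star_dist /= eqxx sub0r normrN ger0_norm.
Qed.

(** The image of a [star_chart] contains some ball about p, but perhaps not the one of radius r;
    after shrinking r the star is the whole ball. *)
Definition exact_chart p n r (f : 'I_n * R -> Gamma) : Prop :=
  star_chart p r f /\ forall y, mdist p y < r ->
    y = p \/ exists k t, 0 <= t < r /\ y = f (k, t).

Lemma star_chart_shrink p n r r' (f : 'I_n * R -> Gamma) :
  star_chart p r f -> 0 < r' <= r -> star_chart p r' f.
Proof.
move=> fC /andP[r'0 r'r]; have [r0 fp fd fn] := fC; split => //.
  move=> u v /andP[u0 ur] /andP[v0 vr].
  by apply: fd; apply/andP; split => //; apply: lt_le_trans r'r.
have [e /= e0 he] := (@nbhs_ballP R Gamma p _).1 fn.
apply/nbhs_ballP; exists (Num.min e r'); first by rewrite /= lt_min e0.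
move=> y; rewrite ballEmdist /= lt_min => /andP[ye yr].
have [|->|[[k t] /= kt yE]] := he y; [by rewrite ballEmdist|by left|right].
exists (k, t) => //; move: kt; rewrite /star /= => /andP[t0 tr].
by rewrite t0 /= -(chart_center k fC (t := t)) ?t0 // yE.
Qed.

Lemma star_chart_exact p n r (f : 'I_n * R -> Gamma) :
  star_chart p r f -> exists2 r', 0 < r' <= r & exact_chart p r' f.
Proof.
move=> fC; have [r0 fp fd fn] := fC.
have [e /= e0 he] := (@nbhs_ballP R Gamma p _).1 fn.
exists (Num.min e r); first by rewrite lt_min e0 r0 ge_min lexx orbT.
have hr : 0 < Num.min e r <= r by rewrite lt_min e0 r0 ge_min lexx orbT.
split; first exact: star_chart_shrink hr.
move=> y yr; have ye : mdist p y < e by move: yr; rewrite lt_min => /andP[].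
have [|->|[[k t] /= kt yE]] := he y; [by rewrite ballEmdist|by left|right].
exists k, t; split => //; have ht : 0 <= t < r := kt.
by rewrite -{2}(chart_center k fC ht) yE; case/andP: ht => ->.
Qed.

(** Radial geodesics are unique: on another ray the point at radius l * t has distance l * t + t
    from f (k, t), which equals (1 - l) * t only if l * t = 0. *)
Lemma chart_ray p n r (f : 'I_n * R -> Gamma) k t z (l : R) :
  exact_chart p r f -> 0 <= t < r -> 0 <= l <= 1 ->
  mdist p z = l * t -> mdist z (f (k, t)) = (1 - l) * t -> z = f (k, l * t).
Proof.
move=> [fC fy] ht /andP[l0 l1] pz zy; have [r0 fp fd _] := fC.
have /andP[t0 tr] := ht.
have lt : l * t <= t by rewrite ler_piMl.
have hlt : 0 <= l * t < r by rewrite mulr_ge0 //= (le_lt_trans lt).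
have z0 : l * t = 0 -> z = f (k, l * t).
  by move=> lt0; rewrite lt0 fp; apply/esym/mdist_positivity; rewrite pz.
have [|zp|[j [s [hs zE]]]] := fy z.
- by rewrite pz; case/andP: hlt.
- by apply: z0; rewrite -pz zp mdistxx.
have sE : s = l * t by rewrite -pz zE (chart_center j fC hs).
have := fd (j, s) (k, t) hs ht; rewrite -zE zy /star_dist /=.
case: eqP => [<-|_]; first by rewrite zE sE.
by rewrite sE => h; apply: z0; lra.
Qed.

(** A ray of [f'] goes to the ray of [f] through its point at distance [rho], and by [chart_ray] the
    two agree up to there. Points at distance [rho] on distinct rays of [f'] are 2 * rho apart,
    hence injectivity; applied both ways this determines the valency. *)
Lemma chart_compare p n n' r r' (f : 'I_n * R -> Gamma)
    (f' : 'I_n' * R -> Gamma) : star_chart p r f -> star_chart p r' f' ->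
  exists2 rho, 0 < rho & rho <= r' /\ exists2 s : 'I_n' -> 'I_n, injective s &
    forall k t, 0 <= t < rho -> f' (k, t) = f (s k, t).
Proof.
move=> fC f'C; have [r1 /andP[r10 r1r] fE] := star_chart_exact fC.
have [r'0 fp' fd' _] := f'C.
pose rho := Num.min r1 r' / 2.
have rho0 : 0 < rho by rewrite divr_gt0 // lt_min r10.
have rhom : rho < Num.min r1 r' by rewrite ltr_pdivrMr // ltr_pMr ?ltr1n // lt_min r10.
move: (rhom); rewrite lt_min => /andP[rho1 rho2].
have hrho : 0 <= rho < r' by rewrite ltW.
have hrho1 : 0 <= rho < r1 by rewrite ltW.
exists rho => //; split; first exact: ltW.
have [fC1 fy] := fE.
have ex k : exists j, f' (k, rho) = f (j, rho).
  have d := chart_center k f'C hrho.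
  have [|yp|[j [t [ht yE]]]] := fy (f' (k, rho)); first by rewrite d.
    by move: rho0; rewrite -d yp mdistxx ltxx.
  by exists j; rewrite -[in RHS]d yE (chart_center j fC1 ht).
have [s hs] := choice ex; exists s.
  move=> k k' ss; have := fd' (k, rho) (k', rho) hrho hrho.
  rewrite !hs ss mdistxx /star_dist /=; case: eqP => // _ h.
  by exfalso; move: rho0 h; lra.
move=> k t /andP[t0 tr].
have -> : t = t / rho * rho by rewrite divfK // gt_eqF.
apply: (chart_ray fE) => //.
- by rewrite divr_ge0 ?(ltW rho0) //= ler_pdivrMr // mul1r ltW.
- by rewrite divfK ?gt_eqF // (chart_center k f'C) // t0 (lt_trans tr).
rewrite -hs divfK ?gt_eqF // fd' /star /= ?t0 ?(lt_trans tr) //.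
rewrite /star_dist /= eqxx mulrBl mul1r divfK ?gt_eqF //.
by rewrite distrC ger0_norm // subr_ge0 ltW.
Qed.

Lemma chart_compare_bij p n n' r r' (f : 'I_n * R -> Gamma)
    (f' : 'I_n' * R -> Gamma) : star_chart p r f -> star_chart p r' f' ->
  n = n' /\ exists2 rho, 0 < rho <= r' & exists2 s : 'I_n' -> 'I_n, bijective s &
    forall k t, 0 <= t < rho -> f' (k, t) = f (s k, t).
Proof.
move=> fC f'C.
have [rho rho0 [rhor [s sI sE]]] := chart_compare fC f'C.
have [_ _ [_ [s' s'I _]]] := chart_compare f'C fC.
have nn' : n = n'.
  by apply/eqP; rewrite eqn_leq; apply/andP; split;
    [have := leq_card s' s'I|have := leq_card s sI]; rewrite !card_ord.
split=> //; exists rho; first by rewrite rho0.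
by exists s => //; apply: inj_card_bij => //; rewrite !card_ord nn'.
Qed.

Lemma valency_unique p n n' : has_valency p n -> has_valency p n' -> n = n'.
Proof. by move=> [r [f fC]] [r' [f' f'C]]; have [] := chart_compare_bij fC f'C. Qed.

(* [C y l] is the point at fraction [l] of the radius from [p] to [y]. *)
Lemma star_contraction p n : has_valency p n ->
  exists2 r, 0 < r & exists C : Gamma -> R -> Gamma,
   forall y, mdist p y < r ->
   [/\ C y 0 = p, C y 1 = y,
     forall y' l l', mdist p y' < r -> 0 <= l <= 1 -> 0 <= l' <= 1 ->
       mdist (C y l) (C y' l') <= mdist y y' + r * `|l - l'| &
     forall z l, 0 <= l <= 1 -> mdist p z = l * mdist p y ->
       mdist z y = (1 - l) * mdist p y -> z = C y l].
Proof.
move=> [r1 [f /star_chart_exact[r /andP[r0 _] fE]]]; exists r => //.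
have [fC fy] := fE; have [_ fp fd _] := fC.
have ex y : exists g : R -> Gamma, mdist p y < r ->
  (y = p /\ forall l, g l = p) \/ (exists k t,
     [/\ 0 <= t < r, y = f (k, t) & forall l, g l = f (k, l * t)]).
  have [yr|yr] := pselect (mdist p y < r); last by exists (fun=> p) => /yr.
  have [->|[k [t [ht yE]]]] := fy y yr; first by exists (fun=> p) => _; left.
  by exists (fun l => f (k, l * t)) => _; right; exists k, t.
have [C hC] := choice ex; exists C => y yr.
have scale l t : 0 <= l <= 1 -> 0 <= t < r -> 0 <= l * t < r.
  move=> /andP[l0 l1] /andP[t0 tr]; rewrite mulr_ge0 //=.
  by apply: le_lt_trans tr; rewrite ler_piMl.
have nr l l' t : 0 <= t < r -> `|l - l'| * t <= r * `|l - l'|.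
  by move=> /andP[_ tr]; rewrite mulrC ler_wpM2r // ltW.
split.
- by case: (hC y yr) => [[_ ->//]|[k [t [_ _ ->]]]]; rewrite mul0r fp.
- by case: (hC y yr) => [[-> ->//]|[k [t [_ -> ->]]]]; rewrite mul1r.
- move=> y' l l' y'r hl hl'.
  have n0 : 0 <= r * `|l - l'| by rewrite mulr_ge0 // ltW.
  have /andP[l0 l1] := hl; have /andP[l'0 l'1] := hl'.
  case: (hC y yr) => [[-> ->]|[k [t [ht -> ->]]]];
    case: (hC y' y'r) => [[-> ->]|[k' [t' [ht' -> ->]]]].
  + by rewrite mdistxx add0r.
  + rewrite !(chart_center k' fC) ?scale //; case/andP: ht' => t'0 _.
    by rewrite -[leLHS]addr0 lerD // ler_piMl.
  + rewrite metric_sym [mdist _ p]metric_sym.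
    rewrite !(chart_center k fC) ?scale //; case/andP: ht => t0 _.
    by rewrite -[leLHS]addr0 lerD // ler_piMl.
  + rewrite !fd /star /= ?scale // /star_dist /=.
    have /andP[t0 tr] := ht; have /andP[t'0 t'r] := ht'.
    case: eqP => _; last first.
      by rewrite -[leLHS]addr0; do 2! rewrite lerD ?ler_piMl //.
    have -> : l * t - l' * t' = l * (t - t') + (l - l') * t' by ring.
    apply: le_trans (ler_normD _ _) _; rewrite !normrM [`|t'|]ger0_norm // lerD ?nr //.
    by rewrite ger0_norm // ler_piMl.
- move=> z l hl pz zy.
  case: (hC y yr) => [[yp ->]|[k [t [ht yE ->]]]].
    by apply/esym/mdist_positivity; rewrite pz yp mdistxx mulr0.
  rewrite yE (chart_center k fC ht) in pz zy.
  exact: (chart_ray fE ht hl pz).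
Qed.

End Charts.

(** * Cutting a compact metric graph into finitely many arcs *)

Section ModelExistence.
Context {R : realType} {Gamma : metricType R}.
Implicit Types (A B : set Gamma) (W : seq Gamma).

Lemma seq_greatest (L : seq R) x : x \in L ->
  exists2 a, a \in L & forall y, y \in L -> y <= a.
Proof.
elim: L x => // b [|c L] IH x _.
  by exists b; rewrite ?mem_head // => y; rewrite inE => /eqP ->.
have [a aL ha] := IH c (mem_head _ _).
exists (Num.max a b); first by case: leP => _; rewrite !inE ?eqxx // -in_cons aL orbT.
by move=> y; rewrite inE le_max => /predU1P[->|/ha ->]; rewrite ?lexx ?orbT.
Qed.

Lemma seq_least (L : seq R) x : x \in L ->
  exists2 a, a \in L & forall y, y \in L -> a <= y.
Proof.
move=> xL; have [|a /mapP[b bL ->] hb] := @seq_greatest (map -%R L) (- x).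
  by rewrite map_f.
by exists b => // y yL; rewrite -lerN2; apply: hb; rewrite map_f.
Qed.

(** The filter [F] says that a property holds for all lists containing a suitable one; uniformity
    along it is a finite subcover. *)
Lemma compact_seq_cover (rho : Gamma -> R) : compact [set: Gamma] ->
  (forall p, 0 < rho p) ->
  exists C : seq Gamma, forall x, exists2 p, p \in C & mdist p x < rho p.
Proof.
move=> /compact_near_coveringP cG rho0.
pose F : set_system (seq Gamma) :=
  [set U | exists C0 : seq Gamma, forall C : seq Gamma, {subset C0 <= C} -> U C].
have FF : Filter F.
  split; first by exists [::].
  - move=> U U' [C hC] [C' hC']; exists (C ++ C') => D sD; split.
      by apply: hC => z zC; apply: sD; rewrite mem_cat zC.
    by apply: hC' => z zC; apply: sD; rewrite mem_cat zC orbT.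
  - by move=> U U' UU' [C hC]; exists C => D sD; apply/UU'/hC.
pose P (C : seq Gamma) x := exists2 p, p \in C & mdist p x < rho p.
have loc x : [set: Gamma] x -> \forall x' \near x & C \near F, P C x'.
  exists (ball x (rho x), [set C : seq Gamma | x \in C]).
    split; first exact: nbhsx_ballx.
    by exists [:: x] => D; apply; rewrite mem_head.
  by move=> [x' C] [/=]; rewrite ballEmdist => h1 h2; exists x.
have [C0 hC0] := cG _ F P FF loc.
by exists C0 => x; exact: (hC0 C0).
Qed.

(** [W] lists the marked points. The set [A] is kept beside its parametrisation so that pieces found
    in different charts can be compared. *)
Definition piece W A (l : R) (g : R -> Gamma) : Prop :=
  [/\ 0 < l, continuous g,
     forall s t, 0 <= s <= l -> 0 <= t <= l -> mdist (g s) (g t) = `|s - t|,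
     g 0 \in W /\ g l \in W &
     [/\ A = g @` [set s | 0 < s < l], open A &
       forall s, 0 < s < l -> g s \notin W]].

(** Along [g'] membership in [A] is locally constant: [A] is open, and the closed arc adds only its
    two ends, which are in [W], while the interior of [g'] avoids [W]. *)
Lemma piece_sub W A B l l' g g' z : piece W A l g -> piece W B l' g' ->
  A z -> B z -> B `<=` A.
Proof.
move=> [l0 cg ig [g0 gl] [AE Ao gW]] [l'0 cg' ig' [g'0 g'l] [BE Bo g'W]] Az Bz.
have cl : closed (g @` [set s | 0 <= s <= l]).
  apply: compact_closed; first exact: metric_hausdorff.
  have -> : [set s | 0 <= s <= l] = `[0, l]%classic.
    by apply/seteqP; split => s /=; rewrite in_itv.
  apply: continuous_compact; last exact: segment_compact.
  exact: continuous_subspaceT.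
have near_set (D : set Gamma) t : open D -> D (g' t) -> exists2 e : R, 0 < e &
    forall t', `|t' - t| < e -> D (g' t').
  move=> Do Dt; have : nbhs t (g' @^-1` D).
    by apply: cg'; apply: open_nbhs_nbhs.
  move=> /nbhs_ballP[e /= e0 he]; exists e => // t' tt'; apply: he.
  by rewrite /ball /= distrC.
have loc t : 0 < t < l' -> exists2 e : R, 0 < e & forall t', 0 < t' < l' ->
    `|t' - t| < e -> `[< A (g' t') >] = `[< A (g' t) >].
  move=> ht; case: (asboolP (A (g' t))) => At.
    have [e e0 he] := near_set A t Ao At; exists e => // t' _ /he ?.
    exact/asboolP.
  have [||e e0 he] := near_set (~` (g @` [set s | 0 <= s <= l])) t.
  - exact: closed_openC.
  - move=> [s /= /andP[s0 sl] st].
    have [s00|s00] := eqVneq s 0; first by move: (g'W t ht); rewrite -st s00 g0.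
    have [sll|sll] := eqVneq s l; first by move: (g'W t ht); rewrite -st sll gl.
    apply: At; rewrite AE; exists s => //=.
    by rewrite lt_neqAle eq_sym s00 s0 lt_neqAle sll sl.
  exists e => // t' _ /he h; apply/negbTE/asboolP => At'; apply: h.
  by move: At'; rewrite AE => -[s /= /andP[/ltW s0 /ltW sl] <-]; exists s => //=; rewrite s0.
move=> y; rewrite BE => -[t /= ht <-].
move: Bz; rewrite BE => -[t0 /= ht0 zt].
have := @locally_constant R _ (fun t => `[< A (g' t) >]) [set t | 0 < t < l'] t0 t loc.
rewrite zt (_ : `[< A z >]) //; last exact/asboolP.
move=> h; apply/asboolP; rewrite -h // => x /=.
case/andP: ht ht0 => [ta tb] /andP[tc td].
by rewrite ge_min le_max => /andP[/orP[]h1 /orP[]h2]; lra.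
Qed.

Lemma piece_unique W A B l l' g g' z : piece W A l g -> piece W B l' g' ->
  A z -> B z -> A = B.
Proof.
move=> pA pB Az Bz; apply/seteqP; split.
  exact: piece_sub pB pA Bz Az.
exact: piece_sub pA pB Az Bz.
Qed.

(** The ends are recorded as distances of marked points from [p], so that for given [p] and [W] only
    finitely many sets qualify. *)
Definition leg_piece p n (f : 'I_n * R -> Gamma) W A : Prop :=
  exists (k : 'I_n) v w, [/\ v \in W, w \in W &
    A = (fun s => f (k, s)) @` [set s | mdist p v < s < mdist p w]].

(** The piece through [x] runs on its ray between the nearest marked points on either side; these
    exist because the centre and the point at radius r / 2 are marked. *)
Lemma leg_piece_exists p n r (f : 'I_n * R -> Gamma) W x :
  exact_chart p r f -> p \in W -> (forall k, f (k, r / 2) \in W) ->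
  x \notin W -> mdist p x < r / 2 ->
  exists A, [/\ A x, leg_piece p f W A & exists l g, piece W A l g].
Proof.
move=> fE pW kW xW px; have [fC fy] := fE; have [r0 fp fd _] := fC.
have r2 : r / 2 < r by rewrite ltr_pdivrMr // ltr_pMr // ltr1n.
have [|xp|[k [t [ht xE]]]] := fy x; first exact: lt_trans px r2.
  by rewrite xp pW in xW.
have t0 : 0 < t.
  rewrite lt_neqAle; case/andP: (ht) => -> _; rewrite andbT.
  by apply: contraNneq xW => t0; rewrite xE -t0 fp.
have tr2 : t < r / 2 by rewrite -(chart_center k fC ht) -xE.
pose L := [seq mdist p v | v <- W].
have LW s : 0 <= s <= r / 2 -> f (k, s) \in W -> s \in L.
  move=> /andP[s0 sr] h; apply/mapP; exists (f (k, s)) => //.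
  by rewrite (chart_center k fC) // s0 (le_lt_trans sr).
have rh : 0 <= r / 2 <= r / 2 by rewrite lexx andbT divr_ge0 // ltW.
have [|a] := @seq_greatest [seq s <- L | (0 <= s < t) && (f (k, s) \in W)] 0.
  by rewrite mem_filter lexx t0 fp pW LW ?fp // lexx; case/andP: rh.
rewrite mem_filter => /andP[/andP[/andP[a0 at'] aW] aL] amax.
have [|b] := @seq_least [seq s <- L | (t < s <= r / 2) && (f (k, s) \in W)] (r / 2).
  by rewrite mem_filter tr2 lexx kW LW.
rewrite mem_filter => /andP[/andP[/andP[tb br] bW] bL] bmin.
have hs s : a <= s <= b -> 0 <= s < r.
  by move=> /andP[h1 h2]; rewrite (le_trans a0 h1) (le_lt_trans h2) // (le_lt_trans br).
pose A := (fun s => f (k, s)) @` [set s | a < s < b].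
have da : mdist p (f (k, a)) = a by rewrite (chart_center k fC) // hs ?lexx //= ltW // (lt_trans at').
have db : mdist p (f (k, b)) = b by rewrite (chart_center k fC) // hs ?lexx ?andbT //= ltW // (lt_trans at').
exists A; split.
- by exists t => //=; rewrite at'.
- by exists k, (f (k, a)), (f (k, b)); rewrite da db.
have ab : a < b by rewrite (lt_trans at').
(* Clamping the parameter to [0, b - a] makes the parametrisation continuous on the whole line. *)
pose c (s : R) := Num.max 0 (Num.min s (b - a)).
have cc : continuous c.
  apply: (@max_fun_continuous _ R R (cst 0) (fun t => Num.min t (b - a))).
    by move=> ?; exact: cvg_cst.
  apply: (@min_fun_continuous _ R R id (cst (b - a))) => ?; first exact: cvg_id.
  exact: cvg_cst.
have cI s : 0 <= s <= b - a -> c s = s.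
  by move=> /andP[s0 sb]; rewrite /c min_l // max_r.
have cB s : a <= a + c s <= b.
  have h0 : 0 <= c s by rewrite /c le_max lexx.
  have h1 : c s <= b - a by rewrite /c ge_max subr_ge0 (ltW ab) ge_min lexx orbT.
  by apply/andP; split; lra.
have dd s s' : mdist (f (k, a + c s)) (f (k, a + c s')) = `|c s - c s'|.
  rewrite fd /star /= ?hs ?cB // /star_dist /= eqxx; congr `|_|; ring.
exists (b - a), (fun s => f (k, a + c s)); split.
- by rewrite subr_gt0.
- move=> s; apply/metricType_numDomainType.cvgrPdist_lt => e e0.
  have /cvgrPdist_lt/(_ e e0) : c s' @[s' --> s] --> c s by exact: cc.
  by apply: filterS => s'; rewrite dd.
- by move=> s s' hs1 hs2; rewrite dd !cI.
- by rewrite !cI ?lexx ?subr_ge0 ?(ltW ab) // addr0 [a + _]addrC subrK.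
split.
- apply/seteqP; split => y [s /= /andP[h1 h2] <-].
    exists (s - a); first by rewrite /= ; apply/andP; split; lra.
    by rewrite cI ?[a + _]addrC ?subrK //; apply/andP; split; lra.
  exists (a + s); first by rewrite /=; apply/andP; split; lra.
  by rewrite cI // !ltW.
- rewrite openE => y [s /= /andP[h1 h2] <-].
  (* A ball of this radius stays on the ray: another ray is reached only through the centre, at
     distance s >= s - a. *)
  apply/nbhs_ballP; exists (Num.min (s - a) (b - s)) => /=.
    by rewrite lt_min !subr_gt0 h1.
  have hsr : 0 <= s < r by apply: hs; rewrite !ltW.
  move=> z; rewrite ballEmdist /= lt_min => /andP[d1 d2].
  have ds := chart_center k fC hsr.
  have [|zp|[k' [s' [hs' zE]]]] := fy z.
  + apply: le_lt_trans (metric_triangle p (f (k, s)) z) _; rewrite ds.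
    by apply: lt_le_trans (_ : b <= r); [lra|apply: le_trans br _; exact: ltW].
  + by move: d1; rewrite zp metric_sym ds; lra.
  move: d1 d2; rewrite zE fd // /star_dist /=.
  case: eqP => [<-|_]; last by case/andP: hs' => s'0 _; lra.
  rewrite !ltr_norml => /andP[i1 i2] /andP[i3 i4].
  by exists s' => //=; apply/andP; split; lra.
- move=> s hs1; rewrite cI; last by case/andP: hs1 => /ltW -> /ltW ->.
  have /andP[s1 s2] := hs1.
  apply/negP => sW; have sL : a + s \in L.
    by apply: LW => //; apply/andP; split; lra.
  have [st|ts|st] := ltgtP (a + s) t.
  + suff : a + s <= a by lra.
    by apply: amax; rewrite mem_filter sW sL st /= andbT; apply/andP; split => //; lra.
  + suff : b <= a + s by lra.
    by apply: bmin; rewrite mem_filter sW sL ts /= andbT; lra.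
  + by move: xW; rewrite xE -st sW.
Qed.

(** Pieces are collected as subsets of [Gamma], so an arc found in several overlapping charts counts
    once, and by [piece_unique] different ones are disjoint. *)
Lemma model_exists (S : seq Gamma) : is_metric_graph Gamma ->
  exists M : model Gamma, forall x, x \in S -> exists v, x = vtx (m := M) v.
Proof.
move=> [_ cG _ valP].
have ex p : exists d : {n : nat & (R * ('I_n * R -> Gamma))%type},
    exact_chart p (projT2 d).1 (projT2 d).2.
  have [n [r [f /star_chart_exact[r' _ fE]]]] := valP p.
  by exists (existT _ n (r', f)).
have [d hd] := choice ex.
pose rad p := (projT2 (d p)).1; pose f p := (projT2 (d p)).2.
have rad0 p : 0 < rad p by have [[]] := hd p.
have hd' p : exact_chart p (rad p) (@f p) := hd p.
have [C hC] := compact_seq_cover cG (fun p => divr_gt0 (rad0 p) (ltr0Sn _ 1)).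
(* Balls of half the chart radius cover the graph; marking the point at this radius on every ray
   closes off each piece within its chart. *)
pose W : seq Gamma := S ++ C ++
  flatten [seq [seq f p (k, rad p / 2) | k <- enum 'I_(projT1 (d p))] | p <- C].
have CW p : p \in C -> p \in W by move=> pC; rewrite !mem_cat pC orbT.
have kW p k : p \in C -> f p (k, rad p / 2) \in W.
  move=> pC; rewrite !mem_cat; apply/orP; right; apply/orP; right.
  by apply/flattenP; exists [seq f p (k, rad p / 2) | k <- enum 'I_(projT1 (d p))];
    [apply/mapP; exists p|apply/mapP; exists k; rewrite ?mem_enum].
pose pieces : set (set Gamma) := [set A | (exists l g, piece W A l g) /\
  exists2 p, p \in C & leg_piece p (@f p) W A].
have fin : finite_set pieces.
  apply: (@sub_finite_set _ _ (\bigcup_(p in [set` C]) \bigcup_(k in [set: 'I_(projT1 (d p))])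
     ((fun vw => (fun s => f p (k, s)) @` [set s | mdist p vw.1 < s < mdist p vw.2]) @`
       ([set` W] `*` [set` W])))).
    move=> A [_ [p pC [k [v [w [vW wW AE]]]]]].
    by exists p => //; exists k => //; exists (v, w).
  apply: bigcup_finite => [|p _]; first exact: finite_seq.
  apply: bigcup_finite => [|k _]; first exact: finite_finset.
  by apply: finite_image; apply: finite_setX; exact: finite_seq.
have [P PE] := (finite_seqP pieces).1 fin.
have piecesP (e : seq_sub P) : exists lg : R * (R -> Gamma), piece W (ssval e) lg.1 lg.2.
  have : pieces (ssval e) by rewrite PE /=; exact: ssvalP.
  by case=> -[l [g pg]] _; exists (l, g).
have [lg hlg] := choice piecesP.
have g0W e : (lg e).2 0 \in W by have [_ _ _ []] := hlg e.
have glW e : (lg e).2 (lg e).1 \in W by have [_ _ _ []] := hlg e.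
have disj (e e' : seq_sub P) (s s' : R) : 0 < s < (lg e).1 -> 0 < s' < (lg e').1 ->
    (lg e).2 s = (lg e').2 s' -> e = e'.
  move=> hs hs' ss; apply/val_inj => /=.
  have [_ _ _ _ [AE _ _]] := hlg e; have [_ _ _ _ [AE' _ _]] := hlg e'.
  apply: (piece_unique (hlg e) (hlg e') (z := (lg e).2 s)).
    by rewrite AE; exists s.
  by rewrite AE' ss; exists s'.
have arcW (e : seq_sub P) s (v : seq_sub W) : 0 < s < (lg e).1 -> (lg e).2 s <> ssval v.
  by have [_ _ _ _ [_ _ h]] := hlg e => /h /negP h' hv; apply: h'; rewrite hv ssvalP.
have arcO (e : seq_sub P) : open ((lg e).2 @` [set s | 0 < s < (lg e).1]).
  by have [_ _ _ _ [<- ? _]] := hlg e.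
have cover (x : Gamma) : (exists v : seq_sub W, x = ssval v) \/
    (exists (e : seq_sub P) s, 0 < s < (lg e).1 /\ x = (lg e).2 s).
  have [xW|xW] := boolP (x \in W); first by left; exists (SeqSub xW).
  right; have [p pC px] := hC x.
  have [A [Ax Al Ap]] := leg_piece_exists (hd' p) (CW p pC) (fun k => kW p k pC) xW px.
  have AP : A \in P.
    by have : pieces A; [split => //; exists p|rewrite PE].
  have [e eA] : exists e : seq_sub P, ssval e = A by exists (SeqSub AP).
  exists e; have [_ _ _ _ [AE _ _]] := hlg e.
  by move: Ax; rewrite -eA AE => -[s hs <-]; exists s.
pose M := @Model R Gamma (seq_sub W) (seq_sub P) (@ssval _ _)
  (fun e => (lg e).1) (fun e => (lg e).2)
  (fun e => SeqSub (g0W e)) (fun e => SeqSub (glW e))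
  val_inj (fun e => let: And5 h _ _ _ _ := hlg e in h)
  (fun=> erefl) (fun=> erefl) (fun e => let: And5 _ h _ _ _ := hlg e in h)
  (fun e => let: And5 _ _ h _ _ := hlg e in h) arcO disj arcW cover.
exists M => x xS; have xW : x \in W by rewrite mem_cat xS.
by exists (SeqSub xW).
Qed.

End ModelExistence.

(** * Singular simplices and winding numbers *)

Section FreegLift.
Context (R : nzRingType) (K : choiceType) (M : lmodType R) (f : K -> M).

HB.instance Definition _ := GRing.isZmodMorphism.Build
  {freeg K / R} M (fglift f) (lift_is_additive f).

Lemma fglift_scalable : scalable (fglift f).
Proof.
move=> a D; rewrite -(freeg_sumE D).
elim: (dom D) => [|z r IH]; first by rewrite big_nil scaler0 raddf0 scaler0.
rewrite big_cons !raddfD /= IH; congr (_ + _).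
have -> : a *: << coeff z D *g z >> = << a * coeff z D *g z >>.
  by apply/eqP/freeg_eqP => y; rewrite coeffZ !coeffU mulrA.
by rewrite !liftU scalerA.
Qed.

HB.instance Definition _ := GRing.isScalable.Build R
  {freeg K / R} M *:%R (fglift f) fglift_scalable.

End FreegLift.

Section AffineSimplices.
Context {R : realType} {X : topologicalType}.
Implicit Types (V : normedModType R).

HB.instance Definition _ n := GRing.Linear.copy (@boundary R X n)
  (fglift (fun s => \sum_(i < n.+2) (-1) ^+ i *: << face i s >>)).

Lemma boundary1 n (s : singular_simplex X n.+1) :
  boundary << s >> = \sum_(i < n.+2) (-1) ^+ i *: << face i s >> :> singular_chain (R := R) X n.
Proof. by rewrite /boundary liftU scale1r. Qed.

Definition affine_map V n (P : seq V) (x : set_type (@std_simplex R n)) : V :=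
  \sum_(i < n.+1) set_val x ord0 i *: nth 0 P i.

Lemma bary_continuous n (i : 'I_n.+1) :
  continuous (fun x : set_type (@std_simplex R n) => set_val x ord0 i).
Proof.
move=> x; apply: (@continuous_comp _ _ _
  (set_val : set_type (@std_simplex R n) -> 'rV[R]_n.+1)
  (fun M : 'rV[R]_n.+1 => M ord0 i) x).
  exact: initial_continuous.
exact: coord_continuous.
Qed.

Lemma affine_map_continuous V n (P : seq V) :
  continuous (affine_map (n := n) P).
Proof.
apply: (@continuous_big V _ +%R 0 xpredT (@add_continuous _) _ _
  (fun i (x : set_type (@std_simplex R n)) => set_val x ord0 i *: nth 0 P i)).
move=> i _ x.
exact: cvgZr_tmp (@bary_continuous n i x).
Qed.

Lemma affine_simplex_continuous V (H : V -> X) n (P : seq V) : continuous H ->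
  continuous (H \o affine_map (n := n) P).
Proof.
move=> cH x; apply: continuous_comp; first exact: affine_map_continuous.
exact: cH.
Qed.

(** The explicit chains below are images of affine simplices of a normed space, so faces are
    computed on lists of vertices. *)
Definition affine_simplex V (H : V -> X) (cH : continuous H) n (P : seq V) :
  singular_simplex X n := mkcts (@affine_simplex_continuous V H n P cH).

Lemma face_affine V (H : V -> X) (cH : continuous H) n (P : seq V) i :
  face i (affine_simplex cH n.+1 P) =
  affine_simplex cH n (mkseq (fun k => nth 0 P (bump i k)) n.+1).
Proof.
apply/continuousEP => x; rewrite /= /mkcts /= /affine_map; congr H.
rewrite (bigD1_ord i) //= mxE unlift_none scale0r add0r.
apply: eq_bigr => k _; rewrite mxE liftK nth_mkseq //.
Qed.

End AffineSimplices.

Section Segments.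
Context {R : realType} {X : topologicalType}.
Implicit Types (V W : normedModType R) (x : X).

Definition seg V (H : V -> X) (cH : continuous H) (P Q : V) :
  singular_simplex (R := R) X 1 := affine_simplex cH 1 [:: P; Q].

Definition pt x : singular_simplex (R := R) X 0 := cst x.

Lemma seg_eval V (H : V -> X) (cH : continuous H) (P Q : V)
    (z : set_type (@std_simplex R 1)) :
  seg cH P Q z = H (P + set_val z ord0 ord_max *: (Q - P)).
Proof.
rewrite /seg /affine_simplex /= /mkcts /= /affine_map; congr H.
have [z0 /= z1] := set_valP z.
rewrite !big_ord_recl !big_ord0 /= !addr0 in z1 *.
have -> : ord_max = fintype.lift ord0 ord0 :> 'I_2 by apply/val_inj.
move: z1; set a := set_val z ord0 _; set b := set_val z ord0 _ => ab.
have -> : a = 1 - b by rewrite -ab addrK.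
by rewrite scalerBl scale1r scalerBr -addrA [- _ + _]addrC.
Qed.

Lemma simplex1_coord (z : set_type (@std_simplex R 1)) :
  0 <= set_val z ord0 ord_max <= 1.
Proof.
have [z0 /= z1] := set_valP z; rewrite z0 /= -z1 (bigD1 ord_max) //= lerDl.
by apply: sumr_ge0 => i _; exact: z0.
Qed.

Lemma seg_eq V W (H : V -> X) (H' : W -> X) (cH : continuous H)
    (cH' : continuous H') P Q P' Q' :
  (forall t : R, 0 <= t <= 1 -> H (P + t *: (Q - P)) = H' (P' + t *: (Q' - P'))) ->
  seg cH P Q = seg cH' P' Q'.
Proof.
move=> HH'; apply/continuousEP => z; rewrite !seg_eval HH' //.
exact: simplex1_coord.
Qed.

Lemma boundary_seg V (H : V -> X) (cH : continuous H) (P Q : V) :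
  boundary << seg cH P Q >> = << pt (H Q) >> - << pt (H P) >>
  :> singular_chain (R := R) X 0.
Proof.
rewrite boundary1 !big_ord_recl big_ord0 addr0 expr0 scale1r expr1 scaleN1r.
congr (<< _ >> - << _ >>); rewrite face_affine; apply/continuousEP => z;
  rewrite /= /mkcts /= /affine_map; have [_ /=] := set_valP z;
  by rewrite !big_ord_recl !big_ord0 !addr0 /= => ->; rewrite scale1r.
Qed.

Definition bounds n (c : singular_chain (R := R) X n) : Prop :=
  exists b, c = boundary b.

Lemma bounds0 n : bounds (0 : singular_chain X n).
Proof. by exists 0; rewrite raddf0. Qed.

Lemma boundsD n (c d : singular_chain X n) :
  bounds c -> bounds d -> bounds (c + d).
Proof. by move=> [a ->] [b ->]; exists (a + b); rewrite raddfD. Qed.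

Lemma boundsZ n a (c : singular_chain X n) : bounds c -> bounds (a *: c).
Proof. by move=> [b ->]; exists (a *: b); rewrite linearZ. Qed.

Lemma bounds_sum n (I : Type) (r : seq I) (F : I -> singular_chain X n) :
  (forall i, bounds (F i)) -> bounds (\sum_(i <- r) F i).
Proof.
move=> hF; elim: r => [|i r IH]; first by rewrite big_nil; exact: bounds0.
by rewrite big_cons; exact: boundsD.
Qed.

Lemma seg_cat V (H : V -> X) (cH : continuous H) (P Q S : V) :
  bounds (<< seg cH P Q >> + << seg cH Q S >> - << seg cH P S >>).
Proof.
exists << affine_simplex cH 2 [:: P; Q; S] >>.
rewrite boundary1 !big_ord_recl big_ord0 addr0 expr0 scale1r expr1 scaleN1r.
rewrite -signr_odd /= expr0 scale1r.
rewrite !face_affine /seg addrA [RHS]addrAC [<< _ >> + << _ >> in RHS]addrC.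
by [].
Qed.

(** The segment equals the degenerate one at [P], and the degenerate triangle bounds PP + PP -
    PP. *)
Lemma seg_const V (H : V -> X) (cH : continuous H) (P Q : V) :
  (forall t : R, 0 <= t <= 1 -> H (P + t *: (Q - P)) = H P) ->
  bounds << seg cH P Q >>.
Proof.
move=> hH; have -> : seg cH P Q = seg cH P P.
  by apply: seg_eq => t /hH ->; rewrite subrr scaler0 addr0.
by have := seg_cat cH P P P; rewrite addrK.
Qed.

End Segments.

Section Parametrization.
Context {R : realType}.

(** Extends paths from [0, 1] to the line, because [seg] takes maps defined on a whole normed
    space. *)
Definition clamp (t : R) : R := Num.max 0 (Num.min t 1).

Lemma clamp_itv t : 0 <= clamp t <= 1.
Proof.
by rewrite /clamp le_max lexx /= ge_max ler01 ge_min lexx orbT.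
Qed.

Lemma clamp_id t : 0 <= t <= 1 -> clamp t = t.
Proof. by move=> /andP[t0 t1]; rewrite /clamp min_l // max_r. Qed.

Lemma clamp_continuous : continuous clamp.
Proof.
apply: (@max_fun_continuous _ R R (cst 0) (fun t => Num.min t 1)).
  by move=> t; exact: cvg_cst.
apply: (@min_fun_continuous _ R R id (cst 1)) => t; first exact: cvg_id.
exact: cvg_cst.
Qed.

Definition simplex1_pt (t : R) : 'rV[R]_2 :=
  \row_j (if j == ord_max then clamp t else 1 - clamp t).

Lemma simplex1_subproof t : simplex1_pt t \in @std_simplex R 1.
Proof.
have /andP[t0 t1] := clamp_itv t; apply/mem_set; split => [i|].
  by rewrite mxE; case: ifP => _ //; rewrite subr_ge0.
by rewrite !big_ord_recl big_ord0 !mxE /= addr0 subrK.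
Qed.

Definition simplex1_param t : set_type (@std_simplex R 1) :=
  SigSub (simplex1_subproof t).

Lemma row_continuous (T : topologicalType) n (f : T -> 'rV[R]_n) :
  (forall j, continuous (fun t => f t ord0 j)) -> continuous f.
Proof.
move=> hf t A [B nB sBA].
have hB (j : 'I_n) : \forall t' \near t, B ord0 j (f t' ord0 j).
  exact: (hf j t _ (nB ord0 j)).
have := filter_forall (nbhs_filter t) hB; apply: filterS => t' ht'.
by apply: sBA => a j; rewrite (ord1 a); exact: ht'.
Qed.

Lemma simplex1_param_continuous : continuous simplex1_param.
Proof.
apply: continuous_comp_initial; apply: row_continuous => j.
have -> : (fun t => (set_val \o simplex1_param) t ord0 j) =
   (fun t => if j == ord_max then clamp t else 1 - clamp t).
  by apply/funext => t /=; rewrite mxE.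
case: (j == ord_max) => t; first exact: clamp_continuous.
by apply: cvgB; [exact: cvg_cst|exact: clamp_continuous].
Qed.

Context {X : topologicalType}.

Definition path_of (s : singular_simplex (R := R) X 1) (t : R^o) : X :=
  s (simplex1_param t).

Lemma path_of_continuous s : continuous (path_of s).
Proof.
move=> t; apply: continuous_comp; first exact: simplex1_param_continuous.
exact: cts_fun.
Qed.

Lemma simplex1_paramK (z : set_type (@std_simplex R 1)) :
  simplex1_param (set_val z ord0 ord_max) = z.
Proof.
apply/val_inj/matrixP => a j; rewrite (ord1 a) /= mxE.
rewrite clamp_id ?simplex1_coord //.
have [_ z1] := set_valP z; case: eqP => [->//|/eqP jm].
rewrite -z1 (bigD1 ord_max) //= addrAC subrr add0r (bigD1 j) //= big1 ?addr0 //.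
by move=> k; case: k j jm => [[|[|?]] ?] [[|[|?]] ?].
Qed.

(** Every singular 1-simplex is thus a segment, so the calculus of [seg] reaches all 1-chains. *)
Lemma seg_path_of s : seg (@path_of_continuous s) 0 1 = s.
Proof.
apply/continuousEP => z; rewrite seg_eval subr0 add0r /path_of.
rewrite [_ *: _]mulr1; congr (s _); exact: simplex1_paramK.
Qed.

End Parametrization.

(** * Winding numbers of a local cocycle *)

Section Winding.
Context {R : realType} {X : topologicalType}.
(** [delta] is a difference of values only locally: the increment of a multivalued function, as for
    a closed 1-form. *)
Variable delta : X -> X -> R.
Hypothesis delta_loc : forall p : X, exists2 U, nbhs p U &
  exists h : X -> R, forall y z, U y -> U z -> delta y z = h z - h y.
Implicit Types (V : normedModType R).

(** [L] is a primitive of [delta] along [H], valid on [K] at a uniform scale. *)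
Definition lift V (K : set V) (H : V -> X) (L : V -> R) : Prop :=
  exists2 eta : R, 0 < eta & forall x y, K x -> K y -> `|y - x| < eta ->
    L y - L x = delta (H x) (H y).

Lemma delta_refl p : delta p p = 0.
Proof.
have [U nU [h hU]] := delta_loc p; rewrite hU ?subrr //; exact: nbhs_singleton.
Qed.

(* Sum [delta] along a fine subdivision of the radius from 0 to x; by the
   cocycle identity the difference of two such sums telescopes. *)
Lemma lift_exists V (K : set V) (H : V -> X) : continuous H -> compact K ->
  (forall x (t : R), K x -> 0 <= t <= 1 -> K (t *: x)) ->
  exists L, lift K H L.
Proof.
move=> cH cK starK.
have [] := @lebesgue_number R V K (fun U => exists h : X -> R, forall y z,
    K y -> K z -> U y -> U z -> delta (H y) (H z) = h (H z) - h (H y)) cK.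
- by move=> A B AB [h hB]; exists h => y z Ky Kz /AB By /AB Bz; exact: hB.
- move=> x _; have [U nU [h hU]] := delta_loc (H x).
  exists (H @^-1` U); first exact: (cH x _ nU).
  by exists h => y z _ _; exact: hU.
move=> eta eta0 Heta.
have [M [M0 hM]] : exists M : R, 0 < M /\ forall x, K x -> `|x| <= M.
  have [M [Mr hM]] := compact_bounded cK; exists (`|M| + 1); split.
    by rewrite ltr_wpDl.
  by move=> x Kx; apply: hM => //; rewrite ltr_pwDr // ler_norm.
(* With [N] steps a radius of length at most [M] advances by less than eta / 2 each time; the other
   half of [eta] is left for the distance between the two radii. *)
pose N := (Num.truncn (M / (eta / 2))).+1.
have N0 : 0 < N%:R :> R by rewrite ltr0n.
have MN : M / N%:R < eta / 2.
  rewrite ltr_pdivrMr // mulrC -ltr_pdivrMr ?divr_gt0 //; exact: truncnS_gt.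
pose a i (x : V) := (i%:R / N%:R : R) *: x.
have Ka i x : (i <= N)%N -> K x -> K (a i x).
  move=> iN Kx; apply: starK => //; rewrite divr_ge0 ?ler0n //=.
  by rewrite ler_pdivrMr // mul1r ler_nat.
exists (fun x => \sum_(0 <= i < N) delta (H (a i x)) (H (a i.+1 x))).
exists (eta / 2); first by rewrite divr_gt0.
move=> x y Kx Ky xy; rewrite -sumrB.
transitivity (\sum_(0 <= i < N) (delta (H (a i.+1 x)) (H (a i.+1 y))
    - delta (H (a i x)) (H (a i y)))); last first.
  rewrite (telescope_sumr (fun i => delta (H (a i x)) (H (a i y)))) //.
  rewrite /a mul0r !scale0r delta_refl subr0 divff ?scale1r //.
  by rewrite pnatr_eq0.
apply: eq_big_nat => i /andP[_ iN].
have close z : K z -> `|a i z - a i.+1 z| < eta / 2.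
  move=> Kz; rewrite /a -scalerBl -mulrBl -natr1 opprD addNKr mulN1r.
  rewrite normrZ normrN ger0_norm ?invr_ge0 ?ltW //.
  apply: le_lt_trans MN; rewrite mulrC ler_pM2r ?invr_gt0 //; exact: hM.
have close' j : (j <= N)%N -> `|a j x - a j y| < eta / 2.
  move=> jN; rewrite /a -scalerBr normrZ ger0_norm ?divr_ge0 ?ler0n //.
  apply: le_lt_trans xy; rewrite distrC ler_piMl //.
  by rewrite ler_pdivrMr // mul1r ler_nat.
have e2 : eta / 2 < eta by rewrite ltr_pdivrMr // ltr_pMr // ltr1n.
have [h hh] := Heta (a i x) (Ka _ _ (ltnW iN) Kx).
have B0 : ball (a i x) eta (a i x) by exact: ballxx.
have B1 : ball (a i x) eta (a i.+1 x).
  by rewrite -ball_normE /=; apply: lt_trans e2; exact: close.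
have B2 : ball (a i x) eta (a i y).
  by rewrite -ball_normE /=; apply: lt_trans e2; exact: (close' _ (ltnW iN)).
have B3 : ball (a i x) eta (a i.+1 y).
  rewrite -ball_normE /= -(subrK (a i.+1 x) (a i x)) -addrA (splitr eta).
  by apply: le_lt_trans (ler_normD _ _) _; apply: ltrD; [exact: close|exact: close'].
have K0 := Ka _ _ (ltnW iN) Kx; have K1 := Ka _ _ iN Kx.
have K2 := Ka _ _ (ltnW iN) Ky; have K3 := Ka _ _ iN Ky.
rewrite !hh //; ring.
Qed.

Definition unit_itv : set R^o := [set t | 0 <= t <= 1].

Lemma unit_itv_compact : compact unit_itv.
Proof.
have -> : unit_itv = `[0, 1]%classic by apply/seteqP; split => t /=; rewrite in_itv.
exact: segment_compact.
Qed.

Lemma lift_unique (u : R^o -> X) L L' :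
  lift unit_itv u L -> lift unit_itv u L' -> L 1 - L 0 = L' 1 - L' 0.
Proof.
move=> [e e0 He] [e' e'0 He'].
apply: (@interval_chain R (fun a b => L b - L a = L' b - L' a)) => //.
  by move=> a b c h1 h2; lra.
move=> x hx; exists (Num.min e e' / 2).
  by rewrite divr_gt0 // lt_min e0.
move=> a b ha hb ax bx.
have : `|b - a| < Num.min e e'.
  rewrite -(subrK x b) -addrA (splitr (Num.min e e')).
  by apply: le_lt_trans (ler_normD _ _) _; rewrite ltrD // distrC.
rewrite lt_min => /andP[h1 h2].
by rewrite He ?He'.
Qed.

(** The total increment of a primitive along the path; by [lift_unique] the choice made by [xget]
    does not matter. *)
Definition winding (s : singular_simplex (R := R) X 1) : R^o :=
  xget 0 [set r | exists2 L, lift unit_itv (path_of s) L & r = L 1 - L 0].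

(** Restricting a primitive on [K] to a segment gives one along the path, so a single primitive on a
    square evaluates all faces of a 2-simplex. *)
Lemma winding_lift s V (K : set V) (H : V -> X) L (P Q : V) :
  lift K H L -> (forall t : R, 0 <= t <= 1 -> K (P + t *: (Q - P)) /\
     path_of s t = H (P + t *: (Q - P))) ->
  winding s = L Q - L P.
Proof.
move=> [eta eta0 HL] HP.
have LL : lift unit_itv (path_of s) (fun t => L (P + t *: (Q - P))).
  have d0 : 0 < `|Q - P| + 1 by rewrite ltr_wpDl.
  exists (eta / (`|Q - P| + 1)); first by rewrite divr_gt0.
  move=> x y hx hy xy.
  have [Kx ->] := HP _ hx; have [Ky ->] := HP _ hy.
  apply: HL => //; have -> : P + y *: (Q - P) - (P + x *: (Q - P)) =
      (y - x : R) *: (Q - P).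
    by rewrite opprD addrACA subrr add0r -scalerBl.
  rewrite normrZ; move: xy; rewrite ltr_pdivlMr //; apply: le_lt_trans.
  by rewrite ler_wpM2l // lerDl.
have E : L (P + 1 *: (Q - P)) - L (P + 0 *: (Q - P)) = L Q - L P.
  by rewrite scale1r scale0r addr0 [P + _]addrC subrK.
have [L' hL' ->] : [set r | exists2 L, lift unit_itv (path_of s) L &
    r = L 1 - L 0] (winding s).
  by apply: (@xgetI _ _ _ (L Q - L P)); exists (fun t => L (P + t *: (Q - P))).
by rewrite -E (lift_unique hL' LL).
Qed.

(** The unit square maps onto the triangle with the side z.1 = 0 collapsed to the first vertex.
    Unlike the simplex, the square is star-shaped about 0, as [lift_exists] demands. *)
Definition square_pt (z : R * R) : 'rV[R]_3 :=
  \row_j nth 0 [:: 1 - clamp z.1; clamp z.1 * (1 - clamp z.2);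
                   clamp z.1 * clamp z.2] j.

Lemma square_subproof z : square_pt z \in @std_simplex R 2.
Proof.
have /andP[s0 s1] := clamp_itv z.1; have /andP[t0 t1] := clamp_itv z.2.
apply/mem_set; split => [i|].
  rewrite mxE; case: i => [[|[|[|?]]] ?] //=; rewrite ?subr_ge0 //.
  - by rewrite mulr_ge0 // subr_ge0.
  - by rewrite mulr_ge0.
by rewrite !big_ord_recl big_ord0 !mxE /=; ring.
Qed.

Definition square_param z : set_type (@std_simplex R 2) :=
  SigSub (square_subproof z).

Lemma square_param_continuous : continuous square_param.
Proof.
have c1 : continuous (fun z : R * R => clamp z.1).
  by move=> z; apply: continuous_comp; [exact: cvg_fst|exact: clamp_continuous].
have c2 : continuous (fun z : R * R => clamp z.2).
  by move=> z; apply: continuous_comp; [exact: cvg_snd|exact: clamp_continuous].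
apply: continuous_comp_initial; apply: row_continuous => j.
have -> : (fun t => (set_val \o square_param) t ord0 j) =
  (fun z => nth 0 [:: 1 - clamp z.1; clamp z.1 * (1 - clamp z.2);
                   clamp z.1 * clamp z.2] j).
  by apply/funext => t /=; rewrite mxE.
case: j => [[|[|[|?]]] ?] //= z.
- by apply: cvgB; [exact: cvg_cst|exact: c1].
- by apply: cvgM; [exact: c1|apply: cvgB; [exact: cvg_cst|exact: c2]].
- by apply: cvgM; [exact: c1|exact: c2].
Qed.

(** Pulled back to the square, a 2-simplex has a primitive [L] on all of it. Three sides of the
    square are the faces and the fourth is collapsed to a point, so the alternating sum of the
    increments vanishes. *)
Lemma winding_boundary (c : singular_chain (R := R) X 2) :
  fglift winding (boundary c) = 0.
Proof.
rewrite -(freeg_sumE c) !raddf_sum big1 // => tau _.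
have -> : << coeff tau c *g tau >> = coeff tau c *: << tau >> :> singular_chain (R := R) X 2.
  by apply/eqP/freeg_eqP => y; rewrite coeffZ !coeffU mul1r.
rewrite /= {1}/boundary !fglift_scalable -/(boundary _) boundary1 !big_ord_recl big_ord0 addr0.
rewrite !raddfD /= !fglift_scalable !liftU. 
rewrite -!scalerDr !scale1r expr1 scaleN1r.
have -> : (-1) ^+ bump 0 (bump 0 0) = 1 :> R by rewrite sqrrN expr1n.
rewrite scale1r.
pose H (z : R^o * R^o) := tau (square_param z).
have cH : continuous H.
  move=> z; apply: continuous_comp; first exact: square_param_continuous.
  exact: cts_fun.
have [L HL] : exists L, lift (unit_itv `*` unit_itv) H L.
  apply: lift_exists => //.
    by apply: compact_setX; exact: unit_itv_compact.
  move=> [x y] t [/= /andP[x0 x1] /andP[y0 y1]] /andP[t0 t1].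
  split; rewrite /unit_itv /=;
  rewrite -![_ *: _]/(_ * _) mulr_ge0 //=;
    by rewrite mulr_ile1.
have hit (t : R) : 0 <= t <= 1 -> clamp t = t by exact: clamp_id.
have c0 : clamp 0 = 0 :> R by rewrite clamp_id // lexx ler01.
have c1 : clamp 1 = 1 :> R by rewrite clamp_id // lexx ler01.
have E (P Q : R^o * R^o) i :
  (forall t : R, 0 <= t <= 1 -> (unit_itv `*` unit_itv) (P + t *: (Q - P)) /\
     coface_mx i (simplex1_pt t) = square_pt (P + t *: (Q - P))) ->
  winding (face i tau) = L Q - L P.
  move=> h; apply: (winding_lift HL) => t /h [? e]; split => //.
  by rewrite /path_of /face /H /=; congr (tau _); apply/val_inj.
have rowE (i : 'I_3) (t : R) z : 0 <= t <= 1 ->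
    (forall k : 'I_2, (if k == ord_max then t else 1 - t) =
      square_pt z ord0 (fintype.lift i k)) -> square_pt z ord0 i = 0 ->
    coface_mx i (simplex1_pt t) = square_pt z.
  move=> ht h h0; apply/rowP => j; rewrite [LHS]mxE.
  by case: (unliftP i j) => [k ->|->] /=; [rewrite -h mxE (hit _ ht)|rewrite h0].
have unit0 : 0 <= (0 : R) <= 1 by rewrite lexx ler01.
have unit1 : 0 <= (1 : R) <= 1 by rewrite lexx ler01.
rewrite (E (1, 0) (1, 1)); last first.
  move=> t ht.
  have -> : (1, 0) + t *: ((1, 1) - (1, 0)) = (1, t) :> R^o * R^o.
    by congr pair; rewrite /= -![_ *: _]/(_ * _); ring.
  split => //; apply: rowE => // [k|]; rewrite mxE /= c1 ?(hit t ht).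
    by case: k => [[|[|?]] ?] //=; rewrite mul1r.
  by rewrite subrr.
rewrite (E (0, 1) (1, 1)); last first.
  move=> t ht.
  have -> : (0, 1) + t *: ((1, 1) - (0, 1)) = (t, 1) :> R^o * R^o.
    by congr pair; rewrite /= -![_ *: _]/(_ * _); ring.
  split => //; apply: rowE => // [k|]; rewrite mxE /= c1 ?(hit t ht).
    by case: k => [[|[|?]] ?] //=; rewrite mulr1.
  by rewrite subrr mulr0.
rewrite (E (0, 0) (1, 0)); last first.
  move=> t ht.
  have -> : (0, 0) + t *: ((1, 0) - (0, 0)) = (t, 0) :> R^o * R^o.
    by congr pair; rewrite /= -![_ *: _]/(_ * _); ring.
  split => //; apply: rowE => // [k|]; rewrite mxE /= c0 ?(hit t ht).
    by case: k => [[|[|?]] ?] //=; rewrite subr0 mulr1.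
  by rewrite mulr0.
(* What is left after cancellation is the increment of [L] along the collapsed side. *)
suff <- : L (0, 0) = L (0, 1).
  by rewrite -[RHS](scaler0 _ (coeff tau c)); congr (_ *: _); lra.
have [e e0 He] := HL.
apply: (@locally_constant R _ (fun t => L (0, t)) unit_itv 0 1); last first.
  by move=> x; rewrite min_l // max_r.
move=> x hx; exists e => // y hy xy; apply/eqP; rewrite -subr_eq0; apply/eqP.
rewrite He //; last by rewrite prod_normE /= subrr normr0 gt_max e0.
rewrite /H; have -> : square_param (0, y) = square_param (0, x).
  by apply/val_inj/rowP => j; rewrite !mxE /= c0 !mul0r.
exact: delta_refl.
Qed.
End Winding.

(** * The genus is the number of edges off a spanning tree *)

(* Formal sums are compared coefficientwise, where [ring] applies. *)
Ltac freeg_ring :=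
  let z := fresh "z" in
  apply/eqP/freeg_eqP => z; rewrite ?(coeffB, coeffD, coeffN, coeffZ, coeff0); ring.

Section Spanning.
Context {R : realType} {Gamma : metricType R} (M : model Gamma).
Hypothesis valencyP : forall p : Gamma, exists n, has_valency p n.
Local Notation V := (vert M).
Local Notation E := (edge M).
Local Notation chain1 := (singular_chain (R := R) Gamma 1).
Variable pot : V -> chain1.

Definition arc_path (e : E) (a b : R^o) : singular_simplex (R := R) Gamma 1 :=
  @seg R Gamma R^o (arc e) (@arc_continuous _ _ M e) a b.

(** When [pot] comes from a spanning tree by [tree_potential], this is the fundamental cycle of [e],
    and it is 0 for the edges of the tree. *)
Definition arc_cycle (e : E) : chain1 :=
  << arc_path e 0 (len e) >> + pot (src e) - pot (tgt e).

Definition spanned (c : chain1) : Prop :=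
  exists a : E -> R, bounds (c - \sum_e a e *: arc_cycle e).

Lemma spanned_bounds c : bounds c -> spanned c.
Proof.
move=> hc; exists (fun=> 0); rewrite big1 ?subr0 // => e _; exact: scale0r.
Qed.

Lemma spanned_cycle e : spanned (arc_cycle e).
Proof.
exists (fun e' => (e' == e)%:R); rewrite (bigD1 e) //= eqxx scale1r big1.
  by rewrite addr0 subrr; exact: bounds0.
by move=> e' /negbTE ->; exact: scale0r.
Qed.

Lemma spannedD c d : spanned c -> spanned d -> spanned (c + d).
Proof.
move=> [a ha] [b hb]; exists (fun e => a e + b e).
under eq_bigr do rewrite scalerDl.
by rewrite big_split /= opprD addrACA; exact: boundsD.
Qed.

Lemma spannedZ k c : spanned c -> spanned (k *: c).
Proof.
move=> [a ha]; exists (fun e => k * a e).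
under eq_bigr do rewrite -scalerA.
by rewrite -scaler_sumr -scalerBr; exact: boundsZ.
Qed.

Lemma spannedN c : spanned c -> spanned (- c).
Proof. by rewrite -scaleN1r; exact: spannedZ. Qed.

Lemma spannedB c d : spanned c -> spanned d -> spanned (c - d).
Proof. by move=> hc hd; apply: spannedD => //; exact: spannedN. Qed.

Lemma base_exists (x : Gamma) : exists c : chain1,
  (exists2 v, x = vtx v & c = pot v) \/ (exists e s,
    [/\ 0 < s < len e, x = arc e s & c = pot (src e) + << arc_path e 0 s >>]).
Proof.
have [[v ->]|[e [s [hs ->]]]] := model_cover M x.
  by exists (pot v); left; exists v.
by exists (pot (src e) + << arc_path e 0 s >>); right; exists e, s.
Qed.

(** Extends [pot] from the vertices to all points by the initial piece of the arc; it is the chain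
    used to close up a path at its two ends. *)
Definition base : Gamma -> chain1 := projT1 (choice base_exists).

Lemma base_vtx v : base (vtx v) = pot v.
Proof.
rewrite /base; case: choice => b /= /(_ (vtx v)) [[w vw ->]|[e [s [hs vs _]]]].
  by rewrite (vtx_inj vw).
by case: (arc_vtx hs (esym vs)).
Qed.

Lemma base_arc_open e s : 0 < s < len e ->
  base (arc e s) = pot (src e) + << arc_path e 0 s >>.
Proof.
move=> hs; rewrite /base; case: choice => b /= /(_ (arc e s)) [[v vs _]|].
  by case: (arc_vtx hs vs).
move=> [e' [s' [hs' ss' ->]]]; have ee := arc_disjoint hs hs' ss'.
rewrite -ee in hs' ss' *; rewrite (arc_inj _ _ ss') //.
  by case/andP: hs => /ltW -> /ltW ->.
by case/andP: hs' => /ltW -> /ltW ->.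
Qed.

(** At an interior point the difference is 0, and at the source it is a constant path up to sign. At
    the target it is minus the arc cycle: this is where the spanning family enters. *)
Lemma base_arc e s : 0 <= s <= len e ->
  spanned (base (arc e s) - pot (src e) - << arc_path e 0 s >>).
Proof.
move=> /andP[]; rewrite le_eqVlt => /predU1P[<- _|s0].
  rewrite arc_src base_vtx subrr sub0r; apply/spannedN/spanned_bounds/seg_const.
  by move=> t _; rewrite subrr scaler0 addr0.
rewrite le_eqVlt => /predU1P[->|sl].
  rewrite arc_tgt base_vtx; have -> : pot (tgt e) - pot (src e) -
      << arc_path e 0 (len e) >> = - arc_cycle e.
    by rewrite /arc_cycle; freeg_ring.
  exact/spannedN/spanned_cycle.
rewrite base_arc_open ?s0 //; set x := pot _; set y := << _ >>.
have -> : x + y - x - y = 0 by freeg_ring.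
exact/spanned_bounds/bounds0.
Qed.

Lemma base_arc_path e s s' : 0 <= s <= len e -> 0 <= s' <= len e ->
  spanned (<< arc_path e s s' >> - base (arc e s') + base (arc e s)).
Proof.
move=> hs hs'.
have h1 := base_arc hs; have h2 := base_arc hs'.
have h3 := spanned_bounds (seg_cat (@arc_continuous _ _ M e : continuous (arc e : R^o -> Gamma)) 0 s s').
have := spannedD (spannedB h1 h2) h3; rewrite /arc_path.
set a := << seg _ 0 s >>; set b := << seg _ s s' >>; set c := << seg _ 0 s' >>.
set x := base _; set y := base _; set z := pot _.
suff -> : b - y + x = x - z - a - (y - z - c) + (a + b - c) by [].
freeg_ring.
Qed.

(** The radial contraction to [p] spans a square [H] over the path. Its bottom is constant, so the
    path is homologous to the descent from its first point to [p] followed by the ascent to its last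
    point, and both run along single arcs. *)
Lemma small_path (p : Gamma) : exists2 rho : R, 0 < rho &
  forall (u : R^o -> Gamma) (cu : continuous u) (a b : R),
  (forall t : R, 0 <= t <= 1 -> mdist p (u (a + t * (b - a))) < rho) ->
  spanned (<< seg cu a b >> - base (u b) + base (u a)).
Proof.
have [n np] := valencyP p.
have [r0 r00 [C hC]] := star_contraction np.
have [r1 r10 hr1] := near_arcs M p.
exists (Num.min r0 r1); first by rewrite lt_min r00.
move=> u cu a b hu.
pose w (s : R^o) := u (a + clamp s * (b - a)).
have cw : continuous w.
  move=> s; apply: continuous_comp; last exact: cu.
  by apply: cvgD; [exact: cvg_cst|apply: cvgM; [exact: clamp_continuous|exact: cvg_cst]].
have wr s : mdist p (w s) < Num.min r0 r1 by apply: hu; exact: clamp_itv.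
have w0 s : mdist p (w s) < r0 by have := wr s; rewrite lt_min => /andP[].
pose H (z : R^o * R^o) := C (w z.1) (clamp z.2).
have cH : continuous H.
  move=> z; apply/metricType_numDomainType.cvgrPdist_lt => eps eps0.
  have e2 : 0 < eps / 2 by rewrite divr_gt0.
  have c1 : \forall z' \near z, mdist (w z.1) (w z'.1) < eps / 2.
    have : w z'.1 @[z' --> z] --> w z.1.
      by apply: continuous_comp; [exact: cvg_fst|exact: cw].
    by move=> /metricType_numDomainType.cvgrPdist_lt; exact.
  have c2 : \forall z' \near z, `|clamp z.2 - clamp z'.2| < eps / 2 / r0.
    have : clamp z'.2 @[z' --> z] --> clamp z.2.
      by apply: continuous_comp; [exact: cvg_snd|exact: clamp_continuous].
    by move=> /cvgrPdist_lt; apply; rewrite divr_gt0.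
  near=> z'; have [_ _ lip _] := hC _ (w0 z.1).
  apply: le_lt_trans (lip _ _ _ (w0 z'.1) (clamp_itv _) (clamp_itv _)) _.
  rewrite (splitr eps); apply: ltrD; first by near: z'.
  by rewrite mulrC -ltr_pdivlMr //; near: z'.
have rad s : C (w s) 0 = p.
  by have [] := hC _ (w0 s).
have c0 : clamp 0 = 0 :> R by rewrite clamp_id // lexx ler01.
have c1 : clamp 1 = 1 :> R by rewrite clamp_id // lexx ler01.
pose A : R^o * R^o := (0, 1); pose B : R^o * R^o := (1, 1).
pose A0 : R^o * R^o := (0, 0); pose B0 : R^o * R^o := (1, 0).
(* A point w s near [p] is [p] itself or shares an arc with [p]. The arc is a geodesic, so the
   contraction follows it. The pair [P], [Q] covers both directions of travel. *)
have radial s (P Q : R) :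
    (P = 0 /\ Q = 1 -> spanned (<< seg cH (s, P) (s, Q) >> - base (w s) + base p))
    /\ (P = 1 /\ Q = 0 -> spanned (<< seg cH (s, P) (s, Q) >> - base p + base (w s))).
  have lin (t : R) : (s, P) + t *: ((s, Q) - (s, P)) = (s, P + t * (Q - P)) :> R^o * R^o.
    by congr pair; rewrite /= -![_ *: _]/(_ * _); ring.
  have [C0 C1 _ Cu] := hC _ (w0 s).
  have : mdist p (w s) < r1 by have := wr s; rewrite lt_min => /andP[].
  case/hr1 => [wp|[e [t [t' [ht ht' pe we]]]]].
    have cst : bounds << seg cH (s, P) (s, Q) >>.
      apply: seg_const => l hl; rewrite lin /H /=.
      have hp l' : 0 <= l' <= 1 -> C (w s) l' = p.
        by move=> h; apply/esym/Cu => //; rewrite wp mdistxx ?mulr0.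
      by rewrite !hp ?clamp_itv.
    rewrite wp -!addrA addNr addr0.
    by split=> _; exact: spanned_bounds.
  have Ce l : 0 <= l <= 1 -> C (w s) l = arc e (t + l * (t' - t)).
    move=> /andP[l0 l1]; apply/esym/Cu; first by rewrite l0.
    - rewrite we pe !arc_isometry //.
      + have -> : t - (t + l * (t' - t)) = l * (t - t') by ring.
        by rewrite normrM ger0_norm.
      + by nra.
    - rewrite we pe !arc_isometry //.
      + have -> : t + l * (t' - t) - t' = (1 - l) * (t - t') by ring.
        by rewrite normrM ger0_norm // subr_ge0.
      + by nra.
  have hl (l : R) : 0 <= l <= 1 -> H ((s, l) : R^o * R^o) = arc e (t + l * (t' - t)).
    by move=> h; rewrite /H /= clamp_id // Ce.
  split=> -[P0 Q0].
    rewrite we pe; suff -> : seg cH (s, P) (s, Q) = arc_path e t t'.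
      exact: base_arc_path.
    apply: seg_eq => l h; rewrite lin P0 Q0 subr0 mulr1 add0r hl //.
  rewrite we pe; suff -> : seg cH (s, P) (s, Q) = arc_path e t' t.
    exact: base_arc_path.
  apply: seg_eq => l /andP[l0 l1]; rewrite lin P0 Q0 sub0r mulrN1 hl ?subr_ge0 ?l1 //=.
    by congr arc; rewrite -[_ *: _]/(_ * _); ring.
  by rewrite gerBl.
have -> : seg cu a b = seg cH A B.
  apply: seg_eq => t ht; rewrite /A /B.
  have -> : (0, 1) + t *: ((1, 1) - (0, 1)) = (t, 1) :> R^o * R^o.
    by congr pair; rewrite /= -![_ *: _]/(_ * _); ring.
  rewrite /H /= c1; have [_ -> _ _] := hC _ (w0 t).
  by rewrite /w clamp_id.
have [_ h1] := radial 0 1 0; have {}h1 := h1 (conj erefl erefl).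
have [h2 _] := radial 1 0 1; have {}h2 := h2 (conj erefl erefl).
have h3 := spanned_bounds (seg_cat cH A A0 B).
have h4 := spanned_bounds (seg_cat cH A0 B0 B).
have h5 : spanned << seg cH A0 B0 >>.
  apply/spanned_bounds/seg_const => t _; rewrite /H /= c0.
  have -> : clamp (0 + t *: (0 - 0)) = 0 :> R.
    by rewrite subrr scaler0 addr0 c0.
  by rewrite !rad.
have ua : w 0 = u a by rewrite /w c0 mul0r addr0.
have ub : w 1 = u b by rewrite /w c1 mul1r addrC subrK.
rewrite ua in h1; rewrite ub in h2.
have := spannedB (spannedD (spannedD h1 h2) h5) (spannedD h3 h4).
rewrite -/A -/A0 -/B0 -/B.
set x1 := << seg _ A B >>; set x2 := << seg _ A A0 >>; set x3 := << seg _ A0 B >>.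
set x4 := << seg _ A0 B0 >>; set x5 := << seg _ B0 B >>.
set y1 := base p; set y2 := base (u a); set y3 := base (u b).
suff -> : x1 - y3 + y2 = 
  x2 - y1 + y2 + (x5 - y3 + y1) + x4 - (x2 + x3 - x1 + (x4 + x5 - x3)) by [].
freeg_ring.
Unshelve. all: by end_near. Qed.

End Spanning.

(** * Spanning and independence of the fundamental cycles *)

Section Rank.
Context {R : realType} {Gamma : metricType R} (M : model Gamma).
Hypothesis valencyP : forall p : Gamma, exists n, has_valency p n.
Local Notation V := (vert M).
Local Notation E := (edge M).
Local Notation chain1 := (singular_chain (R := R) Gamma 1).

Lemma freeg_basis n (c : singular_chain (R := R) Gamma n) :
  c = \sum_(z <- dom c) coeff z c *: << z >>.
Proof.
rewrite -[LHS]freeg_sumE; apply: eq_bigr => z _.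
by apply/eqP/freeg_eqP => y; rewrite coeffZ !coeffU mul1r.
Qed.

Lemma simplex0_subproof : const_mx 1 \in @std_simplex R 0.
Proof.
apply/mem_set; split => [i|]; first by rewrite mxE.
by rewrite big_ord_recl big_ord0 mxE addr0.
Qed.

Definition simplex0_point : set_type (@std_simplex R 0) :=
  SigSub simplex0_subproof.

(** The property is transitive in the parameters by [seg_cat] and holds at small scale by
    [small_path]. *)
Lemma spanned_path (pot : V -> chain1) (s : singular_simplex (R := R) Gamma 1) :
  spanned pot (<< s >> - base pot (path_of s 1) + base pot (path_of s 0)).
Proof.
pose cu := @path_of_continuous R Gamma s; pose u := path_of s.
have : spanned pot (<< seg cu 0 1 >> - base pot (u 1) + base pot (u 0)).
  apply: (@interval_chain R (fun a b =>
    spanned pot (<< seg cu a b >> - base pot (u b) + base pot (u a))) 1) => //.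
    move=> a b c h1 h2.
    have := spannedB (spannedD h1 h2) (spanned_bounds pot (seg_cat cu a b c)).
    set x1 := << _ >>; set x2 := << _ >>; set x3 := << _ >>.
    set y1 := base _ _; set y2 := base _ _; set y3 := base _ _.
    suff -> : x3 - y3 + y2 = x1 - y1 + y2 + (x2 - y3 + y1) - (x1 + x2 - x3) by [].
    freeg_ring.
  move=> x _; have [rho rho0 hrho] := small_path valencyP pot (u x).
  have /metricType_numDomainType.cvgrPdist_lt : u t @[t --> x] --> u x by exact: cu.
  move=> /(_ rho rho0) /nbhs_ballP[e /= e0 he]; exists e => //.
  move=> a b _ _ ax bx; apply: hrho => t /andP[t0 t1]; apply: he.
  rewrite /ball /=.
  have -> : x - (a + t * (b - a)) = (1 - t) * (x - a) + t * (x - b) by ring.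
  apply: le_lt_trans (ler_normD _ _) _.
  rewrite !normrM [`|1 - t|]ger0_norm ?subr_ge0 // [`|t|]ger0_norm //.
  rewrite distrC [`|x - b|]distrC; set P := `|a - x| in ax *; set Q := `|b - x| in bx *.
  have mP : P <= Num.max P Q by rewrite le_max lexx.
  have mQ : Q <= Num.max P Q by rewrite le_max lexx orbT.
  by apply: (@le_lt_trans _ _ (Num.max P Q)); [nra|rewrite gt_max ax].
by rewrite seg_path_of.
Qed.

(** With [B] the linear extension of [base] to 0-chains, c - B (boundary c) is spanned for a simplex
    by [spanned_path], hence for every chain; on a cycle the correction is 0. *)
Lemma cycle_spanned (pot : V -> chain1) (c : chain1) :
  boundary c = 0 -> spanned pot c.
Proof.
pose B := fglift (fun s : singular_simplex (R := R) Gamma 0 =>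
  base pot (s simplex0_point)).
suff H : spanned pot (c - B (boundary c)).
  by move=> c0; move: H; rewrite c0 /B raddf0 subr0.
have BD x y : x + y - B (boundary (x + y)) =
    (x - B (boundary x)) + (y - B (boundary y)).
  by rewrite /B !raddfD /= addrACA.
have BZ k x : k *: x - B (boundary (k *: x)) = k *: (x - B (boundary x)).
  by rewrite scalerBr /B /boundary !fglift_scalable.
rewrite (freeg_basis c); elim: (dom c) => [|z r IH].
  by rewrite big_nil /B !raddf0 addr0; apply/spanned_bounds/bounds0.
rewrite big_cons BD BZ; apply: spannedD IH; apply: spannedZ.
have := spanned_path pot z; rewrite -{5}(seg_path_of z) boundary_seg.
rewrite /B raddfB /= !liftU !scale1r opprB addrA.
by rewrite [<< z >> - _ + _]addrAC.
Qed.

(* Signed number of crossings of the midpoint of the arc, for x close to y. *)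
Definition midpoint_jump (e : E) (x y : Gamma) : R :=
  if `[< open_arc e x /\ open_arc e y >] then
    (`[< exists2 s, len e / 2 <= s < len e & y = arc e s >])%:R -
    (`[< exists2 s, len e / 2 <= s < len e & x = arc e s >])%:R
  else 0.

Lemma midpoint_jump_arc e s t : 0 < s < len e -> 0 < t < len e ->
  midpoint_jump e (arc e s) (arc e t) = (len e / 2 <= t)%R%:R - (len e / 2 <= s)%R%:R.
Proof.
move=> hs ht; rewrite /midpoint_jump; case: asboolP => [_|[]]; last first.
  by split; [exists s|exists t].
have H (z : R) : 0 < z < len e -> `[< exists2 s, len e / 2 <= s < len e & arc e z = arc e s >]
    = (len e / 2 <= z).
  move=> hz; apply/asboolP/idP => [[s' /andP[h1 h2] /arc_inj ->] //|h].
  - by case/andP: hz => /ltW -> /ltW.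
  - by rewrite (ltW h2) andbT (le_trans _ h1) // divr_ge0 // ltW // len_gt0.
  - by exists z => //; case/andP: hz => _ ->; rewrite h.
by rewrite !H.
Qed.

Lemma midpoint_jump_out e x y : ~ (open_arc e x /\ open_arc e y) ->
  midpoint_jump e x y = 0.
Proof. by rewrite /midpoint_jump; case: asboolP. Qed.

(** Inside the open arc the indicator of its second half is a primitive; off the closed arc there
    are no jumps. Around an end, the ball of radius len e / 2 meets only one half of the open
    arc. *)
Lemma midpoint_jump_cocycle e (p : Gamma) : exists2 U, nbhs p U &
  exists h : Gamma -> R, forall y z, U y -> U z ->
    midpoint_jump e y z = h z - h y.
Proof.
have l0 : 0 < len e := len_gt0 e.
have l2 : 0 < len e / 2 by rewrite divr_gt0.
have [pe|pe] := pselect (open_arc e p).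
  exists (open_arc e); first by apply: open_nbhs_nbhs; split => //; exact: open_arc_open.
  exists (fun y => (`[< exists2 s, len e / 2 <= s < len e & y = arc e s >])%:R).
  by move=> y z hy hz; rewrite /midpoint_jump; case: asboolP => // -[].
have [[s /= hs ps]|pc] := pselect (closed_arc e p); last first.
  exists (~` closed_arc e).
    by apply: open_nbhs_nbhs; split => //; apply: closed_openC; exact: closed_arc_closed.
  exists (fun=> 0) => y z hy _; rewrite subrr midpoint_jump_out // => -[[t ht yt] _].
  by apply: hy; exists t => //=; case/andP: ht => /ltW -> /ltW.
exists (ball p (len e / 2)); first exact: nbhsx_ballx.
exists (fun=> 0) => y z; rewrite !ballEmdist /= => py pz; rewrite subrr.
have [[[t ht yt] [t' ht' zt]]|] := pselect (open_arc e y /\ open_arc e z); last first.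
  exact: midpoint_jump_out.
have tc : 0 <= t <= len e by case/andP: ht => /ltW -> /ltW ->.
have tc' : 0 <= t' <= len e by case/andP: ht' => /ltW -> /ltW ->.
rewrite -yt -zt midpoint_jump_arc //.
move: py pz; rewrite -yt -zt -ps !arc_isometry //.
have /andP[s0 sl] := hs; have /andP[t0 tl] := ht; have /andP[t'0 t'l] := ht'.
have [->|s0'] := eqVneq s 0.
  rewrite !sub0r !normrN (ger0_norm (ltW t0)) (ger0_norm (ltW t'0)) => h1 h2.
  by rewrite [(len e / 2 <= t)]leNgt h1 [(len e / 2 <= t')]leNgt h2 subrr.
have [->|sl'] := eqVneq s (len e).
  rewrite (@ger0_norm _ (len e - t)) ?(@ger0_norm _ (len e - t')); rewrite ?subr_ge0 ?(ltW tl) ?(ltW t'l) //.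
  move=> h1 h2.
  have -> : len e / 2 <= t' by lra.
  have -> : len e / 2 <= t by lra.
  by rewrite subrr.
case: pe; exists s => //=; rewrite lt_neqAle eq_sym s0' s0 /=.
by rewrite lt_neqAle sl' sl.
Qed.

Definition arc_winding (e : E) : chain1 -> R^o :=
  fglift (winding (midpoint_jump e)).

Lemma path_of_seg (W : normedModType R) (H : W -> Gamma) (cH : continuous H) P Q t :
  path_of (seg cH P Q) t = H (P + clamp t *: (Q - P)).
Proof. by rewrite /path_of seg_eval /= mxE. Qed.

Lemma arc_winding_path (e e' : E) :
  arc_winding e << arc_path e' 0 (len e') >> = (e == e')%:R.
Proof.
rewrite /arc_winding liftU scale1r.
have l0 : 0 < len e' := len_gt0 e'.
pose L (s : R^o) : R := (e == e')%:R * (len e / 2 <= s)%R%:R.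
have HL : lift (midpoint_jump e) ([set s : R^o | 0 <= s <= len e']) (arc e') L.
  rewrite /L; case: eqP => [->|ne]; last first.
    exists 1 => // x y hx hy _; rewrite !mul0r subrr midpoint_jump_out //.
    move=> [[s hs] sx _]; apply: ne.
    exact: arc_disjoint_closed hs hx sx.
  (* [midpoint_jump] is 0 when one argument is an end of the arc. At this scale the other argument
     then lies in the same half, where [L] does not jump either. *)
  exists (len e' / 2); first by rewrite divr_gt0.
  move=> x y /= hx hy xy; rewrite !mul1r.
  have [x0|x0] := pselect (0 < x < len e').
    have [y0|y0] := pselect (0 < y < len e').
      by rewrite midpoint_jump_arc.
    rewrite midpoint_jump_out; last first.
      move=> [_ [s hs /arc_inj sy]]; apply: y0; rewrite -sy //.
      by case/andP: hs => /ltW -> /ltW ->.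
    have : y = 0 \/ y = len e'.
      move: y0 hy; case: (ltgtP 0 y) => // [|<-]; last by left.
      by case: (ltgtP y (len e')) => //; right.
    case=> yE; rewrite yE in xy *; move: xy; rewrite ltr_norml => /andP[h1 h2].
      have -> : (len e' / 2 <= 0) = false by apply/negbTE; rewrite -ltNge; lra.
      have -> : (len e' / 2 <= x) = false by apply/negbTE; rewrite -ltNge; lra.
      by rewrite subrr.
    have -> : (len e' / 2 <= len e') by lra.
    have -> : (len e' / 2 <= x) by lra.
    by rewrite subrr.
  rewrite midpoint_jump_out; last first.
    move=> [[s hs /arc_inj sx] _]; apply: x0; rewrite -sx //.
    by case/andP: hs => /ltW -> /ltW ->.
  have : x = 0 \/ x = len e'.
    move: x0 hx; case: (ltgtP 0 x) => // [|<-]; last by left.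
    by case: (ltgtP x (len e')) => //; right.
  case=> xE; rewrite xE in xy *; move: xy; rewrite ltr_norml => /andP[h1 h2].
    have -> : (len e' / 2 <= 0) = false by apply/negbTE; rewrite -ltNge; lra.
    have -> : (len e' / 2 <= y) = false by apply/negbTE; rewrite -ltNge; lra.
    by rewrite subrr.
  have -> : (len e' / 2 <= len e') by lra.
  have -> : (len e' / 2 <= y) by lra.
  by rewrite subrr.
rewrite (winding_lift (P := 0) (Q := len e') HL).
  rewrite /L; case: eqP => [->|_]; last by rewrite !mul0r subrr.
  have -> : (len e' / 2 <= 0) = false by apply/negbTE; rewrite -ltNge; lra.
  have -> : (len e' / 2 <= len e') by lra.
  by rewrite !mul1r subr0.
move=> t /andP[t0 t1]; split; last by rewrite /arc_path path_of_seg clamp_id // t0.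
rewrite /= add0r subr0 -[_ *: _]/(_ * _); apply/andP; split; nra.
Qed.

End Rank.

Section Genus.
Context {R : realType} {Gamma : metricType R} (M : model Gamma).
Hypothesis valencyP : forall p : Gamma, exists n, has_valency p n.
Local Notation V := (vert M).
Local Notation E := (edge M).
Local Notation chain1 := (singular_chain (R := R) Gamma 1).
Variables (root : V) (T : {set E}).
Hypothesis treeT : tree (@src _ _ M) (@tgt _ _ M) root [set: V]%SET T.

Lemma tree_vertices (P : V -> Prop) : P root ->
  (forall e, e \in T -> P (src e) <-> P (tgt e)) -> forall v, P v.
Proof.
move=> Pr hP v; pose A := [set v | `[< P v >]]%SET.
have := tree_spanning_connecting treeT root v.
have st e : e \in T -> ~~ crossing (@src _ _ M) (@tgt _ _ M) A e.
  move=> eT; rewrite /crossing !finset.inE; apply/negP.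
  by case: asboolP => s; case: asboolP => t // _; have := hP e eT; tauto.
move/(connect_stable st); rewrite !finset.inE.
by case: asboolP => // _; case: asboolP.
Qed.

Lemma arc_winding_boundary (e : E) (b : singular_chain (R := R) Gamma 2) :
  arc_winding e (boundary b) = 0.
Proof. apply: winding_boundary; exact: midpoint_jump_cocycle. Qed.

(** The given basis [z] and the fundamental cycles [C] are expanded in each other modulo boundaries;
    the two coefficient matrices turn out to be inverse, so their sizes agree. *)
Lemma genus_cotree g : has_genus (R := R) Gamma g -> g = #|~: T|%SET.
Proof.
move=> [z [zcycle zbasis]].
have [pot pot0 potE] := @tree_potential _ _ (@src _ _ M) (@tgt _ _ M) chain1
  (fun e => << arc_path e 0 (len e) >>) root _ _ treeT.
pose c (e : E) := arc_cycle pot e.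
have cT e : e \in T -> c e = 0.
  move=> /potE h; rewrite /c /arc_cycle -h; set x := pot _; set y := pot _.
  by freeg_ring.
have boundary_path (e : E) : boundary << arc_path e 0 (len e) >> =
    << pt (vtx (tgt e)) >> - << pt (vtx (src e)) >>
    :> singular_chain (R := R) Gamma 0.
  by rewrite /arc_path boundary_seg arc_src arc_tgt.
have bpot v : boundary (pot v) = << pt (vtx v) >> - << pt (vtx root) >>
    :> singular_chain (R := R) Gamma 0.
  move: v; apply: tree_vertices; first by rewrite pot0 raddf0 subrr.
  move=> e eT; have -> : pot (tgt e) = << arc_path e 0 (len e) >> + pot (src e).
    by rewrite -(potE e eT) subrK.
  rewrite raddfD /= boundary_path.
  set x := boundary _; set p := << _ >>; set q := << _ >>; set r := << _ >>.
  split=> [->|]; first by freeg_ring.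
  move/eqP; rewrite -subr_eq0 => /eqP h; apply/eqP; rewrite -subr_eq0 -h.
  by apply/eqP; freeg_ring.
have ccycle e : boundary (c e) = 0.
  rewrite /c /arc_cycle raddfB raddfD /= boundary_path !bpot.
  by set p := << _ >>; set q := << _ >>; set r := << _ >>; freeg_ring.
(* Along an edge of [T] the potential changes by that arc, which does not wind around an arc off the
   tree. *)
have wpot e v : e \notin T -> arc_winding e (pot v) = 0.
  move=> eT; move: v; apply: tree_vertices; first by rewrite pot0 /arc_winding raddf0.
  move=> e' e'T; have -> : pot (tgt e') = << arc_path e' 0 (len e') >> + pot (src e').
    by rewrite -(potE e' e'T) subrK.
  rewrite /arc_winding raddfD /= -!/(arc_winding _ _) arc_winding_path.
  have -> : (e == e') = false by apply: contraNF eT => /eqP ->.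
  by rewrite add0r.
have wc e e' : e \notin T -> arc_winding e (c e') = (e == e')%:R.
  move=> eT; rewrite /c /arc_cycle /arc_winding raddfB raddfD /=.
  by rewrite -!/(arc_winding _ _) !wpot // arc_winding_path addr0 subr0.
pose k := #|(~: T)%SET|; pose C (j : 'I_k) := c (enum_val j).
have span d : boundary d = 0 -> exists a : 'I_k -> R,
    bounds (d - \sum_j a j *: C j).
  move=> /(cycle_spanned valencyP pot)[a ha]; exists (fun j => a (enum_val j)).
  suff <- : \sum_e a e *: arc_cycle pot e = \sum_j a (enum_val j) *: C j by [].
  rewrite (bigID (mem (~: T)%SET)) /= [X in _ + X]big1 ?addr0; last first.
    by move=> e; rewrite finset.inE negbK => eT; rewrite -/(c e) cT // scaler0.
  by rewrite big_enum_val.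
have exA j : exists a : {ffun 'I_g -> R}, bounds (C j - \sum_i a i *: z i).
  by have [a [ha _]] := zbasis (C j) (ccycle _); exists a.
have [A hA] := choice exA.
have [B hB] := choice (fun i => span (z i) (zcycle i)).
pose mA : 'M[R]_(k, g) := \matrix_(j, i) A j i.
pose mB : 'M[R]_(g, k) := \matrix_(i, j) B i j.
(* Winding numbers around the arcs off the tree vanish on boundaries and are dual to the [C j];
   applied to both expansions they read off the entries. *)
have AB : mA *m mB = 1%:M.
  apply/matrixP => j j'; rewrite !mxE.
  have nT (l : 'I_k) : enum_val l \notin T.
    by have := enum_valP l; rewrite finset.inE.
  have W (d : chain1) : bounds d -> arc_winding (enum_val j') d = 0.
    by move=> [b' ->]; exact: arc_winding_boundary.
  have := W _ (hA j); rewrite /arc_winding raddfB raddf_sum /=.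
  under eq_bigr do rewrite fglift_scalable.
  rewrite -!/(arc_winding _ _) wc // => /eqP; rewrite subr_eq0 => /eqP.
  have -> : (enum_val j' == enum_val j) = (j == j').
    by rewrite eq_sym (inj_eq enum_val_inj).
  move=> ->; apply: eq_bigr => i _; rewrite !mxE; congr (_ * _).
  have := W _ (hB i); rewrite /arc_winding raddfB raddf_sum /=.
  under eq_bigr do rewrite fglift_scalable.
  rewrite -!/(arc_winding _ _) => /eqP; rewrite subr_eq0 => /eqP ->.
  rewrite (bigD1 j') //= -/(arc_winding _ _) wc // eqxx big1 ?addr0; first by rewrite [_ *: _]mulr1.
  move=> l lj; rewrite -/(arc_winding _ _) wc // (inj_eq enum_val_inj) eq_sym (negbTE lj).
  exact: mulr0.
(* Substituting the expansions of the [C j] into that of [z i] gives coordinates of [z i] in its own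
   basis, which are unique. *)
have BA : mB *m mA = 1%:M.
  apply/matrixP => i i'; rewrite !mxE.
  have [a [ha uniq]] := zbasis (z i) (zcycle i).
  have e1 : a = [ffun l => (i == l)%:R].
    apply: uniq; exists 0; rewrite raddf0 (bigD1 i) //= ffunE eqxx scale1r.
    rewrite big1 ?addr0 ?subrr // => l li; rewrite ffunE eq_sym (negbTE li).
    exact: scale0r.
  have e2 : a = [ffun l => \sum_j B i j * A j l].
    apply: uniq.
    have h : bounds (\sum_j B i j *: (C j - \sum_l A j l *: z l)).
      by apply: bounds_sum => j; apply: boundsZ; exact: hA.
    suff -> : z i - \sum_l [ffun l => \sum_j B i j * A j l] l *: z l =
      (z i - \sum_j B i j *: C j) + \sum_j B i j *: (C j - \sum_l A j l *: z l).
      exact: boundsD (hB i) h.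
    have -> : \sum_j B i j *: (C j - \sum_l A j l *: z l) =
        \sum_j B i j *: C j - \sum_j \sum_l (B i j * A j l) *: z l.
      rewrite -sumrB; apply: eq_bigr => j _; rewrite scalerBr scaler_sumr.
      by congr (_ - _); apply: eq_bigr => l _; rewrite scalerA.
    rewrite addrA subrK exchange_big; congr (_ - _).
    by apply: eq_bigr => l _; rewrite ffunE scaler_suml.
  have := congr1 (fun f : {ffun 'I_g -> R} => f i') (etrans (esym e1) e2).
  rewrite /= !ffunE => ->; apply: eq_bigr => j _; rewrite !mxE //.
by apply/eqP; rewrite eqn_leq (mulmx1_min AB) (mulmx1_min BA).
Qed.

End Genus.

(** * Contractibility of trees *)

Section TreeContractible.
Context {R : realType} {Gamma : metricType R}.

Lemma within_comp (X Y Z : topologicalType) (S : set X) (D : set Y)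
    (j : X -> Y) (H : Y -> Z) : {within S, continuous j} ->
  (forall x, S x -> D (j x)) -> {within D, continuous H} ->
  {within S, continuous (H \o j)}.
Proof.
move=> /subspace_continuousP cj SD /subspace_continuousP cH.
apply/subspace_continuousP => x Sx U nU.
have h1 := cH _ (SD x Sx) U nU.
have h2 : nbhs x [set y | S y -> D (j y) -> U (H (j y))] := cj x Sx _ h1.
suff : nbhs x [set y | S y -> U (H (j y))] by [].
by apply: filterS h2 => y /= h Sy; apply: h => //; exact: SD.
Qed.

Lemma within_eq (X Z : topologicalType) (S : set X) (f g : X -> Z) :
  (forall x, S x -> f x = g x) -> continuous f -> {within S, continuous g}.
Proof.
move=> fg cf; apply/subspace_continuousP => x Sx U nU.
have nU' : nbhs (f x) U by rewrite (fg x Sx).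
have h2 : nbhs x [set y | U (f y)] := cf x U nU'.
suff : nbhs x [set y | S y -> U (g y)] by [].
by apply: filterS h2 => y /= Uy Sy; rewrite /= -(fg y Sy).
Qed.

Lemma setX_closed (X Y : topologicalType) (A : set X) (B : set Y) :
  closed A -> closed B -> closed (A `*` B).
Proof.
move=> cA cB; have -> : A `*` B = (fst @^-1` A) `&` (snd @^-1` B).
  by apply/seteqP; split => -[x y].
by apply: closedI; apply: preimage_closed => //; move=> x _;
  [exact: cvg_fst|exact: cvg_snd].
Qed.

(** The attached arc is first slid down to its foot g 0, in the first half of the time, and then [A]
    is contracted. The position on the arc is its distance [m] from the foot, so [slide] is
    continuous everywhere and can be pasted with the identity on the closed set [A]. *)
Lemma contractible_attach (A : set Gamma) (g : R -> Gamma) (l : R) :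
  contractible (R := R) A -> closed A -> 0 < l -> continuous g ->
  (forall s t, 0 <= s <= l -> 0 <= t <= l -> mdist (g s) (g t) = `|s - t|) ->
  A (g 0) -> (forall s, 0 < s <= l -> ~ A (g s)) ->
  contractible (R := R) (A `|` g @` [set s | 0 <= s <= l]).
Proof.
move=> [a Aa [H [cH HA H0 H1]]] clA l0 cg ig Ag0 gA.
set B := g @` _.
have clB : closed B.
  apply: compact_closed; first exact: metric_hausdorff.
  rewrite /B; have -> : [set s | 0 <= s <= l] = `[0, l]%classic.
    by apply/seteqP; split => s /=; rewrite in_itv.
  apply: continuous_compact; last exact: segment_compact.
  exact: continuous_subspaceT.
pose m z := mdist (g 0) z.
have mB s : 0 <= s <= l -> m (g s) = s.
  move=> hs; have h0 : (0 : R) <= 0 <= l by rewrite lexx ltW.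
  by rewrite /m (ig 0 s h0 hs) sub0r normrN ger0_norm //; case/andP: hs.
have cm : continuous m.
  move=> z; apply/cvgrPdist_lt => e e0.
  near=> z'; rewrite /m.
  have : mdist z z' < e.
    by near: z'; apply/nbhs_ballP; exists e => // w; rewrite ballEmdist.
  have h1 := metric_triangle (g 0) z z'; have h2 := metric_triangle (g 0) z' z.
  by rewrite [mdist z' z]metric_sym in h2; rewrite ltr_norml => h3; apply/andP; split; lra.
pose slide (zt : Gamma * R) := g ((1 - zt.2) * m zt.1).
have cslide : continuous slide.
  move=> zt; apply: (@continuous_comp _ _ _ (fun zt : Gamma * R => (1 - zt.2) * m zt.1)); last exact: cg.
  apply: cvgM; first by apply: cvgB; [exact: cvg_cst|exact: cvg_snd].
  by apply: continuous_comp; [exact: cvg_fst|exact: cm].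
pose r (zt : Gamma * R) := if `[< A zt.1 >] then zt.1 else slide zt.
have rA z t : A z -> r (z, t) = z by move=> Az; rewrite /r /=; case: asboolP.
have rB z t : B z -> r (z, t) = slide (z, t).
  move=> [s /= hs <-]; rewrite /r /=; case: asboolP => // As.
  have s0 : s = 0.
    apply/eqP; apply: contraPT As => s0; apply: gA.
    by case/andP: hs => h ->; rewrite lt_neqAle eq_sym s0 h.
  by rewrite s0 /slide /= mB ?lexx ?ltW // mulr0.
have cr : {within (A `|` B) `*` [set t : R | 0 <= t <= 1], continuous r}.
  have cI : closed [set t : R | 0 <= t <= 1].
    have -> : [set t : R | 0 <= t <= 1] = `[0, 1]%classic.
      by apply/seteqP; split => s /=; rewrite in_itv.
    exact: itv_closed.
  have -> : (A `|` B) `*` [set t : R | 0 <= t <= 1] =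
     (A `*` [set t : R | 0 <= t <= 1]) `|` (B `*` [set t : R | 0 <= t <= 1]).
    apply/seteqP; split => -[z t] /=; first by move=> [[?|?] ?]; [left|right].
    by move=> [[? ?]|[? ?]]; split => //; [left|right].
  apply: withinU_continuous; try exact: setX_closed.
    by apply: (within_eq (f := fst)) => [[z t] [/= /rA ->]|x] //; exact: cvg_fst.
  by apply: (within_eq (f := slide)) => [[z t] [/= /rB ->]|x].
have rAB z t : (A `|` B) z -> 0 <= t <= 1 -> (A `|` B) (r (z, t)).
  move=> [Az _|Bz /andP[t0 t1]]; first by rewrite rA //; left.
  rewrite rB //; right; case: Bz => s /= hs <-; exists ((1 - t) * s).
    rewrite /= ; case/andP: hs => s0 sl; rewrite mulr_ge0 ?subr_ge0 //=.
    by apply: le_trans sl; rewrite ler_piMl // gerBl.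
  by rewrite /slide /= mB.
have r0 z : (A `|` B) z -> r (z, 0) = z.
  move=> [Az|Bz]; first by rewrite rA.
  by rewrite rB //; case: Bz => s /= hs <-; rewrite /slide /= subr0 mul1r mB.
have r1 z : (A `|` B) z -> A (r (z, 1)).
  move=> [Az|Bz]; first by rewrite rA.
  by rewrite rB // /slide /= subrr mul0r.
exists a; first by left.
pose H' (zt : Gamma * R) := if zt.2 <= 1 / 2 then r (zt.1, 2 * zt.2)
  else H (r (zt.1, 1), 2 * zt.2 - 1).
have H'1 z t : t <= 1 / 2 -> H' (z, t) = r (z, 2 * t) by rewrite /H' /= => ->.
have H'2 z t : (A `|` B) z -> 1 / 2 <= t -> H' (z, t) = H (r (z, 1), 2 * t - 1).
  move=> zAB; rewrite le_eqVlt => /predU1P[<-|ht].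
    have e : 2 * (1 / 2) = 1 :> R by lra.
    by rewrite H'1 // e subrr H0 //; exact: r1.
  by rewrite /H' /= leNgt ht.
exists H'; split.
- have itvE (u v : R) : `[u, v]%classic = [set t : R | u <= t <= v].
    by apply/seteqP; split => s /=; rewrite in_itv.
  have -> : (A `|` B) `*` `[0, 1] =
    ((A `|` B) `*` `[0, 1 / 2]) `|` ((A `|` B) `*` `[1 / 2, 1]) :> set (Gamma * R).
    rewrite !itvE; apply/seteqP; split => -[z t] /=.
      move=> [h /andP[t0 t1]]; have [ht|/ltW ht] := leP t (1 / 2).
        by left; split => //; rewrite t0.
      by right; split => //; rewrite t1 ht.
    by move=> [[? /andP[h1 h2]]|[? /andP[h1 h2]]]; split => //; apply/andP; split => //; lra.
  apply: withinU_continuous.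
  + by apply: setX_closed; [exact: closedU|exact: itv_closed].
  + by apply: setX_closed; [exact: closedU|exact: itv_closed].
  + have : {within (A `|` B) `*` `[0, 1 / 2], continuous (r \o (fun zt : Gamma * R => (zt.1, 2 * zt.2)))}.
      apply: (within_comp (D := (A `|` B) `*` [set t : R | 0 <= t <= 1])) => //.
        apply: continuous_subspaceT => zt.
        have h1 : zt'.1 @[zt' --> zt] --> zt.1 by exact: cvg_fst.
        have h2 : 2 * zt'.2 @[zt' --> zt] --> 2 * zt.2.
          by apply: cvgM; [exact: cvg_cst|exact: cvg_snd].
        exact: cvg_pair h1 h2.
      rewrite itvE => -[z t] [/= ? /andP[t0 t1]]; split => //=.
      by apply/andP; split; lra.
    apply: subspace_eq_continuous => -[z t]; rewrite inE itvE => -[/= _ /andP[_ ht]].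
    exact/esym/H'1.
  + have : {within (A `|` B) `*` `[1 / 2, 1], continuous (H \o (fun zt : Gamma * R => (r (zt.1, 1), 2 * zt.2 - 1)))}.
      pose j (zt : Gamma * R) : Gamma * R := (r (zt.1, 1), 2 * zt.2 - 1).
      have jD zt : ((A `|` B) `*` `[1 / 2, 1]) zt -> (A `*` `[0, 1]) (j zt).
        rewrite !itvE; case: zt => z t [/= ? /andP[t0 t1]]; split => /=; first exact: r1.
        by apply/andP; split; lra.
      suff cj : {within (A `|` B) `*` `[1 / 2, 1], continuous j} by exact: within_comp cj jD cH.
      have cr1 : {within (A `|` B) `*` `[1 / 2, 1], continuous
          (r \o (fun zt : Gamma * R => (zt.1, 1)))}.
        apply: (within_comp (D := (A `|` B) `*` [set t : R | 0 <= t <= 1])) => //.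
          apply: continuous_subspaceT => zt.
          have h1 : zt'.1 @[zt' --> zt] --> zt.1 by exact: cvg_fst.
          have h2 : (1 : R) @[_ --> zt] --> (1 : R) by exact: cvg_cst.
          exact: cvg_pair h1 h2.
        by move=> [z t] [/= ? _]; split => //=; rewrite ler01 lexx.
      have c2 : {within (A `|` B) `*` `[1 / 2, 1], continuous (fun zt : Gamma * R => 2 * zt.2 - 1)}.
        apply: continuous_subspaceT => zt; apply: cvgB; last exact: cvg_cst.
        by apply: cvgM; [exact: cvg_cst|exact: cvg_snd].
      apply/subspace_continuousP => x Sx.
      have h1 := (subspace_continuousP _ _).1 cr1 x Sx.
      have h2 := (subspace_continuousP _ _).1 c2 x Sx.
      exact: cvg_pair h1 h2.
    apply: subspace_eq_continuous => -[z t]; rewrite inE itvE => -[/= zAB /andP[ht _]].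
    exact/esym/H'2.
- move=> z t zAB /andP[t0 t1]; have [ht|ht] := leP t (1 / 2).
    by rewrite H'1 //; apply: rAB => //; apply/andP; split; lra.
  rewrite H'2 ?ltW //; left; apply: HA; first exact: r1.
  by apply/andP; split; lra.
- by move=> z zAB; rewrite H'1 ?mulr0 ?r0 // divr_ge0.
- move=> z zAB; rewrite H'2 //; last by rewrite ler_pdivrMr // mul1r ler1n.
  have -> : 2 * 1 - 1 = 1 :> R by lra.
  by rewrite H1 //; exact: r1.
Unshelve. all: by end_near. Qed.

End TreeContractible.

Section TreeSubset.
Context {R : realType} {Gamma : metricType R} (M : model Gamma).
Local Notation V := (vert M).
Local Notation E := (edge M).

Definition subgraph (W : {set V}) (T : {set E}) : set Gamma :=
  [set x | (exists2 v, v \in W & x = vtx v) \/ (exists2 e, e \in T & closed_arc e x)].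

Lemma arc_in_subgraph (W : {set V}) (T : {set E}) e s : 0 < s < len e ->
  subgraph W T (arc e s) -> e \in T.
Proof.
move=> hs [[v _ sv]|[e' e'T [s' /= hs' ss']]]; first by case: (arc_vtx hs sv).
by rewrite (arc_disjoint_closed hs hs' (esym ss')).
Qed.

Lemma subgraph_vtx r (W : {set V}) (T : {set E}) v :
  tree (@src _ _ M) (@tgt _ _ M) r W T -> subgraph W T (vtx v) -> v \in W.
Proof.
move=> tWT [[w wW /vtx_inj ->] //|[e eT [s /= /andP[s0 sl] sv]]].
have [sW tW] := tree_edge tWT eT.
have [s00|s00] := eqVneq s 0.
  by move: sv; rewrite s00 arc_src => /vtx_inj <-.
have [sll|sll] := eqVneq s (len e).
  by move: sv; rewrite sll arc_tgt => /vtx_inj <-.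
case: (@arc_vtx _ _ M e s v) => //.
by rewrite lt_neqAle eq_sym s00 s0 lt_neqAle sll sl.
Qed.

Lemma tree_contractible r (W : {set V}) (T : {set E}) :
  tree (@src _ _ M) (@tgt _ _ M) r W T ->
  contractible (R := R) (subgraph W T) /\ closed (subgraph W T).
Proof.
elim=> [|{}W {}T e u v tWT [cX clX] uW vW euv].
  have -> : subgraph [set r]%SET finset.set0 = [set vtx r].
    apply/seteqP; split => [x [[v]|[e]]|x /= ->].
    - by rewrite finset.in_set1 => /eqP -> ->.
    - by rewrite finset.in_set0.
    - by left; exists r => //; rewrite finset.in_set1.
  split; last by apply: accessible_closed_set1; apply: hausdorff_accessible;
    exact: metric_hausdorff.
  exists (vtx r) => //; exists (fun zt => vtx r); split => //.
  by apply: continuous_subspaceT => z; exact: cvg_cst.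
have eT : e \notin T.
  apply: contra vW => eT; have [] := tree_edge tWT eT.
  by case/orP: euv => /andP[/eqP -> /eqP ->].
(* [g] runs through the arc from the old vertex [u] to the leaf [v], reversing it if necessary. *)
have [g [cg ig gu gv gE]] : exists g : R -> Gamma, [/\ continuous g,
    forall s t, 0 <= s <= len e -> 0 <= t <= len e -> mdist (g s) (g t) = `|s - t|,
    g 0 = vtx u, g (len e) = vtx v &
    forall s, 0 <= s <= len e -> exists2 s', 0 <= s' <= len e & g s = arc e s' /\
      arc e s = g s' /\ (0 < s < len e -> 0 < s' < len e)].
  case/orP: euv => /andP[/eqP e1 /eqP e2].
    exists (arc e); split.
    - exact: arc_continuous.
    - by move=> s t; exact: arc_isometry.
    - by rewrite arc_src e1.
    - by rewrite arc_tgt e2.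
    - by move=> s hs; exists s.
  exists (fun s => arc e (len e - s)); split.
  - move=> s; apply: (@continuous_comp _ _ _ (fun s => len e - s)).
      by apply: cvgB; [exact: cvg_cst|exact: cvg_id].
    exact: arc_continuous.
  - move=> s t /andP[s0 sl] /andP[t0 tl]; rewrite arc_isometry.
    + by rewrite distrC; congr `|_|; ring.
    + by apply/andP; split; lra.
    + by apply/andP; split; lra.
  - by rewrite subr0 arc_tgt e2.
  - by rewrite subrr arc_src e1.
  - move=> s /andP[s0 sl]; exists (len e - s); first by apply/andP; split; lra.
    rewrite subKr; split=> //; split => // /andP[h1 h2].
    by apply/andP; split; lra.
have XE : subgraph (v |: W)%SET (e |: T)%SET =
    subgraph W T `|` g @` [set s | 0 <= s <= len e].
  apply/seteqP; split => x.
    move=> [[w]|[e']]; rewrite finset.in_setU1 => /predU1P[->|h].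
    - move=> ->; right; exists (len e) => //=.
      by rewrite lexx ltW // len_gt0.
    - by move=> ->; left; left; exists w.
    - move=> [s /= hs <-]; right; have [s' hs' [_ [-> _]]] := gE s hs.
      by exists s'.
    - by move=> h'; left; right; exists e'.
  move=> [[[w wW ->]|[e' e'T h]]|[s /= hs <-]].
  - by left; exists w => //; rewrite finset.in_setU1 wW orbT.
  - by right; exists e' => //; rewrite finset.in_setU1 e'T orbT.
  - right; exists e; first by rewrite finset.in_setU1 eqxx.
    by have [s' hs' [-> _]] := gE s hs; exists s'.
rewrite XE; split; last first.
  apply: closedU => //; apply: compact_closed; first exact: metric_hausdorff.
  have -> : [set s | 0 <= s <= len e] = `[0, len e]%classic.
    by apply/seteqP; split => s /=; rewrite in_itv.
  apply: continuous_compact; last exact: segment_compact.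
  exact: continuous_subspaceT.
apply: contractible_attach => //; first exact: len_gt0.
  by rewrite gu; left; exists u.
move=> s /andP[s0 sl] Xs; have [sE|sE] := eqVneq s (len e).
  by move: Xs; rewrite sE gv => /(subgraph_vtx tWT); exact/negP.
have hs : 0 < s < len e by rewrite s0 lt_neqAle sE sl.
have [|s' _ [gs [_ /(_ hs) hs']]] := gE s; first by rewrite ltW.
by move: Xs; rewrite gs => /(arc_in_subgraph hs'); exact/negP.
Qed.

Lemma subgraph_cotree (T : {set E}) :
  subgraph [set: V]%SET T = ~` \bigcup_(e in [set e | e \notin T]) open_arc e.
Proof.
apply/seteqP; split => x.
  move=> Xx [e /= eT [s /= hs sx]]; move: Xx; rewrite -sx.
  by move/(arc_in_subgraph hs); exact/negP.
move=> nx; have [[v ->]|[e [s [hs xE]]]] := model_cover M x.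
  by left; exists v => //; rewrite finset.in_setT.
have [eT|eT] := boolP (e \in T).
  right; exists e => //; exists s => //=.
  by case/andP: hs => /ltW -> /ltW ->.
by case: nx; exists e => //; exists s.
Qed.

End TreeSubset.

(** * Slopes, principal divisors and chip firing *)

Section Slopes.
Context {R : realType} {Gamma : metricType R}.
Implicit Types (phi psi : Gamma -> R) (p x : Gamma) (D : {freeg Gamma / int}).

Definition slope_chart phi p n r (f : 'I_n * R -> Gamma) (a : 'I_n -> int) :=
  star_chart p r f /\
  forall k t, 0 <= t < r -> phi (f (k, t)) = phi p + (a k)%:~R * t.

(** Two charts at [p] differ near [p] by a permutation of the rays, so the sum of slopes does not
    depend on the chart. *)
Lemma slope_transfer phi p n n' r r' (f : 'I_n * R -> Gamma)
    (f' : 'I_n' * R -> Gamma) (a : 'I_n -> int) :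
  slope_chart phi p r f a -> star_chart p r' f' ->
  n = n' /\ exists2 rho, 0 < rho <= r' & exists2 a' : 'I_n' -> int,
    slope_chart phi p rho f' a' & \sum_k a' k = \sum_k a k.
Proof.
move=> [fC fa] f'C; have [r0 _ _ _] := fC.
have [nn' [rho /andP[rho0 rhor] [s sb sE]]] := chart_compare_bij fC f'C.
split=> //; have hm : 0 < Num.min rho r <= r'.
  by rewrite lt_min rho0 r0 ge_min rhor.
exists (Num.min rho r) => //; exists (fun k => a (s k)); last first.
  by rewrite [RHS](reindex s) //; exact: onW_bij.
split; first exact: star_chart_shrink hm.
move=> k t; rewrite lt_min => /and3P[t0 t1 t2].
by rewrite sE ?t0 // fa ?t0.
Qed.

Lemma incoming_slope_sumD phi psi p m m' :
  has_incoming_slope_sum phi p m -> has_incoming_slope_sum psi p m' ->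
  has_incoming_slope_sum (fun x => phi x + psi x) p (m + m').
Proof.
move=> [n [r [f [a [fC fa ->]]]]] [n' [r' [f' [a' [f'C f'a ->]]]]].
have [_ [rho hrho [b [f'C' f'b] <-]]] := slope_transfer (conj fC fa) f'C.
have /andP[rho0 rhor] := hrho.
exists n', rho, f', (fun k => b k + a' k); split => //.
  move=> k t ht; rewrite f'b // f'a; first by rewrite rmorphD /=; ring.
  by case/andP: ht => -> /= h; exact: lt_le_trans rhor.
by rewrite big_split opprD.
Qed.

Lemma incoming_slope_continuous phi :
  (forall p, exists m, has_incoming_slope_sum phi p m) -> continuous phi.
Proof.
move=> h p; have [m [n [r [f [a [fC fa _]]]]]] := h p.
have [r1 /andP[r10 r1r] [fC1 fy]] := star_chart_exact fC.
pose K : R := 1 + \sum_k `|(a k)%:~R|.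
have K0 : 0 < K by rewrite /K ltr_pwDl // sumr_ge0.
have aK k : `|(a k)%:~R : R| <= K.
  by rewrite /K (bigD1 k) //= addrCA lerDl addr_ge0 // sumr_ge0.
apply/cvgrPdist_lt => e e0; apply/nbhs_ballP.
exists (Num.min r1 (e / K)); first by rewrite /= lt_min r10 divr_gt0.
move=> y; rewrite ballEmdist /= lt_min => /andP[yr ye].
have [|->|[k [t [ht yE]]]] := fy y => //; first by rewrite subrr normr0.
have ht' : 0 <= t < r by case/andP: ht => -> h1; exact: lt_le_trans r1r.
rewrite yE fa // opprD addrA subrr sub0r normrN normrM.
move: ye; rewrite yE (chart_center k fC) // ltr_pdivlMr // mulrC.
case/andP: ht => t0 _; rewrite [`|t|]ger0_norm //.
by apply: le_lt_trans; rewrite ler_wpM2r.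
Qed.

Lemma is_divD phi psi D D' : is_div phi D -> is_div psi D' ->
  is_div (fun x => phi x + psi x) (D + D').
Proof. by move=> h h' p; rewrite coeffD; exact: incoming_slope_sumD. Qed.

(** Piecewise affinity is automatic: off the branch points and the support of the divisor there are
    two rays, whose outgoing slopes add up to 0. *)
Lemma is_div_lin_equiv phi D1 D2 :
  finite_set (branch_points (Gamma := Gamma)) ->
  is_div phi (D1 - D2) -> lin_equiv D1 D2.
Proof.
move=> fin hphi; exists phi => //; split.
  by apply: incoming_slope_continuous => p; exists (coeff p (D1 - D2)).
exists (branch_points `|` [set` dom (D1 - D2)]); split.
- by rewrite finite_setU; split => //; exact: finite_seq.
- by move=> x; left.
move=> x xS; have [n [r [f [a [fC fa s]]]]] := hphi x.
have n2 : n = 2%N.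
  by apply: contrapT => n2; apply: xS; left; exists n => //; exists r, f.
subst n; exists r, f, (a ord0); split => // t ht; rewrite !fa //; split => //.
have : coeff x (D1 - D2) = 0.
  by apply: coeff_outdom; apply/negP => xd; apply: xS; right.
rewrite s big_ord_recl big_ord1 => /eqP; rewrite oppr_eq0 addr_eq0 => /eqP ->.
have -> : fintype.lift ord0 ord0 = ord_max :> 'I_2 by exact/val_inj.
by rewrite rmorphN mulNr opprK.
Qed.

End Slopes.

(** * Directions at a point, read off from the arcs *)

Section Germs.
Context {R : realType} {Gamma : metricType R} (M : model Gamma).
Hypothesis valencyP : forall p : Gamma, exists n, has_valency p n.
Local Notation V := (vert M).
Local Notation E := (edge M).
Implicit Types (p x y : Gamma) (e : E) (s t : R) (b : bool).

Definition dir b : R := if b then 1 else -1.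

Definition arc_pos p e : R := xget 0 [set s | 0 <= s <= len e /\ arc e s = p].

(** The directions at [p]: [true] stands for increasing and [false] for decreasing parameter on the
    arc. Membership in the closed arc guards against the default value of [arc_pos]. *)
Definition germs p : {set E * bool} :=
  [set eb : E * bool | `[< closed_arc eb.1 p /\
     if eb.2 then arc_pos p eb.1 < len eb.1 else 0 < arc_pos p eb.1 >]]%SET.

Lemma arc_posK e s : 0 <= s <= len e -> arc_pos (arc e s) e = s.
Proof.
move=> hs; rewrite /arc_pos; case: xgetP => [s' _ [hs' /arc_inj ->] //|/(_ s)].
by case; split.
Qed.

Lemma mem_germs e s b : 0 <= s <= len e ->
  ((e, b) \in germs (arc e s)) = (if b then s < len e else 0 < s).
Proof.
move=> hs; rewrite finset.in_set /= arc_posK //; apply/asboolP/idP.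
  by case: b => -[].
by move=> h; split; [exists s|case: b h].
Qed.

Lemma germs_out e b p : ~ closed_arc e p -> (e, b) \notin germs p.
Proof. by move=> pe; rewrite finset.in_set; apply/negP => /asboolP[]. Qed.

Definition germ p (u : 'I_#|germs p| * R) : Gamma :=
  let: (e, b) := enum_val u.1 in arc e (arc_pos p e + dir b * u.2).

Lemma germ_room p : exists2 rho : R, 0 < rho & forall e b t,
  (e, b) \in germs p -> 0 < t < rho ->
  0 < arc_pos p e + dir b * t < len e.
Proof.
have H : \forall rho \near (0 : R)^'+, forall eb : E * bool, eb \in germs p ->
    forall t, 0 < t < rho -> 0 < arc_pos p eb.1 + dir eb.2 * t < len eb.1.
  apply: filter_forall => -[e b].
  have [eb|_] := boolP ((e, b) \in germs p); last exact: nearW.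
  move: (eb); rewrite finset.in_set /= => /asboolP[[s /= /andP[s0 sl] sp]].
  have hs : arc_pos p e = s by rewrite -sp arc_posK ?s0.
  rewrite hs => h.
  pose w := if b then len e - s else s.
  have w0 : 0 < w by rewrite /w; case: (b) h => h; rewrite ?subr_gt0.
  near=> rho => _ t /andP[t0 tr].
  have : rho < w by near: rho; exact: nbhs_right_lt.
  by rewrite /w /dir; case: (b) => hr; apply/andP; split; lra.
have [rho [h rho0]] := filter_ex (filterI H (nbhs_right_gt (0 : R))).
by exists rho => // e b t eb; exact: (h (e, b)).
Unshelve. all: by end_near. Qed.

(** Each germ is geodesic, so it follows a ray of a given chart [f]; distinct germs follow distinct
    rays, and the distances are those measured in [f]. *)
Lemma germ_chart p : exists rho, star_chart p rho (@germ p).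
Proof.
have [n [r [f /star_chart_exact[r1 _ fE]]]] := valencyP p.
have [fC fy] := fE; have [r10 fp fd _] := fC.
have [r2 r20 hr2] := germ_room p; have [r3 r30 hr3] := near_arcs M p.
pose rho := Num.min r1 (Num.min r2 r3).
have rho0 : 0 < rho by rewrite !lt_min r10 r20.
have germP e b : (e, b) \in germs p -> 0 <= arc_pos p e <= len e /\
    arc e (arc_pos p e) = p.
  rewrite finset.in_set => /asboolP[[s /= hs sp] _].
  by rewrite -sp arc_posK.
have dirt b t : `|dir b * t| = `|t|.
  by rewrite /dir; case: b; rewrite ?mul1r // mulN1r normrN.
have room e b t : (e, b) \in germs p -> 0 <= t < rho ->
    0 <= arc_pos p e + dir b * t <= len e.
  move=> eb /andP[]; rewrite le_eqVlt => /predU1P[<- _|t0].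
    by rewrite mulr0 addr0; have [] := germP e b eb.
  rewrite !lt_min => /and3P[_ t2 _].
  by have /andP[/ltW -> /ltW ->] := hr2 e b t eb (ltac:(by rewrite t0)).
have dist e b t t' : (e, b) \in germs p -> 0 <= t < rho -> 0 <= t' < rho ->
    mdist (arc e (arc_pos p e + dir b * t)) (arc e (arc_pos p e + dir b * t')) = `|t - t'|.
  move=> eb ht ht'; rewrite arc_isometry ?(room _ b) //.
  by rewrite opprD addrACA subrr add0r -mulrBr dirt.
have dist0 e b t : (e, b) \in germs p -> 0 <= t < rho ->
    mdist p (arc e (arc_pos p e + dir b * t)) = t.
  move=> eb ht; have := dist e b 0 t eb _ ht.
  rewrite mulr0 addr0 lexx rho0 (proj2 (germP e b eb)) => -> //.
  by rewrite sub0r normrN ger0_norm //; case/andP: ht.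
have ray e b t : (e, b) \in germs p -> 0 <= t < rho -> 0 < t ->
    exists k, forall l, 0 <= l <= 1 -> arc e (arc_pos p e + dir b * (l * t)) = f (k, l * t).
  move=> eb ht t00; have /andP[t0 tr] := ht.
  have tr1 : t < r1 by move: tr; rewrite lt_min => /andP[].
  have [|yp|[k [t' [ht' yE]]]] := fy (arc e (arc_pos p e + dir b * t)).
  - by rewrite dist0.
  - by move: t00; rewrite -(dist0 e b t eb ht) yp mdistxx ltxx.
  have t't : t' = t by rewrite -(chart_center k fC ht') -yE dist0.
  exists k => l hl; have hlt : 0 <= l * t < rho.
    case/andP: hl => l0 l1; rewrite mulr_ge0 //=; apply: le_lt_trans tr.
    by rewrite ler_piMl.
  have ht1 : 0 <= t < r1 by rewrite t0.
  apply: (chart_ray fE ht1 hl); rewrite ?dist0 // -t't -yE t't dist //.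
  have -> : l * t - t = - ((1 - l) * t) by ring.
  by rewrite normrN ger0_norm // mulr_ge0 // subr_ge0; case/andP: hl.
exists rho; split => //.
- move=> k; rewrite /germ /=; case E1 : (enum_val k) => [e b].
  rewrite mulr0 addr0; apply: (proj2 (germP e b _)).
  by rewrite -E1 enum_valP.
- move=> [k t] [k' t']; rewrite /star /= => ht ht'.
  rewrite /germ /star_dist /=.
  case E1 : (enum_val k) => [e b]; case E2 : (enum_val k') => [e' b'].
  have eb : (e, b) \in germs p by rewrite -E1 enum_valP.
  have eb' : (e', b') \in germs p by rewrite -E2 enum_valP.
  case: eqP => [kk|kk].
    by move: E1; rewrite kk E2 => -[-> ->]; rewrite dist.
  have [t0|t0] := eqVneq t 0.
    rewrite t0 mulr0 addr0 (proj2 (germP e b eb)) add0r dist0 //.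
  have [t'0|t'0] := eqVneq t' 0.
    by rewrite t'0 mulr0 addr0 (proj2 (germP e' b' eb')) addr0 metric_sym dist0.
  have tp : 0 < t by rewrite lt_neqAle eq_sym t0; case/andP: ht.
  have tp' : 0 < t' by rewrite lt_neqAle eq_sym t'0; case/andP: ht'.
  have [j hj] := ray e b t eb ht tp; have [j' hj'] := ray e' b' t' eb' ht' tp'.
  have one : 0 <= (1 : R) <= 1 by rewrite ler01 lexx.
  have := hj 1 one; have := hj' 1 one; rewrite !mul1r => -> ->.
  have [tr1 tr1'] : t < r1 /\ t' < r1.
    by split; [case/andP: ht|case/andP: ht'] => _; rewrite lt_min => /andP[].
  rewrite fd /star /= ?tr1 ?tr1' ?(ltW tp) ?(ltW tp') // /star_dist /=.
  (* Two germs on one ray would share the point at distance [u], which is interior to both arcs;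
     then the arcs agree, and so do the directions. *)
  case: eqP => // jj; exfalso; apply: kk; apply: enum_val_inj; rewrite E1 E2.
  pose u := Num.min t t'.
  have u0 : 0 < u by rewrite lt_min tp.
  have ut : u <= t by rewrite ge_min lexx.
  have ut' : u <= t' by rewrite ge_min lexx orbT.
  have q1 : 0 <= u / t <= 1 by rewrite divr_ge0 ?(ltW u0) ?(ltW tp) //= ler_pdivrMr // mul1r.
  have q2 : 0 <= u / t' <= 1 by rewrite divr_ge0 ?(ltW u0) ?(ltW tp') //= ler_pdivrMr // mul1r.
  have := hj _ q1; have := hj' _ q2; rewrite !divfK // jj => <- same.
  have hu : 0 < u < r2.
    rewrite u0 /=; apply: le_lt_trans ut _; case/andP: ht => _.
    by rewrite !lt_min => /and3P[].
  have o1 := hr2 e b u eb hu; have o2 := hr2 e' b' u eb' hu.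
  have ee := arc_disjoint o1 o2 same.
  move: same; rewrite -ee => /arc_inj; rewrite -ee in o2.
  case/andP: o1 => /ltW -> /ltW ->; case/andP: o2 => /ltW -> /ltW -> /(_ isT isT).
  by move/addrI; rewrite /dir; case: (b); case: (b') => // h; exfalso; lra.
- apply/nbhs_ballP; exists rho => // y; rewrite ballEmdist /= => yr.
  have y3 : mdist p y < r3 by move: yr; rewrite !lt_min => /and3P[].
  have [->|[e [s [s' [hs hs' pe ye]]]]] := hr3 y y3; first by left.
  have [ss|ss] := eqVneq s s'; first by left; rewrite ye -ss -pe.
  right; pose b := s < s'.
  have ps : arc_pos p e = s by rewrite pe arc_posK.
  have eb : (e, b) \in germs p.
    rewrite pe mem_germs // /b; case: ltgtP ss => // h _.
      by apply: lt_le_trans h _; case/andP: hs'.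
    by apply: le_lt_trans h; case/andP: hs'.
  have yd : mdist p y = `|s - s'| by rewrite pe ye arc_isometry.
  exists (enum_rank_in eb (e, b), `|s - s'|); first by rewrite /star /= normr_ge0 -yd.
  rewrite /germ /= enum_rankK_in // ps ye; congr arc.
  rewrite /b /dir; case: ltgtP ss => // h _.
    by rewrite ltr0_norm ?subr_lt0 //; ring.
  by rewrite gtr0_norm ?subr_gt0 //; ring.
Qed.

Lemma incoming_slope_germs (phi : Gamma -> R) p (a : E * bool -> int) :
  (forall e b, (e, b) \in germs p -> exists2 rho : R, 0 < rho & forall t,
     0 <= t < rho -> phi (arc e (arc_pos p e + dir b * t)) = phi p + (a (e, b))%:~R * t) ->
  has_incoming_slope_sum phi p (- \sum_(eb in germs p) a eb).
Proof.
move=> h; have [r gC] := germ_chart p; have [r0 _ _ _] := gC.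
have H : \forall rho \near (0 : R)^'+, forall eb : E * bool, eb \in germs p ->
    forall t, 0 <= t < rho ->
    phi (arc eb.1 (arc_pos p eb.1 + dir eb.2 * t)) = phi p + (a eb)%:~R * t.
  apply: filter_forall => -[e b].
  have [eb|_] := boolP ((e, b) \in germs p); last exact: nearW.
  have [rho1 rho10 hr] := h e b eb.
  near=> rho => _ t /andP[t0 tr].
  have rr : rho < rho1 by near: rho; exact: nbhs_right_lt.
  by apply: hr; rewrite t0 (lt_trans tr).
have [rho [[h' rho0] rhor]] := filter_ex (filterI (filterI H (nbhs_right_gt (0 : R)))
  (nbhs_right_lt r0)).
exists #|germs p|, rho, (@germ p), (fun k => a (enum_val k)); split.
- by apply: star_chart_shrink gC _; rewrite rho0 ltW.
- move=> k t ht; rewrite /germ /=; case E1 : (enum_val k) => [e b].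
  by rewrite -(h' (e, b)) // -E1 enum_valP.
- by rewrite big_enum_val.
Unshelve. all: by end_near. Qed.

Lemma germs_incoming_slope (phi : Gamma -> R) p m :
  has_incoming_slope_sum phi p m -> exists a : E * bool -> int,
  m = - \sum_(eb in germs p) a eb /\ exists2 rho : R, 0 < rho &
  forall e b, (e, b) \in germs p -> forall t, 0 <= t < rho ->
    phi (arc e (arc_pos p e + dir b * t)) = phi p + (a (e, b))%:~R * t.
Proof.
move=> [n [r [f [a [fC fa ->]]]]]; have [r' gC] := germ_chart p.
have [_ [rho /andP[rho0 _] [a' [_ ga'] <-]]] := slope_transfer (conj fC fa) gC.
(* Slopes indexed by the rays become a function of pairs, with value 0 on pairs that are not
   germs. *)
pose a2 (eb : E * bool) := oapp a' 0 [pick k | enum_val k == eb].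
have a2E k : a2 (enum_val k) = a' k.
  rewrite /a2; case: pickP => [k' /eqP /enum_val_inj -> //|/(_ k)].
  by rewrite eqxx.
exists a2; split.
  by rewrite [in RHS]big_enum_val /=; apply: congr1; apply: eq_bigr => k _; rewrite a2E.
exists rho => // e b eb t ht.
have := ga' (enum_rank_in eb (e, b)) t ht.
by rewrite -a2E /germ /= enum_rankK_in.
Qed.

Lemma germs_interior e s : 0 < s < len e ->
  germs (arc e s) = [set (e, true); (e, false)]%SET.
Proof.
move=> hs; have hs' : 0 <= s <= len e by case/andP: hs => /ltW -> /ltW ->.
apply/setP => -[e' b]; rewrite !finset.inE.
have [<-|ne] := eqVneq e e'.
  have := mem_germs b hs'; rewrite finset.in_set => ->; case/andP: hs => h1 h2.
  by rewrite !xpair_eqE eqxx; case: b; rewrite ?h1 ?h2.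
have : (e', b) \notin germs (arc e s).
  apply: germs_out => -[t ht ts]; move/eqP: ne; apply.
  exact: arc_disjoint_closed hs ht (esym ts).
rewrite finset.in_set => /negbTE ->.
by rewrite !xpair_eqE eq_sym (negbTE ne).
Qed.

Lemma interior_valency e s : 0 < s < len e -> has_valency (arc e s) 2.
Proof.
move=> hs; have [r gC] := germ_chart (arc e s).
suff <- : #|germs (arc e s)| = 2%N by exists r, (@germ (arc e s)).
by rewrite germs_interior // cards2 xpair_eqE eqxx.
Qed.

Lemma branch_points_vtx x : branch_points x -> exists v : V, x = vtx v.
Proof.
move=> [n xn n2]; have [//|[e [s [hs xE]]]] := model_cover M x.
by case: n2; apply: valency_unique xn _; rewrite xE; exact: interior_valency.
Qed.

Lemma branch_points_finite : finite_set (branch_points (Gamma := Gamma)).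
Proof.
apply: (@sub_finite_set _ _ (vtx (m := M) @` [set: V])).
  by move=> x /branch_points_vtx[v ->]; exists v.
by apply: finite_image; exact: finite_finset.
Qed.

Lemma open_arc_segment e : open_edge_segment (open_arc e).
Proof.
have l0 := len_gt0 e.
pose m : R := len e / 2.
have m0 : 0 < m < len e by rewrite divr_gt0 //= ltr_pdivrMr // ltr_pMr // ltr1n.
have notbr : open_arc e `<=` ~` branch_points (Gamma := Gamma).
  by move=> x [s hs <-] /branch_points_vtx[v]; exact: arc_vtx.
have conn : connected (open_arc e).
  rewrite /open_arc; have -> : [set s | 0 < s < len e] = `]0, (len e)[%classic.
    by apply/seteqP; split => s /=; rewrite in_itv.
  apply: connected_continuous_connected.
    by apply/connected_intervalP => u v; rewrite /= !in_itv /= => /andP[u0 _] /andP[_ v1] w /andP[uw wv]; rewrite in_itv /= (lt_le_trans u0 uw) (le_lt_trans wv v1).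
  by apply: continuous_subspaceT; exact: arc_continuous.
have am : open_arc e (arc e m) by exists m.
split => //; first by exists (arc e m).
  exact: open_arc_open.
exists (connected_component (~` branch_points (Gamma := Gamma)) (arc e m)).
  by exists (arc e m) => //; exact: notbr.
exact: connected_component_max.
Qed.

Lemma closure_open_arc e s : 0 <= s <= len e -> closure (open_arc e) (arc e s).
Proof.
move=> hs; have l0 := len_gt0 e; move: (hs) => /andP[s0 sl] U.
move=> /(arc_continuous (e := e)) /nbhs_ballP[rho /= rho0 hrho].
have [d [d0 d1 d2]] : exists d : R, [/\ 0 < d, d <= rho / 2 & d <= len e / 4].
  exists (Num.min (rho / 2) (len e / 4)).
  by rewrite lt_min !divr_gt0 // !ge_min !lexx orbT.
pose s' := if s < len e / 2 then s + d else s - d.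
have hs' : 0 < s' < len e.
  by rewrite /s'; have [h|h] := ltP s (len e / 2); apply/andP; split; lra.
exists (arc e s'); split; first by exists s'.
apply: hrho; rewrite /ball /= /s'.
by have [h|h] := ltP s (len e / 2); rewrite ltr_norml; apply/andP; split; lra.
Qed.

End Germs.

(** * Moving all chips of a cut at unit speed *)

Section Firing.
Context {R : realType} {Gamma : metricType R} (M : model Gamma).
Hypothesis valencyP : forall p : Gamma, exists n, has_valency p n.
Local Notation V := (vert M).
Local Notation E := (edge M).
Local Notation crossing := (crossing (@src _ _ M) (@tgt _ _ M)).
Implicit Types (p x y : Gamma) (e : E) (s t : R) (b : bool) (B : {set V}).

Definition fire_pos B (pos : E -> R) (eps : R) (e : E) : R :=
  if tgt e \in B then pos e + eps else pos e - eps.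

(* The potential is 0 off B, eps on B, and rises with slope 1 between the old
   and the new position of the chip on each edge of the cut. *)
Definition fire_profile B (pos : E -> R) (eps : R) (e : E) (s : R) : R :=
  if src e \in B
  then (if tgt e \in B then eps else Num.max 0 (Num.min (pos e - s) eps))
  else (if tgt e \in B then Num.max 0 (Num.min (s - pos e) eps) else 0).

(** The slope of [fire_profile] as seen from [s] in the given direction; the intervals are half-open
    because at a break point the two directions see different slopes. *)
Definition fire_slope B (pos : E -> R) (eps : R) (eb : E * bool) (s : R) : int :=
  let: (e, b) := eb in
  if crossing B e then
    if tgt e \in B then
      (if b then (pos e <= s < pos e + eps)%R%:R else - (pos e < s <= pos e + eps)%R%:R)
    else
      (if b then - (pos e - eps <= s < pos e)%R%:R else (pos e - eps < s <= pos e)%R%:R)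
  else 0.

Lemma clamp_slope_right (s c eps : R) : 0 <= eps ->
  exists2 rho : R, 0 < rho & forall t, 0 <= t < rho ->
  Num.max 0 (Num.min (s + t - c) eps) =
  Num.max 0 (Num.min (s - c) eps) + (c <= s < c + eps)%R%:R * t.
Proof.
move=> e0; have [sc|sc] := ltP s c.
  exists (c - s); first by rewrite subr_gt0.
  move=> t /andP[t0 tr]; rewrite /= mul0r addr0.
  by rewrite !max_l // ge_min; apply/orP; left; lra.
have [se|se] /= := ltP s (c + eps).
  exists (c + eps - s); first by rewrite subr_gt0.
  move=> t /andP[t0 tr]; rewrite mul1r !min_l; [|lra..].
  by rewrite !max_r; [ring|lra..].
exists 1 => // t /andP[t0 tr]; rewrite mul0r addr0.
by rewrite !min_r //; lra.
Qed.

Lemma clamp_slope_left (s c eps : R) : 0 <= eps ->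
  exists2 rho : R, 0 < rho & forall t, 0 <= t < rho ->
  Num.max 0 (Num.min (s - t - c) eps) =
  Num.max 0 (Num.min (s - c) eps) - (c < s <= c + eps)%R%:R * t.
Proof.
move=> e0; have [sc|sc] := leP s c.
  exists 1 => // t /andP[t0 tr]; rewrite /= mul0r subr0.
  by rewrite !max_l // ge_min; apply/orP; left; lra.
have [se|se] /= := leP s (c + eps).
  exists (s - c); first by rewrite subr_gt0.
  move=> t /andP[t0 tr]; rewrite mul1r !min_l; [|lra..].
  by rewrite !max_r; [ring|lra..].
exists (s - (c + eps)); first by rewrite subr_gt0.
move=> t /andP[t0 tr]; rewrite mul0r subr0.
by rewrite !min_r //; lra.
Qed.

(** [lo] and [hi] bound a ramp of slope 1, and the tests on [s] tell which directions exist. A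
    direction missing at an end would see slope 0 anyway, because the ramp lies in [0, l]. *)
Lemma jump_sum (s lo hi l : R) : [&& 0 <= lo, lo <= hi & hi <= l] ->
  ((if 0 < s then (lo < s <= hi)%R%:R else 0) -
  (if s < l then (lo <= s < hi)%R%:R else 0))%R = ((hi == s)%:R - (lo == s)%:R)%R :> int.
Proof.
move=> /and3P[lo0 lohi hil].
have -> : (if s < l then (lo <= s < hi)%R%:R else 0)%R = (lo <= s < hi)%R%:R%R :> int.
  case: ifP => // /negbT; rewrite -leNgt => ls.
  by case: andP => // -[_ sh]; exfalso; move: (le_lt_trans ls sh); lra.
have -> : (if 0 < s then (lo < s <= hi)%R%:R else 0)%R = (lo < s <= hi)%R%:R%R :> int.
  case: ifP => // /negbT; rewrite -leNgt => ls.
  by case: andP => // -[sh _]; exfalso; lra.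
by case: (ltgtP lo s) => h1; case: (ltgtP s hi) => h2 //; exfalso; lra.
Qed.

Lemma fire_profile_slope B pos eps e b s : 0 <= eps ->
  exists2 rho : R, 0 < rho & forall t, 0 <= t < rho ->
    fire_profile B pos eps e (s + dir b * t) =
    fire_profile B pos eps e s + (fire_slope B pos eps (e, b) s)%:~R * t.
Proof.
move=> e0; rewrite /fire_profile /fire_slope /crossing /dir.
case sB : (src e \in B); case tB : (tgt e \in B) => /=;
  try by exists 1 => // t _; rewrite mul0r addr0.
(* A descending ramp is an ascending one in the variable -u. *)
- have flip (u : R) : Num.max 0 (Num.min (pos e - u) eps) =
      Num.max 0 (Num.min (- u - (- pos e)) eps) by congr Num.max; congr Num.min; ring.
  case: b.
    have [rho rho0 h] := clamp_slope_left (- s) (- pos e) e0.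
    exists rho => // t ht; rewrite !flip mul1r.
    rewrite (_ : - (s + t) = - s - t); last by ring.
    rewrite h // rmorphN /= mulrz_nat mulNr; congr (_ - (nat_of_bool _)%:R * _).
    by apply/andP/andP => -[h1 h2]; split; lra.
  have [rho rho0 h] := clamp_slope_right (- s) (- pos e) e0.
  exists rho => // t ht; rewrite !flip mulN1r.
  rewrite (_ : - (s - t) = - s + t); last by ring.
  rewrite h // mulrz_nat; congr (_ + (nat_of_bool _)%:R * _).
  by apply/andP/andP => -[h1 h2]; split; lra.
- case: b.
    have [rho rho0 h] := clamp_slope_right s (pos e) e0.
    by exists rho => // t ht; rewrite mul1r h // mulrz_nat.
  have [rho rho0 h] := clamp_slope_left s (pos e) e0.
  exists rho => // t ht; rewrite mulN1r h //.
  by rewrite rmorphN /= mulrz_nat mulNr.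
Qed.

(** Since the chips are on their closed arcs before and after, every ramp is complete and the
    profiles agree at the vertices. The divisor of a ramp is its top minus its bottom, that is, the
    new position minus the old one. *)
Lemma fire_lin_equiv B (pos : E -> R) (eps : R) : 0 <= eps ->
  (forall e, crossing B e -> 0 <= pos e <= len e /\
     0 <= fire_pos B pos eps e <= len e) ->
  exists phi : Gamma -> R, is_div phi
   (\sum_(e | crossing B e) << arc e (fire_pos B pos eps e) >> -
    \sum_(e | crossing B e) << arc e (pos e) >>).
Proof.
move=> e0 hpos.
pose pr := fire_profile B pos eps.
have pr0 e : pr e 0 = if src e \in B then eps else 0.
  rewrite /pr /fire_profile; have := hpos e.
  rewrite /crossing /fire_pos; case: (src e \in B); case: (tgt e \in B) => //= h.
    have [/andP[h1 h2] /andP[h3 h4]] := h isT.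
    by rewrite subr0 min_r ?max_r //; lra.
  have [/andP[h1 h2] /andP[h3 h4]] := h isT.
  by rewrite max_l // ge_min; apply/orP; left; lra.
have prl e : pr e (len e) = if tgt e \in B then eps else 0.
  rewrite /pr /fire_profile; have := hpos e.
  rewrite /crossing /fire_pos; case: (src e \in B); case: (tgt e \in B) => //= h.
    have [/andP[h1 h2] /andP[h3 h4]] := h isT.
    by rewrite max_l // ge_min; apply/orP; left; lra.
  have [/andP[h1 h2] /andP[h3 h4]] := h isT.
  by rewrite min_r ?max_r //; lra.
have ex x : exists y : R, (exists2 v, x = vtx v & y = if v \in B then eps else 0)
    \/ (exists e s, [/\ 0 < s < len e, x = arc e s & y = pr e s]).
  have [[v ->]|[e [s [hs ->]]]] := model_cover M x.
    by exists (if v \in B then eps else 0); left; exists v.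
  by exists (pr e s); right; exists e, s.
have [phi hphi] := choice ex.
have phiv v : phi (vtx v) = if v \in B then eps else 0.
  have [[w /vtx_inj -> //]|[e [s [hs vs _]]]] := hphi (vtx v).
  by case: (arc_vtx hs (esym vs)).
have phia e s : 0 <= s <= len e -> phi (arc e s) = pr e s.
  move=> /andP[]; rewrite le_eqVlt => /predU1P[<- _|s0].
    by rewrite arc_src phiv pr0.
  rewrite le_eqVlt => /predU1P[->|sl]; first by rewrite arc_tgt phiv prl.
  have hs : 0 < s < len e by rewrite s0.
  have [[v vs _]|[e' [s' [hs' ss ->]]]] := hphi (arc e s).
    by case: (arc_vtx hs vs).
  have ee := arc_disjoint hs hs' ss; rewrite -ee in hs' ss *.
  rewrite (arc_inj _ _ ss) //; first by rewrite !ltW.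
  by case/andP: hs' => /ltW -> /ltW ->.
exists phi => p.
pose a (eb : E * bool) := fire_slope B pos eps eb (arc_pos p eb.1).
suff -> : coeff p (\sum_(e | crossing B e) << arc e (fire_pos B pos eps e) >> -
    \sum_(e | crossing B e) << arc e (pos e) >>) = - \sum_(eb in germs M p) a eb.
  apply: incoming_slope_germs => // e b eb.
  have [rho1 rho10 hr1] := fire_profile_slope B pos e b (arc_pos p e) e0.
  have [rho2 rho20 hr2] := germ_room M p.
  exists (Num.min rho1 rho2); first by rewrite lt_min rho10.
  move=> t; rewrite lt_min => /and3P[t0 t1 t2].
  have [s hs sp] : closed_arc e p.
    by move: eb; rewrite finset.in_set => /asboolP[].
  have ps : arc_pos p e = s by rewrite -sp arc_posK.
  have -> : phi p = pr e (arc_pos p e) by rewrite ps -phia ?sp.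
  rewrite -hr1 ?t0 // phia //.
  have [->|t00] := eqVneq t 0; first by rewrite mulr0 addr0 ps.
  have := hr2 e b t eb; rewrite t2 lt_neqAle eq_sym t00 t0 => /(_ isT).
  by case/andP => /ltW -> /ltW ->.
rewrite coeffB !raddf_sum -big_split /=.
(* Slopes are summed arc by arc, so that vertices and interior points are treated alike. *)
transitivity (\sum_e \sum_(b | (e, b) \in germs M p) - a (e, b)); last first.
  by rewrite pair_big_dep; apply: eq_big => -[e b].
rewrite [LHS]big_mkcond; apply: eq_bigr => e _.
have [[s hs sp]|pe] := pselect (closed_arc e p); last first.
  rewrite [RHS]big1; last by move=> b; rewrite (negbTE (germs_out b pe)).
  case: ifP => // ce; have [h1 h2] := hpos e ce.
  rewrite !coeffU !mul1r.
  have -> : (arc e (fire_pos B pos eps e) == p) = false.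
    by apply/eqP => h; apply: pe; exists (fire_pos B pos eps e).
  have -> : (arc e (pos e) == p) = false.
    by apply/eqP => h; apply: pe; exists (pos e).
  by rewrite subrr.
have ps : arc_pos p e = s by rewrite -sp arc_posK.
rewrite [RHS]big_mkcond big_bool /= -sp !mem_germs // /a /= arc_posK //.
case: ifP => [ce|_]; last by rewrite oppr0 !if_same addr0.
have [h1 h2] := hpos e ce; rewrite !coeffU !mul1r.
have aE u : 0 <= u <= len e -> (arc e u == arc e s) = (u == s).
  by move=> hu; apply/eqP/eqP => [/arc_inj ->|->].
rewrite !aE //; move: h2; rewrite /fire_pos.
have /andP[s0 sl] := hs; have /andP[p0 pl] := h1.
case: ifP => tB /andP[q0 ql].
  have <- := @jump_sum s (pos e) (pos e + eps) (len e); rewrite ?hs ?p0 ?ql ?lerDl ?e0 //.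
  by case: ifP => _; case: ifP => _; rewrite ?oppr0 ?opprK ?addr0 ?sub0r ?subr0 ?add0r ?opprB // addrC.
rewrite -opprB.
have <- := @jump_sum s (pos e - eps) (pos e) (len e); rewrite ?hs ?q0 ?pl ?gerBl ?e0 //.
case: ifP => _; case: ifP => _; rewrite ?oppr0 ?opprK ?addr0 ?sub0r ?subr0 ?add0r ?opprB //.
by rewrite opprK.
Qed.

End Firing.

(** * Principal divisors have degree 0 *)

Section Degree.
Context {R : realType} {Gamma : metricType R}.

Lemma affine_slope_unique (m m' : int) (c c' rho : R) : 0 < rho ->
  (forall t : R, 0 < t < rho -> c + m%:~R * t = c' + m'%:~R * t) -> m = m' /\ c = c'.
Proof.
move=> rho0 h.
have h1 := h (rho / 2) (ltac:(by apply/andP; split; lra)).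
have h2 := h (rho / 4) (ltac:(by apply/andP; split; lra)).
have mm : (m%:~R : R) = m'%:~R.
  have : ((m%:~R : R) - m'%:~R) * rho = 0.
    move: h1 h2; set x := m%:~R; set y := m'%:~R; nra.
  by move/eqP; rewrite mulf_eq0 subr_eq0 (gt_eqF rho0) orbF => /eqP.
by split; [exact: intr_inj mm|move: h1; rewrite mm => /addIr].
Qed.

Section Model.
Variable M : model Gamma.
Hypothesis valencyP : forall p : Gamma, exists n, has_valency p n.

(** At an interior point the two outgoing slopes are opposite, so [phi] is affine nearby; the slope,
    and then the intercept, is locally constant along the arc. *)
Lemma harmonic_on_arc (phi : Gamma -> R) (e : edge M) :
  (forall s, 0 < s < len e -> has_incoming_slope_sum phi (arc e s) 0) ->
  exists (m : int) (c : R), forall s, 0 < s < len e ->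
    phi (arc e s) = c + m%:~R * s.
Proof.
move=> harm; have l0 := len_gt0 e.
have loc s : exists m : int, 0 < s < len e -> exists2 rho : R, 0 < rho &
    forall u, `|u - s| < rho -> phi (arc e u) = phi (arc e s) + m%:~R * (u - s).
  have [hs|hs] := pselect (0 < s < len e); last by exists 0 => /hs.
  have hs' : 0 <= s <= len e by case/andP: hs => /ltW -> /ltW ->.
  have [a [+ [rho rho0 ha]]] := germs_incoming_slope M valencyP (harm s hs).
  rewrite germs_interior // big_setU1 /=; last by rewrite finset.in_set1 xpair_eqE andbF.
  rewrite big_set1 => /eqP; rewrite eq_sym oppr_eq0 addr_eq0 => /eqP a0.
  have in1 b : (e, b) \in germs M (arc e s).
    by rewrite germs_interior // !finset.inE !xpair_eqE eqxx; case: b.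
  exists (a (e, true)) => _; exists rho => // u us.
  have [su|us'] := leP s u.
    have := ha e true (in1 true) (u - s); rewrite arc_posK // mul1r addrCA subrr addr0.
    by apply; rewrite subr_ge0 su; move: us; rewrite ger0_norm // subr_ge0.
  have := ha e false (in1 false) (s - u); rewrite arc_posK // mulN1r opprB addrCA subrr addr0.
  rewrite a0 rmorphN mulNr -mulrN opprB; apply.
  by rewrite subr_ge0 (ltW us') /=; move: us; rewrite distrC gtr0_norm // subr_gt0.
have [m hm] := choice loc.
pose l2 : R := len e / 2.
have hl2 : 0 < l2 < len e by rewrite divr_gt0 //= ltr_pdivrMr // ltr_pMr // ltr1n.
have between s x : 0 < s < len e -> Num.min l2 s <= x <= Num.max l2 s -> 0 < x < len e.
  case/andP: hl2 => a1 a2 /andP[a3 a4].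
  by rewrite ge_min le_max => /andP[/orP[]h1 /orP[]h2]; apply/andP; split; lra.
have mE s : 0 < s < len e -> m s = m l2.
  move=> hs; apply/esym.
  apply: (@locally_constant R _ m [set s | 0 < s < len e]) => [x hx|x]; last exact: between.
  have [rho rho0 hr] := hm x hx; exists (rho / 2); first by rewrite divr_gt0.
  move=> y hy xy; have [rho' rho'0 hr'] := hm y hy.
  have mn : 0 < Num.min rho' (rho / 2) by rewrite lt_min rho'0 divr_gt0.
  have [] // := @affine_slope_unique (m y) (m x) (phi (arc e y)) (phi (arc e y)) _ mn.
  move=> t; rewrite lt_min => /and3P[t0 t1 t2].
  have -> : (m y)%:~R * t = (m y)%:~R * (y + t - y) by congr (_ * _); ring.
  rewrite -hr'; last by rewrite addrAC subrr add0r gtr0_norm.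
  rewrite hr; last first.
    rewrite (_ : y + t - x = (y - x) + t); last by ring.
    apply: le_lt_trans (ler_normD _ _) _; rewrite [`|t|]gtr0_norm //.
    by rewrite (splitr rho) ltrD.
  rewrite (hr y); last by apply: lt_trans xy _; rewrite ltr_pdivrMr // ltr_pMr // ltr1n.
  by ring.
exists (m l2), (phi (arc e l2) - (m l2)%:~R * l2) => s hs.
suff -> : phi (arc e l2) - (m l2)%:~R * l2 = phi (arc e s) - (m l2)%:~R * s by rewrite subrK.
apply: (@locally_constant R _ (fun s => phi (arc e s) - (m l2)%:~R * s) [set s | 0 < s < len e]) => [x hx|x].
  have [rho rho0 hr] := hm x hx; exists rho => // y hy xy.
  by rewrite hr // mE //; ring.
exact: between.
Qed.

End Model.

(** In a model having the support of [D] among its vertices, [phi] is affine on every arc, and the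
    outgoing slopes at the two ends of an arc cancel. *)
Lemma is_div_deg0 (phi : Gamma -> R) (D : {freeg Gamma / int}) :
  is_metric_graph Gamma -> is_div phi D -> deg D = 0.
Proof.
move=> mG hphi; have [_ _ _ valP] := mG.
have [M hM] := model_exists (dom D) mG.
have D0 e s : 0 < s < len e -> coeff (arc (m := M) e s) D = 0.
  move=> hs; apply: coeff_outdom; apply/negP => /hM[v]; exact: arc_vtx.
have ex e : exists m : int, exists c : R, forall s, 0 < s < len e ->
    phi (arc (m := M) e s) = c + m%:~R * s.
  by apply: (harmonic_on_arc valP) => s hs; rewrite -(D0 e s hs); exact: hphi.
have [m hm] := choice ex.
have vD v : coeff (vtx (m := M) v) D =
    - (\sum_e ((if src e == v then m e else 0) - (if tgt e == v then m e else 0))).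
  have [a [-> [rho rho0 ha]]] := germs_incoming_slope M valP (hphi (vtx v)).
  congr (- _).
  transitivity (\sum_e \sum_(b | (e, b) \in germs M (vtx v)) a (e, b)).
    by rewrite pair_big_dep; apply: eq_big => -[e b].
  apply: eq_bigr => e _; have l0 := len_gt0 e; have [c hc] := hm e.
  have h0 : 0 <= (0 : R) <= len e by rewrite lexx ltW.
  have hl : 0 <= len e <= len e by rewrite lexx ltW.
  rewrite big_mkcond big_bool /=.
  have at' : (e, true) \in germs M (vtx v) -> src e = v /\ a (e, true) = m e.
    move=> eb; move: (eb); rewrite finset.in_set /= => /asboolP[[s /= hs sv]].
    rewrite -sv arc_posK // => sl; have s0 : s = 0.
      apply/eqP; apply: contraPT sv => s0; apply: arc_vtx.
      by rewrite sl lt_neqAle eq_sym s0; case/andP: hs => ->.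
    have sv' : src e = v by apply: (@vtx_inj _ _ M); rewrite -arc_src -s0.
    split=> //; have := ha e true eb; rewrite -sv arc_posK // s0 => ha'.
    have mn : 0 < Num.min rho (len e) by rewrite lt_min rho0.
    have [] // := @affine_slope_unique (a (e, true)) (m e) (phi (arc e 0)) c _ mn.
    move=> t; rewrite lt_min => /and3P[t0 t1 t2]; rewrite -hc ?t0 //.
    by rewrite -ha' ?(ltW t0) // mul1r add0r.
  have af : (e, false) \in germs M (vtx v) -> tgt e = v /\ a (e, false) = - m e.
    move=> eb; move: (eb); rewrite finset.in_set /= => /asboolP[[s /= hs sv]].
    rewrite -sv arc_posK // => sl; have s0 : s = len e.
      apply/eqP; apply: contraPT sv => s0; apply: arc_vtx.
      by rewrite sl lt_neqAle s0; case/andP: hs => _ ->.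
    have sv' : tgt e = v by apply: (@vtx_inj _ _ M); rewrite -arc_tgt -s0.
    split=> //; have := ha e false eb; rewrite -sv arc_posK // s0 => ha'.
    have mn : 0 < Num.min rho (len e) by rewrite lt_min rho0.
    have [] // := @affine_slope_unique (a (e, false)) (- m e) (phi (arc e (len e)))
      (c + (m e)%:~R * len e) _ mn.
    move=> t; rewrite lt_min => /and3P[t0 t1 t2]; rewrite -ha' ?(ltW t0) //.
    rewrite mulN1r hc; last by apply/andP; split; lra.
    by rewrite rmorphN /=; ring.
  have te : ((e, true) \in germs M (vtx v)) = (src e == v).
    apply/idP/eqP => [/at'[] //|<-]; rewrite -arc_src mem_germs //.
  have fe : ((e, false) \in germs M (vtx v)) = (tgt e == v).
    apply/idP/eqP => [/af[] //|<-]; rewrite -arc_tgt mem_germs //.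
  rewrite te fe in at' af *; congr (_ + _).
    by case: eqP at' => // _ /(_ isT)[].
  by case: eqP af => [_ /(_ isT)[]|_ _] //; rewrite oppr0.
have DE : D = \sum_v << coeff (vtx (m := M) v) D *g vtx v >>.
  apply/eqP/freeg_eqP => x; rewrite raddf_sum /=.
  under eq_bigr do rewrite coeffU.
  have [[v ->]|[e [s [hs ->]]]] := model_cover M x.
    rewrite (bigD1 v) //= eqxx mulr1 big1 ?addr0 // => w wv.
    by rewrite (inj_eq (@vtx_inj _ _ M)) (negbTE wv) mulr0.
  rewrite D0 // big1 // => v _; case: eqP => [/esym/arc_vtx|]; last by rewrite mulr0.
  by case/(_ hs).
rewrite DE raddf_sum /=; under eq_bigr do rewrite degU vD.
rewrite sumrN exchange_big /= big1 ?oppr0 // => e _.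
have delta (u : vert M) (k : int) : \sum_v (if u == v then k else 0) = k.
  rewrite (bigD1 u) //= eqxx big1 ?addr0 // => v.
  by rewrite eq_sym => /negbTE ->.
by rewrite sumrB !delta subrr.
Qed.

End Degree.

(** * Moving chips to a semibreak divisor *)

Section ChipMoving.
Context {R : realType} {Gamma : metricType R} (M : model Gamma).
Hypothesis valencyP : forall p : Gamma, exists n, has_valency p n.
Local Notation V := (vert M).
Local Notation E := (edge M).
Local Notation src := (@src _ _ M).
Local Notation tgt := (@tgt _ _ M).
Local Notation connecting := (connecting src tgt).
Local Notation crossing := (crossing src tgt).
Implicit Types (S : {set E}) (B : {set V}) (pos : E -> R).

(** The vertices reachable from [u], with the open arcs between them, form the set [X]; by
    [near_arcs] it is open and closed. *)
Lemma model_connecting : connected [set: Gamma] -> connecting [set: E]%SET.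
Proof.
move=> conn u v; apply: contrapT => uv.
pose A : {set V} := [set w | connect (joined src tgt [set: E]%SET) u w]%SET.
have stA e : (src e \in A) = (tgt e \in A).
  have st : connect (joined src tgt [set: E]%SET) (src e) (tgt e).
    by apply: joined_edge (endsP _ _ e); rewrite finset.in_setT.
  rewrite !finset.in_set; apply/idP/idP => h; first exact: connect_trans h st.
  by apply: connect_trans h _; rewrite joined_connect_sym.
pose X := [set x : Gamma | (exists2 w, w \in A & x = vtx w) \/
  exists e s, [/\ 0 < s < len e, src e \in A & x = arc e s]].
have onarc e s : 0 <= s <= len e -> X (arc e s) <-> src e \in A.
  move=> /andP[]; rewrite le_eqVlt => /predU1P[<- _|s0].
    rewrite arc_src; split=> [[[w wA /vtx_inj ->] //|[e' [s' [hs _ /esym/arc_vtx]]]]|h].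
      by case/(_ hs).
    by left; exists (src e).
  rewrite le_eqVlt => /predU1P[->|sl].
    rewrite arc_tgt stA; split=> [[[w wA /vtx_inj ->] //|[e' [s' [hs _ /esym/arc_vtx]]]]|h].
      by case/(_ hs).
    by left; exists (tgt e).
  have hs : 0 < s < len e by rewrite s0.
  split=> [[[w wA /arc_vtx]|[e' [s' [hs' h ss]]]]|h]; first by case/(_ hs).
    by rewrite (arc_disjoint hs hs' ss).
  by right; exists e, s.
have loc x : \forall y \near x, X y <-> X x.
  have [rho rho0 hr] := near_arcs M x.
  apply/nbhs_ballP; exists rho => // y; rewrite ballEmdist /= => /hr.
  case=> [->//|[e [s [s' [hs hs' -> ->]]]]].
  have h1 := onarc e s hs; have h2 := onarc e s' hs'.
  by split=> [/h2/h1|/h1/h2].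
have oX : open X.
  by rewrite openE => x Xx; apply: filterS (loc x) => y [_]; exact.
have cX : closed X.
  rewrite -openC openE => x nXx; apply: filterS (loc x) => y [h _] Xy.
  exact: nXx (h Xy).
have XT : X = [set: Gamma].
  apply: conn.
  - by exists (vtx u); left; exists u; rewrite // finset.in_set connect0.
  - by exists X => //; rewrite setTI.
  - by exists X => //; rewrite setTI.
have : X (vtx v) by rewrite XT.
case=> [[w + /vtx_inj vw]|[e [s [hs _ /esym/arc_vtx]]]]; last by case/(_ hs).
by rewrite -vw finset.in_set; exact: uv.
Qed.

(** [S] is the set of free edges: each edge off [S] carries one chip, and the values of [pos] on [S]
    are not read. *)
Definition chips S pos : {freeg Gamma / int} :=
  \sum_(e | e \notin S) << arc e (pos e) >>.

Definition on_arcs S pos : Prop := forall e, e \notin S -> 0 <= pos e <= len e.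

Definition principal (D : {freeg Gamma / int}) : Prop := exists phi, is_div phi D.

Lemma principal0 : principal 0.
Proof.
exists (fun=> 0) => p; have [n [r [f fC]]] := valencyP p.
exists n, r, f, (fun=> 0); split => //; first by move=> k t _; rewrite mul0r addr0.
by rewrite big1 // oppr0 coeff0.
Qed.

Lemma principalD D D' : principal D -> principal D' -> principal (D + D').
Proof.
by move=> [phi h] [psi h']; exists (fun x => phi x + psi x); exact: is_divD.
Qed.

Definition end_pos (x : V) (e : E) : R := if src e == x then 0 else len e.

Lemma arc_end_pos x e : (src e == x) || (tgt e == x) ->
  arc e (end_pos x e) = vtx x.
Proof.
rewrite /end_pos; case: eqP => [<- _|_ /= /eqP <-]; first exact: arc_src.
exact: arc_tgt.
Qed.

Lemma end_pos_itv x e : 0 <= end_pos x e <= len e.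
Proof.
have := len_gt0 e => /ltW l0.
by rewrite /end_pos; case: eqP => _; rewrite lexx l0.
Qed.

Lemma chips_cut S pos x h : h \in S -> (src h == x) || (tgt h == x) ->
  chips (S :\ h)%SET (fun e => if e == h then end_pos x e else pos e) =
  chips S pos + << vtx x >>.
Proof.
move=> hS hx; rewrite /chips (bigD1 h) /=; last by rewrite !finset.inE eqxx.
rewrite eqxx arc_end_pos // addrC; congr (_ + _); apply: eq_big => e.
  rewrite !finset.inE negb_and negbK; case: eqP => [->|_]; last by rewrite andbT.
  by rewrite hS.
by case/andP => _ /negbTE ->.
Qed.

Lemma on_arcs_cut S pos x h : on_arcs S pos ->
  on_arcs (S :\ h)%SET (fun e => if e == h then end_pos x e else pos e).
Proof.
move=> ok e; rewrite !finset.inE negb_and negbK; case: eqP => [->|_] /=.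
  by move=> _; exact: end_pos_itv.
exact: ok.
Qed.

(** The free chip is at [x], the only vertex at which free edges leave [B], and the fixed edge [e0]
    in [B] witnesses a cycle. Each round replaces [B] by a subset that misses [x], whence the
    induction on the bound [n]. *)
Lemma move_chip n S pos x e0 B : (#|B| <= n)%N ->
  connecting S -> on_arcs S pos -> e0 \in S -> connecting (S :\ e0)%SET ->
  x \in B -> src e0 \in B -> tgt e0 \in B ->
  (forall e u v, e \in S -> ends src tgt e u v -> u \in B -> v \notin B -> u = x) ->
  exists S' pos', [/\ #|S| = #|S'|.+1, connecting S', on_arcs S' pos' &
    principal (chips S' pos' - (chips S pos + << vtx x >>))].
Proof.
elim: n S pos x B => [|n IH] S pos x B.
  by rewrite leqn0 cards_eq0 => /eqP -> _ _ _ _; rewrite finset.in_set0.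
move=> Bn cS ok e0S cS0 xB s0B t0B crossB.
(* If an edge at [x] can be removed, the chip rests on it, at its end [x]. *)
have [[e [eS ex ce]]|noremove] := pselect (exists e,
    [/\ e \in S, (src e == x) || (tgt e == x) & connecting (S :\ e)%SET]).
  exists (S :\ e)%SET, (fun e' => if e' == e then end_pos x e' else pos e').
  split => //; first by rewrite (cardsD1 e S) eS.
    exact: on_arcs_cut.
  by rewrite chips_cut // subrr; exact: principal0.
have [|B' [h [B'B s0B' t0B' hS [hB' hx huniq]]]] :=
    @narrow_cut _ _ src tgt S B x e0 cS e0S cS0 xB s0B t0B crossB.
  by move=> e eS ex ce; apply: noremove; exists e.
(* [S0] need not connect the graph; it describes the configuration in which every edge crossing [B']
   carries a chip, the new one sitting on [h] at [x]. *)
pose S0 := (S :\ h)%SET.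
pose pos0 e := if e == h then end_pos x e else pos e.
have ok0 : on_arcs S0 pos0 by exact: on_arcs_cut.
have crossS0 e : crossing B' e -> e \notin S0.
  move=> eB'; rewrite !finset.inE negb_and negbK.
  by have [eS|_] := boolP (e \in S); [rewrite (huniq e) // eqxx|rewrite orbT].
pose rem e := if tgt e \in B' then len e - pos0 e else pos0 e.
(* [eps] is the least distance that a chip of the cut still has to travel to [B'], possibly 0; until
   then all chips remain on their closed arcs. *)
have [|eps] := @seq_least R [seq rem e | e <- enum E & crossing B' e] (rem h).
  by apply: map_f; rewrite mem_filter hB' mem_enum.
case/mapP => e1; rewrite mem_filter => /andP[e1B' _] -> {eps} epsmin.
set eps := rem e1 in epsmin.
have remE e : crossing B' e -> eps <= rem e.
  by move=> eB'; apply/epsmin/map_f; rewrite mem_filter eB' mem_enum.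
have eps0 : 0 <= eps.
  have /andP[a1 a2] := ok0 e1 (crossS0 _ e1B').
  by rewrite /eps /rem; case: ifP => _ //; rewrite subr_ge0.
have firing e : crossing B' e -> 0 <= pos0 e <= len e /\
    0 <= fire_pos B' pos0 eps e <= len e.
  move=> eB'; have := ok0 e (crossS0 _ eB'); split => //.
  have := remE e eB'; rewrite /rem /fire_pos; case/andP: H => a1 a2.
  by case: ifP => _ h1; apply/andP; split; lra.
have [phi hphi] := fire_lin_equiv valencyP eps0 firing.
pose pos1 e := if crossing B' e then fire_pos B' pos0 eps e else pos0 e.
pose x' := if tgt e1 \in B' then tgt e1 else src e1.
have x'B' : x' \in B'.
  by rewrite /x'; case: ifP => // tB; move: e1B'; rewrite /crossing tB addbF.
have e1x' : arc e1 (pos1 e1) = vtx x'.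
  rewrite /pos1 e1B' /fire_pos /x' /eps /rem; case: (tgt e1 \in B').
    by rewrite [pos0 e1 + _]addrC subrK arc_tgt.
  by rewrite subrr arc_src.
have e1S0 := crossS0 _ e1B'.
(* The chip of [e1] has arrived at [x'] and becomes the free one, so [e1] is free again; it may be
   [h] itself. *)
pose S1 := (e1 |: S0)%SET.
have e0cross : ~~ crossing B' e0 by rewrite /crossing s0B' t0B'.
have e0h : e0 != h by apply: contraNneq e0cross => ->.
have e0e1 : e0 != e1 by apply: contraNneq e0cross => ->.
have S1S0 : chips S0 pos1 = chips S1 pos1 + << vtx x' >>.
  rewrite /chips (bigD1 e1) //= e1x' addrC; congr (_ + _); apply: eq_bigl => e.
  by rewrite !finset.inE !negb_or andbC.
have cS1 : connecting S1 by exact: exchange hB' e1B' huniq.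
(* [e0] stays removable, by the same exchange carried out in [S :\ e0]. *)
have cS10 : connecting (S1 :\ e0)%SET.
  have -> : (S1 :\ e0 = e1 |: (S :\ e0) :\ h)%SET.
    apply/setP => e; rewrite !finset.inE.
    have [->|ne1] := eqVneq e e1; first by rewrite eq_sym e0e1.
    by case: (e == e0); case: (e == h); rewrite /= ?andbF.
  apply: exchange hB' e1B' _ => // e; rewrite !finset.inE => /andP[_ eS].
  exact: huniq.
have cardS1 : #|S1| = #|S|.
  by rewrite /S1 cardsU1 e1S0 (cardsD1 h S) hS.
have ok1 : on_arcs S1 pos1.
  move=> e; rewrite finset.inE negb_or => /andP[_ eS0]; rewrite /pos1.
  by case: ifP => [/firing[]|_] //; exact: ok0.
have crossS1 e u v : e \in S1 -> ends src tgt e u v -> u \in B' -> v \notin B' -> u = x'.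
  move=> eS1 euv uB' vB'; have eB' := ends_crossing euv uB' vB'.
  have ee : e = e1.
    move: eS1; rewrite finset.inE => /orP[|eS0]; first by rewrite finset.inE => /eqP.
    by move: (crossS0 e eB'); rewrite eS0.
  rewrite ee in euv; rewrite /x'; case/orP: euv => /andP[/eqP es /eqP et].
    by rewrite es et (negbTE vB').
  by rewrite et uB'.
have [||S' [pos' [cardS' cS' ok' pr']]] := IH S1 pos1 x' B' _ cS1 ok1 _ cS10 x'B' s0B' t0B' crossS1.
- rewrite -ltnS; apply: leq_trans Bn; apply: leq_ltn_trans (subset_leq_card B'B) _.
  by rewrite (cardsD1 x B) xB.
- by rewrite !finset.inE e0S e0h orbT.
exists S', pos'; split => //; first by rewrite -cardS1.
suff -> : chips S' pos' - (chips S pos + << vtx x >>) =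
    (chips S' pos' - (chips S1 pos1 + << vtx x' >>)) +
    (\sum_(e | crossing B' e) << arc e (fire_pos B' pos0 eps e) >> -
     \sum_(e | crossing B' e) << arc e (pos0 e) >>).
  by apply: principalD => //; exists phi.
rewrite -S1S0 -(chips_cut pos hS hx) -/S0 -/pos0.
suff <- : chips S0 pos1 - chips S0 pos0 =
    \sum_(e | crossing B' e) << arc e (fire_pos B' pos0 eps e) >> -
     \sum_(e | crossing B' e) << arc e (pos0 e) >>.
  set a := chips _ _; set b := chips _ _; set c := chips _ _.
  by freeg_ring.
rewrite /chips !(bigID (crossing B') (fun e => e \notin S0)) /=.
have cE e : (e \notin S0) && crossing B' e = crossing B' e.
  by apply: andb_idl; exact: crossS0.
rewrite !(eq_bigl _ _ cE).
rewrite (eq_bigr (fun e => << arc e (fire_pos B' pos0 eps e) >>)); last first.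
  by move=> e eB'; rewrite /pos1 eB'.
rewrite (eq_bigr (fun e => << arc e (pos0 e) >>) (P := fun e => (e \notin S0) && ~~ crossing B' e) (F1 := fun e => << arc e (pos1 e) >>)); last first.
  by move=> e /andP[_ /negbTE eB']; rewrite /pos1 eB'.
set a := \sum_(e | crossing B' e) << arc e (fire_pos _ _ _ _) >>.
set b := \sum_(e | crossing B' e) _; set c := \sum_(e | _ && _) _.
by freeg_ring.
Qed.

(** The bound allows #|E| - #|V| + 1 chips, the number of edges off a spanning tree. Each chip
    starts with [B] the whole vertex set, which no edge leaves. *)
Lemma place_chips (xs : seq V) : connected [set: Gamma] ->
  (#|V| + size xs <= #|E|.+1)%N ->
  exists S pos, [/\ (#|S| + size xs = #|E|)%N, connecting S, on_arcs S pos &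
    principal (chips S pos - \sum_(x <- xs) << vtx x >>)].
Proof.
move=> conn; elim: xs => [_|x xs IH] /=.
  exists [set: E]%SET, (fun=> 0); split.
  - by rewrite addn0 cardsT.
  - exact: model_connecting.
  - by move=> e; rewrite finset.in_setT.
  - rewrite big_nil subr0 /chips big_pred0; first exact: principal0.
    by move=> e; rewrite finset.in_setT.
rewrite addnS ltnS => h; have [|S [pos [cS conS ok pr]]] := IH; first exact: leqW.
(* Before the chip at [x] is placed, at least #|V| edges are still free, hence some free edge is not
   a bridge. *)
have VS : (#|V| <= #|S|)%N by rewrite -(leq_add2r (size xs)) cS.
have [e0 e0S ce0] := removable_edge x conS VS.
have [||||S' [pos' [cS' conS' ok' pr']]] :=
   @move_chip #|[set: V]%SET| S pos x e0 [set: V]%SET (leqnn _) conS ok e0S ce0;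
   rewrite ?finset.in_setT //.
  by move=> e u v _ _ _; rewrite finset.in_setT.
exists S', pos'; split => //; first by rewrite addnS -addSn -cS'.
have := principalD pr' pr; rewrite big_cons.
suff -> : chips S' pos' - (<< vtx x >> + \sum_(j <- xs) << vtx j >>) =
  chips S' pos' - (chips S pos + << vtx x >>) + (chips S pos - \sum_(x <- xs) << vtx x >>) by [].
set a := chips S' _; set b := chips S _; set c := << _ >>; set d := \sum_(_ <- _) _.
freeg_ring.
Qed.

Lemma effective_sum (I : finType) (P : pred I) (p : I -> Gamma) :
  effective (\sum_(i | P i) << p i >>).
Proof.
apply/fgposP => z; rewrite raddf_sum /=; apply: sumr_ge0 => i _.
by rewrite coeffU mul1r.
Qed.

(** A spanning tree inside [S] avoids all edges that carry chips. The open arcs off the tree are the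
    required segments, since their complement is the realised tree. *)
Lemma chips_semibreak S pos g : has_genus (R := R) Gamma g ->
  V -> connecting S -> on_arcs S pos -> semibreak_divisor g (chips S pos).
Proof.
move=> hg root cS ok; split; first exact: effective_sum.
have [T TS tT] := spanning_tree root cS.
have gE := genus_cotree valencyP tT hg; rewrite {g hg}gE.
(* Free edges off the tree complete the break divisor by an arbitrary point of their closure, here
   the source. *)
pose pos1 e := if e \in S then 0 else pos e.
have ok1 e : 0 <= pos1 e <= len e.
  rewrite /pos1; case: ifP => [_|/negbT /ok //].
  by rewrite lexx ltW // len_gt0.
exists (\sum_(i < #|~: T|%SET) << arc (enum_val i) (pos1 (enum_val i)) >>).
  exists (fun i => arc (enum_val i) (pos1 (enum_val i))), (fun i => open_arc (enum_val i)).
  split => //.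
  - by move=> i; exact: open_arc_segment.
  - move=> i j _ _ [x [[s hs <-] [s' hs' ss]]]; apply: enum_val_inj.
    exact: arc_disjoint hs hs' (esym ss).
  - by move=> i; exact: closure_open_arc.
  - have -> : (~` \bigcup_(i in [set: 'I_#|~: T|%SET]) open_arc (enum_val i)) = subgraph [set: V]%SET T.
      rewrite subgraph_cotree; congr (~` _); apply/seteqP; split => x.
        move=> [i _ xi]; exists (enum_val i) => //=.
        by have := enum_valP i; rewrite finset.in_setC.
      move=> [e /= eT xe]; have eT' : e \in (~: T)%SET by rewrite finset.in_setC.
      by exists (enum_rank_in eT' e) => //; rewrite enum_rankK_in.
    by have [] := tree_contractible tT.
rewrite -(big_enum_val (fun e : E => << arc e (pos1 e) >> : {freeg Gamma / int})).
apply/fgleP => z; rewrite /chips !raddf_sum /=.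
rewrite [leRHS](bigID (mem S)) /= -[leLHS]add0r lerD //.
  by apply: sumr_ge0 => e _; rewrite coeffU mul1r.
rewrite [leRHS](eq_bigl (fun e => e \notin S)) /=; last first.
  move=> e; rewrite finset.in_setC; apply: andb_idl; apply: contra.
  exact: (fintype.subsetP TS).
by apply: ler_sum => e /negbTE eS; rewrite /pos1 eS.
Qed.

End ChipMoving.

Lemma effective_seq (R : realType) (Gamma : metricType R) n
  (D : {freeg Gamma / int}) : effective D -> deg D = n%:Z ->
  exists2 xs : seq Gamma, size xs = n & D = \sum_(x <- xs) << x >>.
Proof.
elim: n D => [|n IH] D eD dD.
  by exists [::] => //; rewrite big_nil; exact: fgpos_eq0P.
have /eqP D0 : D <> 0 by move=> D0; move: dD; rewrite D0 deg0.
have [x xD] : exists x, x \in dom D.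
  case E : (dom D) => [|x l]; last by exists x; rewrite mem_head.
  by move/eqP: E; rewrite dom_eq0 (negbTE D0).
have [||xs sxs DE] := IH (D - << x >>).
- apply/fgposP => z; rewrite coeffB coeffU mul1r subr_ge0.
  have := (fgposP _ eD) z; case: eqP => [<- _|_] //=.
  by move: xD; rewrite mem_dom; have := (fgposP _ eD) x; case: (coeff x D) => [[|?]|?].
- by rewrite degB dD degU -addn1 PoszD addrK.
by exists (x :: xs); rewrite /= ?sxs // big_cons -DE addrC subrK.
Qed.

Theorem theoremA (R : realType) (Gamma : metricType R) (g d : nat)
    (D : {freeg Gamma / int}) :
  is_metric_graph Gamma ->
  has_genus (R := R) Gamma g ->
  ~ is_point Gamma ->
  ~ is_circle (R := R) Gamma ->
  (0 <= d <= g)%N ->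
  deg D = d%:Z ->
  complete_linear_system D !=set0 ->
  exists2 E, complete_linear_system D E & semibreak_divisor g E.
Proof.
move=> mG hg _ _ /andP[_ dg] dD [E0 [eE0 [phi0 _ hphi0]]].
have [[x0 _] _ conn valP] := mG.
have dE0 : deg E0 = d%:Z.
  by have := is_div_deg0 mG hphi0; rewrite degB dD => /eqP; rewrite subr_eq0 => /eqP.
have [xs sxs E0E] := effective_seq eE0 dE0.
have [M hM] := model_exists xs mG.
have [root _] : exists v : vert M, True.
  by have [[v _]|[e _]] := model_cover M x0; [exists v|exists (src e)].
have [vs vsE] : exists vs : seq (vert M), xs = map (@vtx _ _ M) vs.
  elim: (xs) hM => [|x l IH] h; first by exists [::].
  have [v xv] := h x (mem_head _ _).
  have [|vs lE] := IH; first by move=> y yl; apply: h; rewrite inE yl orbT.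
  by exists (v :: vs); rewrite /= -xv lE.
have [T _ tT] := spanning_tree root (@model_connecting R Gamma M conn).
have gE := genus_cotree valP tT hg.
(* With #|V| = #|T| + 1 and #|E| = #|T| + g the bound of [place_chips] becomes d <= g. *)
have size_le : (#|vert M| + size vs <= #|edge M|.+1)%N.
  have -> : size vs = d by rewrite -sxs vsE size_map.
  have := tree_card tT; rewrite cardsT => ->; rewrite addSn ltnS.
  by rewrite -(cardsC T) leq_add2l -gE.
have [S [pos [_ cS ok [phi hphi]]]] := place_chips valP conn size_le.
exists (chips S pos); last exact: chips_semibreak.
split; first exact: effective_sum.
apply: (@is_div_lin_equiv _ _ (fun x => phi x + phi0 x)).
  exact: branch_points_finite valP.
have -> : chips S pos - D = (chips S pos - \sum_(x <- vs) << vtx x >>) + (E0 - D).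
  rewrite E0E vsE big_map; set a := chips _ _; set b := \sum_(_ <- _) _.
  by freeg_ring.
exact: is_divD.
Qed.
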